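(* Let $\mathfrak g$ be a complete Lie-graph algebra. The graph exponential map $\exp\colon F_1\mathfrak g_0\to \mathbf 1+F_1\mathfrak g_0$ and its inverse, the graph logarithm map $\log$, are filtered isomorphisms of groups (thus homeomorphisms) between the gauge group and the deformation gauge group: $$\exp\ :\ \Gamma=\big(F_1\mathfrak g_0,\mathrm{BCH},0\big)\ \rightleftarrows\ \big(\mathbf 1+F_1\mathfrak g_0,\circledcirc,\mathbf 1\big)=\mathfrak G\ :\ \log .$$
   Context: Fix a field $k$ of characteristic $0$. A *directed simple graph* is a finite non-empty connected graph whose edges are directed, without directed cycles (edges go from top to bottom: the source of an edge lies above its target), without external legs, with at most one edge between any two vertices. With vertices labelled bijectively by $1,\dots,n$ (where $n=|\mathsf g|$ is the number of vertices) the set of isomorphism classes is $\mathsf{dsGra}(n)$. The operad $\mathrm{Lie}\text{-}\mathrm{gra}$ has $\mathrm{Lie}\text{-}\mathrm{gra}(n)=k\,\mathsf{dsGra}(n)$ (symmetric groups permute labels, unit the one-vertex graph); $\mathsf g_1\circ_i\mathsf g_2$ is the sum of all graphs obtained by replacing vertex $i$ of $\mathsf g_1$ by $\mathsf g_2$ and, independently for each edge of $\mathsf g_1$ between a vertex $j$ and $i$, replacing this edge by edges (of the same direction) joining $j$ to all the vertices of some non-empty subset of the vertices of $\mathsf g_2$ (sum over all choices); the labels $1,\dots,i-1$ of $\mathsf g_1$ are kept, labels of $\mathsf g_2$ are shifted by $i-1$, remaining labels of $\mathsf g_1$ are shifted by $|\mathsf g_2|-1$. A *Lie-graph algebra* is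 an algebra over this operad in $\mathbb Z$-graded $k$-vector spaces. A *complete Lie-graph algebra* is a Lie-graph algebra $\mathfrak g$ with a degreewise descending filtration $\mathfrak g=F_0\mathfrak g\supset F_1\mathfrak g\supset\cdots$, complete ($\mathfrak g\cong\varprojlim_k\mathfrak g/F_k\mathfrak g$), such that every $\mathsf g\in\mathsf{dsGra}(n)$ maps $F_{i_1}\mathfrak g\otimes\cdots\otimes F_{i_n}\mathfrak g$ to $F_{i_1+\cdots+i_n}\mathfrak g$. $\mathfrak g_0$ is the degree $0$ part. *Bracket and gauge group.* $x\star y$ denotes the action of the two-vertex graph with bottom vertex labelled by $x$ and top vertex labelled by $y$; its commutator $[x,y]=x\star y-y\star x$ (on degree $0$ elements) is a Lie bracket. The gauge group is $\Gamma=(F_1\mathfrak g_0,\mathrm{BCH},0)$, filtered by $F_k\mathfrak g_0$, $k\ge1$, where $\mathrm{BCH}(x,y)=\log(e^xe^y)=x+y+\frac12[x,y]+\cdots$ is the Baker--Campbell--Hausdorff series for this bracket. *Deformation gauge group.* A $2$-leveled directed simple graph is a directed simple graph with unlabelled vertices, each placed on one of two ordered levels (a level may be empty), such that every edge goes from the upper to the lower level; up to isomorphism preserving levels. $\mathrm{Aut}(\mathsf g)$ is the group of vertex permutations preserving edges and levels. On the set $\mathbf 1+F_1\mathfrak g_0=\{\mathbf 1+x\mid x\in F_1\mathfrak g_0\}$ ($\mathbf 1$ a formal symbol), $$(\mathbf 1+x)\circledcirc(\mathbf 1+y)=\mathbf 1+\sum_{\mathsf g\ 2\text{-leveled}}\frac1{|\mathrm{Aut}(\mathsf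 g)|}\,\mathsf g(x,y),$$ where $\mathsf g(x,y)$ is the action of $\mathsf g$ with all bottom vertices labelled by $x$ and all top vertices labelled by $y$. This is a group $\mathfrak G$ with unit $\mathbf 1$, filtered by $\mathbf 1+F_k\mathfrak g_0$, $k\ge 1$. *Graph exponential.* $\exp(x)=\mathbf 1+\sum_{\mathsf g}\frac{\ell_{\mathsf g}}{|\mathsf g|!}\,\mathsf g(x)$, the sum running over isomorphism classes of directed simple graphs with unlabelled vertices, $\mathsf g(x)$ being the action of $\mathsf g$ with all vertices labelled by $x$, and $\ell_{\mathsf g}$ the number of total levelisations of $\mathsf g$: isomorphism classes of ways to place the vertices on $|\mathsf g|$ ordered levels, one vertex per level, each edge going from a higher to a lower level. The map $\exp\colon F_1\mathfrak g_0\to\mathbf 1+F_1\mathfrak g_0$ is bijective, and $\log$ denotes its inverse. *)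

(* Defs.v *)
From HB Require Import structures.
From mathcomp Require Import all_boot all_order all_algebra all_fingroup.
From Stdlib Require Import ClassicalEpsilon.

Set Implicit Arguments.
Unset Strict Implicit.
Unset Printing Implicit Defensive.

Import GRing.Theory.
Local Open Scope ring_scope.

(* An isomorphism class of graphs with vertices labelled bijectively by       *)
(* {0, ..., n-1} is the same thing as its set of edges on 'I_n; (a, b) \in E  *)
(* is an edge going down from a to b.  Parallel edges cannot occur in a set   *)
(* of pairs; loops and antiparallel edges are excluded by acyclicity.         *)
Definition acyclicg n (E : {set 'I_n * 'I_n}) :=
  [forall a, forall b, ((a, b) \in E) ==> ~~ connect [rel u v | (u, v) \in E] b a].

Definition connectedg n (E : {set 'I_n * 'I_n}) :=
  [forall a, forall b,
    connect [rel u v | ((u, v) \in E) || ((v, u) \in E)] a b].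

Definition is_dsgraph n (E : {set 'I_n * 'I_n}) :=
  [&& (0 < n)%N, acyclicg E & connectedg E].

Definition dsGra n := {E : {set 'I_n * 'I_n} | is_dsgraph E}.

Definition edge n (g : dsGra n) (a b : 'I_n) : bool := (a, b) \in val g.

Lemma is_dsgraph_vertex : is_dsgraph (set0 : {set 'I_1 * 'I_1}).
Proof.
apply/and3P; split=> //; first by apply/'forall_forallP => a b; rewrite inE.
by apply/'forall_forallP => a b; rewrite !ord1 connect0.
Qed.

Definition vertex_graph : dsGra 1 := Sub set0 is_dsgraph_vertex.

Definition bottom2 : 'I_2 := ord0.
Definition top2 : 'I_2 := ord_max.

Lemma is_dsgraph_edge : is_dsgraph [set (top2, bottom2)].
Proof.
apply/and3P; split=> //.
  apply/'forall_forallP => a b; apply/implyP; rewrite inE => /eqP[-> ->].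
  apply/negP => /connectP[[|c p] /=]; first by move=> _ /eqP.
  by rewrite inE => /andP[/eqP[]].
have two (c : 'I_2) : (c == top2) || (c == bottom2).
  by case: c => -[|[|c]] lt_c2.
apply/'forall_forallP => a b.
case/orP: (two a) => /eqP->; case/orP: (two b) => /eqP->;
  rewrite ?connect0 //; apply: connect1; by rewrite /= !inE eqxx ?orbT.
Qed.

Definition edge_graph : dsGra 2 := Sub [set (top2, bottom2)] is_dsgraph_edge.

Definition giso n (s : 'S_n) (g h : dsGra n) : bool :=
  [forall a, forall b, edge h (s a) (s b) == edge g a b].

(* g1 o_i g2 has (n1 + 1) + (n2 + 1) - 1 vertices; [origin i l] is the vertex *)
(* of g1 (inl) or of g2 (inr) which receives the label l after the shifts.    *)
Definition origin n1 n2 (i : 'I_n1.+1) (l : 'I_(n1 + n2).+1) :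
    'I_n1.+1 + 'I_n2.+1 :=
  if (l < i)%N then inl (inord l)
  else if (l <= i + n2)%N then inr (inord (l - i))
  else inl (inord (l - n2)).

Definition outer_label n1 n2 (i j : 'I_n1.+1) : 'I_(n1 + n2).+1 :=
  inord (if (j < i)%N then j : nat else (j + n2)%N).

Definition inner_label n1 n2 (i : 'I_n1.+1) (b : 'I_n2.+1) : 'I_(n1 + n2).+1 :=
  inord (i + b).

(* S j is the set of vertices of g2 to which j gets joined when the edge of   *)
(* g1 between j and i is replaced; it is irrelevant if there is no such edge. *)
Definition inserted_edge n1 n2 (g1 : dsGra n1.+1) (i : 'I_n1.+1)
    (g2 : dsGra n2.+1) (S : {ffun 'I_n1.+1 -> {set 'I_n2.+1}})
    (l m : 'I_(n1 + n2).+1) : bool :=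
  match origin i l, origin i m with
  | inl a, inl b => edge g1 a b
  | inr a, inr b => edge g2 a b
  | inl a, inr b => edge g1 a i && (b \in S a)
  | inr a, inl b => edge g1 i b && (a \in S b)
  end.

Definition is_insertion n1 n2 (g1 : dsGra n1.+1) (i : 'I_n1.+1)
    (g2 : dsGra n2.+1) (h : dsGra (n1 + n2).+1) : bool :=
  [exists S : {ffun 'I_n1.+1 -> {set 'I_n2.+1}},
     [forall j, (edge g1 j i || edge g1 i j) ==> (S j != set0)] &&
     [forall l, forall m, edge h l m == inserted_edge g1 i g2 S l m]].

Definition subspace (k : fieldType) (V : lmodType k) (P : V -> Prop) : Prop :=
  P 0 /\ forall (a : k) (x y : V), P x -> P y -> P (a *: x + y).

(* A Z-graded vector space, as the internal direct sum of the [homog d]. *)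
Record gradedSpace (k : fieldType) := GradedSpace {
  gspace :> lmodType k;
  homog : int -> gspace -> Prop;
  homog_subspace : forall d, subspace (homog d);
  homog_span : forall v : gspace,
    exists (s : seq int) (x : int -> gspace),
      (forall d, homog d (x d)) /\ v = \sum_(d <- s) x d;
  homog_direct : forall (s : seq int) (x : int -> gspace),
    uniq s -> (forall d, homog d (x d)) -> \sum_(d <- s) x d = 0 ->
    forall d, d \in s -> x d = 0
}.

Definition update (T : Type) n (x : {ffun 'I_n -> T}) (i : 'I_n) (u : T) :
  {ffun 'I_n -> T} := [ffun j => if j == i then u else x j].

(* Exponent of the Koszul sign of x_0 ... x_(n-1) |-> x_(s 0) ... x_(s (n-1)) *)
(* when x_i has degree d i.                                                   *)
Definition koszul n (s : 'S_n) (d : 'I_n -> int) : nat :=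
  (\sum_(p : 'I_n * 'I_n | (p.1 < p.2) && (s p.2 < s p.1))
     `|d (s p.1)| * `|d (s p.2)|)%N.

(* [act g x] is the action of g with vertex i labelled by x i.  The graphs    *)
(* have degree 0, so no sign occurs in [act_comp].                            *)
Record lieGraphAlg (k : fieldType) := LieGraphAlg {
  lgspace :> gradedSpace k;
  act : forall n, dsGra n -> {ffun 'I_n -> lgspace} -> lgspace;
  act_multilinear : forall n (g : dsGra n) (x : {ffun 'I_n -> lgspace})
      (i : 'I_n) (a : k) (u v : lgspace),
    act g (update x i (a *: u + v))
      = a *: act g (update x i u) + act g (update x i v);
  act_homog : forall n (g : dsGra n) (x : {ffun 'I_n -> lgspace})
      (d : 'I_n -> int),
    (forall i, homog (d i) (x i)) -> homog (\sum_i d i) (act g x);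
  act_unit : forall x : {ffun 'I_1 -> lgspace}, act vertex_graph x = x ord0;
  act_equivariant : forall n (s : 'S_n) (g h : dsGra n)
      (x : {ffun 'I_n -> lgspace}) (d : 'I_n -> int),
    giso s g h -> (forall i, homog (d i) (x i)) ->
    act h x = (-1) ^+ koszul s d *: act g [ffun a => x (s a)];
  act_comp : forall n1 n2 (g1 : dsGra n1.+1) (i : 'I_n1.+1)
      (g2 : dsGra n2.+1) (x : {ffun 'I_(n1 + n2).+1 -> lgspace}),
    act g1 [ffun j => if j == i then act g2 [ffun b => x (inner_label i b)]
                      else x (outer_label n2 i j)]
      = \sum_(h : dsGra (n1 + n2).+1 | is_insertion g1 i g2 h) act h x
}.

(* [fil p d] is F_p g_d.  The last two axioms on the filtration say that      *)
(* g_d -> lim_p g_d / F_p g_d is injective and surjective.                    *)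
Record completeLieGraphAlg (k : fieldType) := CompleteLieGraphAlg {
  clgalg :> lieGraphAlg k;
  fil : nat -> int -> clgalg -> Prop;
  fil_subspace : forall p d, subspace (fil p d);
  fil_full : forall d x, fil 0 d x <-> homog d x;
  fil_desc : forall p d x, fil p.+1 d x -> fil p d x;
  fil_act : forall n (g : dsGra n) (x : {ffun 'I_n -> clgalg})
      (p : 'I_n -> nat) (d : 'I_n -> int),
    (forall i, fil (p i) (d i) (x i)) ->
    fil (\sum_i p i)%N (\sum_i d i) (act g x);
  fil_separated : forall d x, (forall p, fil p d x) -> x = 0;
  fil_complete : forall d (v : nat -> clgalg),
    (forall p, homog d (v p)) -> (forall p, fil p d (v p.+1 - v p)) ->
    exists2 x, homog d x & forall p, fil p d (x - v p)
}.

Section InfiniteSums.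
Variables (k : fieldType) (g : completeLieGraphAlg k).

(* F_p g_0 *)
Definition F0 (p : nat) (x : g) : Prop := fil p 0 x.

Definition has_sum (u : nat -> g) (s : g) : Prop :=
  forall p, exists M, forall m, (M <= m)%N -> F0 p (s - \sum_(n < m) u n).

Definition infinite_sum (u : nat -> g) : g := epsilon (inhabits 0) (has_sum u).

End InfiniteSums.

(* Noncommutative power series in X and Y are the functions on words, where   *)
(* the letter X is [true] and the letter Y is [false].                        *)
Section NoncommutativeSeries.
Variable k : fieldType.

Definition ncseries := seq bool -> k.

Definition nc1 : ncseries := fun w => (w == [::])%:R.
Definition ncvar (b : bool) : ncseries := fun w => (w == [:: b])%:R.
Definition ncsub (f h : ncseries) : ncseries := fun w => f w - h w.
Definition ncmul (f h : ncseries) : ncseries :=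
  fun w => \sum_(i < (size w).+1) f (take i w) * h (drop i w).
Definition ncexpn (f : ncseries) (n : nat) : ncseries := iter n (ncmul f) nc1.

(* If f has no constant term, then f ^ n vanishes on words of size < n:       *)
(* the sums below are the full exponential and logarithm series, provided     *)
(* f and h - 1 have no constant term.                                         *)
Definition ncexp (f : ncseries) : ncseries :=
  fun w => \sum_(0 <= n < (size w).+1) (n`!%:R)^-1 * ncexpn f n w.
Definition nclog (h : ncseries) : ncseries :=
  fun w => \sum_(1 <= n < (size w).+1)
             (-1) ^+ n.-1 * (n%:R)^-1 * ncexpn (ncsub h nc1) n w.

(* As above, [LVar true] is X and [LVar false] is Y. *)
Inductive lie_monomial : Type :=
  | LVar of bool
  | LBracket of lie_monomial & lie_monomial.

Fixpoint lie_degree (t : lie_monomial) : nat :=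
  match t with
  | LVar _ => 1%N
  | LBracket t1 t2 => (lie_degree t1 + lie_degree t2)%N
  end.

Fixpoint lie_expand (t : lie_monomial) : ncseries :=
  match t with
  | LVar b => ncvar b
  | LBracket t1 t2 => ncsub (ncmul (lie_expand t1) (lie_expand t2))
                            (ncmul (lie_expand t2) (lie_expand t1))
  end.

(* A Lie series, given by linear combinations of Lie monomials in each degree *)
Definition lie_series := nat -> seq (k * lie_monomial).

Definition is_bch_series (B : lie_series) : Prop :=
  (forall n, all (fun ct => lie_degree ct.2 == n) (B n)) /\
  (forall w, \sum_(ct <- B (size w)) ct.1 * lie_expand ct.2 w
             = nclog (ncmul (ncexp (ncvar true)) (ncexp (ncvar false))) w).

(* log (e^X e^Y) as a Lie series; it exists by the Baker-Campbell-Hausdorff   *)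
(* theorem and its values in Lie algebras do not depend on the choice.        *)
Definition bch_series : lie_series :=
  epsilon (inhabits (fun=> [::])) is_bch_series.

End NoncommutativeSeries.

(* The underlying set is fg_fil 1 (not the whole of fg_sort) and the          *)
(* filtration is indexed by p >= 1.                                           *)
Record filteredData := FilteredData {
  fg_sort :> Type;
  fg_fil : nat -> fg_sort -> Prop;
  fg_mul : fg_sort -> fg_sort -> fg_sort;
  fg_one : fg_sort
}.

Definition fg_carrier (G : filteredData) : G -> Prop := @fg_fil G 1.

Record is_filtered_group (G : filteredData) : Prop := IsFilteredGroup {
  fg_desc : forall p (u : G), (0 < p)%N -> fg_fil p.+1 u -> fg_fil p u;
  fg_fil1 : forall p, (0 < p)%N -> fg_fil p (fg_one G);
  fg_filM : forall p (u v : G), (0 < p)%N ->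
    fg_fil p u -> fg_fil p v -> fg_fil p (fg_mul u v);
  fg_filV : forall p (u : G), (0 < p)%N -> fg_fil p u ->
    exists v, [/\ fg_fil p v, fg_mul u v = fg_one G & fg_mul v u = fg_one G];
  fg_mulA : forall u v w : G, fg_carrier u -> fg_carrier v -> fg_carrier w ->
    fg_mul u (fg_mul v w) = fg_mul (fg_mul u v) w;
  fg_mul1 : forall u : G, fg_carrier u ->
    fg_mul (fg_one G) u = u /\ fg_mul u (fg_one G) = u
}.

Record is_filtered_morphism (G H : filteredData) (f : G -> H) : Prop :=
  IsFilteredMorphism {
  fm_one : f (fg_one G) = fg_one H;
  fm_mul : forall u v : G, fg_carrier u -> fg_carrier v ->
    f (fg_mul u v) = fg_mul (f u) (f v);
  fm_fil : forall p (u : G), (0 < p)%N -> fg_fil p u -> fg_fil p (f u)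
}.

Definition is_filtered_isomorphism (G H : filteredData) (f : G -> H)
    (f' : H -> G) : Prop :=
  [/\ is_filtered_morphism f, is_filtered_morphism f',
      forall u, fg_carrier u -> f' (f u) = u
    & forall v, fg_carrier v -> f (f' v) = v].

Definition fg_open (G : filteredData) (U : G -> Prop) : Prop :=
  (forall u, U u -> fg_carrier u) /\
  (forall u, U u -> exists2 p, (0 < p)%N &
     forall h, fg_fil p h -> U (fg_mul u h)).

Definition fg_continuous (G H : filteredData) (f : G -> H) : Prop :=
  forall U : H -> Prop, fg_open U -> fg_open (fun u => fg_carrier u /\ U (f u)).

Section GaugeGroup.
Variables (k : fieldType) (g : completeLieGraphAlg k).

(* The convention is that x labels the bottom vertex. *)
Definition star (x y : g) : g :=
  act edge_graph [ffun i => if i == bottom2 then x else y].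

Definition bracket (x y : g) : g := star x y - star y x.

Fixpoint lie_eval (x y : g) (t : lie_monomial) : g :=
  match t with
  | LVar b => if b then x else y
  | LBracket t1 t2 => bracket (lie_eval x y t1) (lie_eval x y t2)
  end.

Definition bch (x y : g) : g :=
  infinite_sum (fun n => \sum_(ct <- bch_series k n) ct.1 *: lie_eval x y ct.2).

Definition gauge_group : filteredData := FilteredData (@F0 k g) bch 0.

End GaugeGroup.

(* (h, T) is the graph h with upper level T and lower level ~: T. *)
Definition leveled n (hT : dsGra n * {set 'I_n}) : bool :=
  [forall a, forall b, edge hT.1 a b ==> (a \in hT.2) && (b \notin hT.2)].

Definition leveled_giso n (s : 'S_n) (hT hT' : dsGra n * {set 'I_n}) : bool :=
  giso s hT.1 hT'.1 && [forall a, (s a \in hT'.2) == (a \in hT.2)].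

Definition leveled_classes n : {set dsGra n * {set 'I_n}} :=
  let L := [set hT | @leveled n hT] in
  transversal
    (equivalence_partition (fun hT hT' => [exists s, leveled_giso s hT hT']) L) L.

Definition leveled_Aut n (hT : dsGra n * {set 'I_n}) : {set 'S_n} :=
  [set s | leveled_giso s hT hT].

(* [OnePlus x] is the formal expression 1 + x. *)
Record onePlus (T : Type) := OnePlus { one_plus_tail : T }.

Section DeformationGaugeGroup.
Variables (k : fieldType) (g : completeLieGraphAlg k).

Definition leveled_act n (hT : dsGra n * {set 'I_n}) (x y : g) : g :=
  act hT.1 [ffun a => if a \in hT.2 then y else x].

Definition circledcirc (u v : onePlus g) : onePlus g :=
  OnePlus (infinite_sum (fun n =>
    \sum_(hT in leveled_classes n) (#|leveled_Aut hT|%:R)^-1 *: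
      leveled_act hT (one_plus_tail u) (one_plus_tail v))).

Definition deformation_gauge_group : filteredData :=
  FilteredData (fun p (u : onePlus g) => F0 p (one_plus_tail u))
    circledcirc (OnePlus 0).

End DeformationGaugeGroup.

Definition dsGra_classes n : {set dsGra n} :=
  transversal
    (equivalence_partition (fun h h' => [exists s, @giso n s h h']) [set: dsGra n])
    [set: dsGra n].

(* t a is the level of the vertex a. *)
Definition total_levelisation n (h : dsGra n) (t : 'S_n) : bool :=
  [forall a, forall b, edge h a b ==> (t b < t a)%N].

Definition nb_total_levelisations n (h : dsGra n) : nat :=
  #|equivalence_partition
      (fun t t' : 'S_n => [exists s, giso s h h && [forall a, t' (s a) == t a]])
      [set t | total_levelisation h t]|.

Section GraphExponential.
Variables (k : fieldType) (g : completeLieGraphAlg k).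

Definition graph_exp (x : gauge_group g) : deformation_gauge_group g :=
  OnePlus (infinite_sum (fun n =>
    \sum_(h in dsGra_classes n)
      ((nb_total_levelisations h)%:R / n`!%:R) *: act h [ffun=> x : g])).

Definition graph_log (u : deformation_gauge_group g) : gauge_group g :=
  epsilon (inhabits (0 : g)) (fun x => F0 1 x /\ graph_exp x = u).

End GraphExponential.

(* Main.v *)
From HB Require Import structures.
Require Import Defs.
From mathcomp Require Import all_boot all_order all_algebra all_fingroup.
From Stdlib Require Import ClassicalEpsilon.

Set Implicit Arguments.
Unset Strict Implicit.
Unset Printing Implicit Defensive.

Import GRing.Theory.
Local Open Scope ring_scope.

(** Write A for the degree-zero part of g. Disconnected graphs act on A with
    values in the symmetric algebra of A, one factor for each component. Let
    X * Y be the sum over all the ways of placing the factors of Y above those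
    of X and joining some of the former to some of the latter. This product is
    associative, the commutator of two elements x, y of A is [x,y], and the
    symmetric exponentials E(a), the sum of the a^n / n!, satisfy
    E(a) * E(b) = E(c) where 1 + c is the circled product of 1 + a and 1 + b.
    An n-fold product x * ... * x is a sum over graphs with a total
    levelisation, so that the exponential of x for this product is E(e), where
    1 + e is the graph exponential of x. That the graph exponential turns BCH
    products into circled products is therefore nothing but the identity
    exp (BCH (x, y)) = exp x * exp y.

    The proof works with the connected part of such products only, which has
    values in A: [Tl] is the connected part of a product of levels, each level
    being a symmetric product of elements of A. Instead of the associativity
    of *, it uses a single consequence of the composition axiom, [Tl_split],
    which contracts an element y with those elements of the previous level to
    which it is joined. Two facts result from it, in the context of arbitrary
    other levels:
    - two consecutive levels x, y and y, x differ by the level [x,y]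
      ([Tl_commutator]), so that Lie series may be expanded into
      noncommutative series ([level_bch]);
    - a level filled with graph exponentials of y has the same effect as the
      ordered exponential of y ([exp_level] and [level_exp]), which is the
      equality between E(e) and exp y above and follows from the fact that
      both sides satisfy the same differential equation.
    Together they give the compatibility with products ([is_exp_bch]) and the
    associativity of the BCH product ([is_bch_assoc]).

    The BCH product makes sense only because log (e^X e^Y) is a Lie series
    ([bch_log_lie]). This is proved by expressing the degree derivation of
    e^X e^Y in two ways, which determines each homogeneous component of the
    logarithm by brackets of the previous ones ([bch_recursion]).

    Finally, the graph exponential is the identity up to terms which increase
    the filtration index of differences ([is_exp_contract]). Hence it is
    bijective and compatible with the filtrations in both directions, and the
    group structure of the deformation gauge group is carried over from the
    gauge group. Continuity is a general property of filtered morphisms. *)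

(** * Graphs on arbitrary finite sets of vertices *)

Definition preim_edges (V V' : finType) (f : V -> V') (E : {set V' * V'}) :
  {set V * V} := [set p | (f p.1, f p.2) \in E].

Lemma preim_edges_comp (V1 V2 V3 : finType) (f : V1 -> V2) (h : V2 -> V3) E :
  preim_edges f (preim_edges h E) = preim_edges (h \o f) E.
Proof. by apply/setP => p; rewrite !inE. Qed.

Lemma eq_preim_edges (V V' : finType) (f f' : V -> V') E :
  f =1 f' -> preim_edges f E = preim_edges f' E.
Proof. by move=> eq_f; apply/setP => p; rewrite !inE !eq_f. Qed.

Lemma preim_edges_id (V : finType) (f : V -> V) E :
  f =1 id -> preim_edges f E = E.
Proof. by move=> eq_f; apply/setP => -[a b]; rewrite !inE !eq_f. Qed.

Lemma preim_edges_bij (V V' : finType) (f : V -> V') :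
  bijective f -> bijective (preim_edges f).
Proof.
case=> f' fK f'K; exists (preim_edges f') => E.
  by rewrite preim_edges_comp preim_edges_id.
by rewrite preim_edges_comp preim_edges_id.
Qed.

Lemma connect_bij (V V' : finType) (f : V -> V') (e : rel V') a b :
  bijective f -> connect (relpre f e) a b = connect e (f a) (f b).
Proof.
case=> f' fK f'K; apply/connectP/connectP => -[p pP pE].
  by exists (map f p); rewrite ?path_map // last_map pE.
exists (map f' p).
  by rewrite -path_map -map_comp (eq_map f'K) map_id.
by apply: (can_inj fK); rewrite -last_map -map_comp (eq_map f'K) map_id.
Qed.

Lemma forall_bij (V V' : finType) (f : V -> V') (P : pred V') :
  bijective f -> [forall a, P (f a)] = [forall b, P b].
Proof.
case=> f' fK f'K; apply/forallP/forallP => P_ a; last exact: P_.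
by rewrite -(f'K a); apply: P_.
Qed.

Lemma eq_forall_bij (V V' : finType) (f : V -> V') (P : pred V) (Q : pred V') :
  bijective f -> (forall a, P a = Q (f a)) -> [forall a, P a] = [forall b, Q b].
Proof.
by move=> bij_f eqPQ; rewrite -(forall_bij _ bij_f); apply: eq_forallb.
Qed.

Lemma is_dsgraph_preim n m (f : 'I_n -> 'I_m) E :
  bijective f -> is_dsgraph (preim_edges f E) = is_dsgraph E.
Proof.
move=> bij_f; have eq_nm: n = m by have := bij_eq_card bij_f; rewrite !card_ord.
rewrite /is_dsgraph; congr [&& _, _ & _]; first by rewrite eq_nm.
  apply: (eq_forall_bij bij_f) => a; apply: (eq_forall_bij bij_f) => b.
  rewrite inE -(connect_bij _ _ _ bij_f); congr (_ ==> ~~ _).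
  by apply: eq_connect => u v; rewrite /= !inE.
apply: (eq_forall_bij bij_f) => a; apply: (eq_forall_bij bij_f) => b.
rewrite -(connect_bij _ _ _ bij_f).
by apply: eq_connect => u v; rewrite /= !inE.
Qed.

(** The structure carried by the degree-zero part of a Lie-graph algebra: there
    the Koszul signs are all trivial. *)
Record graphAlg (k : fieldType) := GraphAlg {
  gcar :> lmodType k;
  gop : forall n, dsGra n -> {ffun 'I_n -> gcar} -> gcar;
  gop_multilinear : forall n (g : dsGra n) (x : {ffun 'I_n -> gcar})
      (i : 'I_n) (a : k) (u v : gcar),
    gop g (update x i (a *: u + v))
      = a *: gop g (update x i u) + gop g (update x i v);
  gop_unit : forall x : {ffun 'I_1 -> gcar}, gop vertex_graph x = x ord0;
  gop_equivariant : forall n (s : 'S_n) (g h : dsGra n)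
      (x : {ffun 'I_n -> gcar}),
    giso s g h -> gop h x = gop g [ffun a => x (s a)];
  gop_comp : forall n1 n2 (g1 : dsGra n1.+1) (i : 'I_n1.+1)
      (g2 : dsGra n2.+1) (x : {ffun 'I_(n1 + n2).+1 -> gcar}),
    gop g1 [ffun j => if j == i then gop g2 [ffun b => x (inner_label i b)]
                      else x (outer_label n2 i j)]
      = \sum_(h : dsGra (n1 + n2).+1 | is_insertion g1 i g2 h) gop h x
}.

Section GraphAction.
Variables (k : fieldType) (A : graphAlg k).

Definition eact n (E : {set 'I_n * 'I_n}) (z : 'I_n -> A) : A :=
  if insub E is Some h then gop (h : dsGra n) [ffun i => z i] else 0.

Lemma eact_val n (h : dsGra n) (z : 'I_n -> A) :
  eact (val h) z = gop h [ffun i => z i].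
Proof. by rewrite /eact valK. Qed.

Lemma eact_eq0 n (E : {set 'I_n * 'I_n}) (z : 'I_n -> A) :
  ~~ is_dsgraph E -> eact E z = 0.
Proof. by move=> nE; rewrite /eact insubN. Qed.

Lemma eq_eact n (E : {set 'I_n * 'I_n}) (z z' : 'I_n -> A) :
  z =1 z' -> eact E z = eact E z'.
Proof.
by move=> eqz; rewrite /eact; case: insub => // h; congr gop; apply/ffunP => i;
  rewrite !ffunE.
Qed.

Lemma eact_bij n m (f : 'I_n -> 'I_m) E (z : 'I_m -> A) :
  bijective f -> eact (preim_edges f E) (z \o f) = eact E z.
Proof.
move=> bij_f; have eq_nm: n = m by have := bij_eq_card bij_f; rewrite !card_ord.
case: m / eq_nm f E z bij_f => f E z bij_f.
have [dsE | ndsE] := boolP (is_dsgraph E); last first.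
  by rewrite !eact_eq0 // is_dsgraph_preim.
have dsE': is_dsgraph (preim_edges f E) by rewrite is_dsgraph_preim.
rewrite -[E in RHS]/(val (Sub E dsE : dsGra n)).
rewrite -[preim_edges f E]/(val (Sub _ dsE' : dsGra n)) !eact_val.
rewrite [RHS](@gop_equivariant _ _ _ (perm (bij_inj bij_f)) (Sub _ dsE')).
  by congr gop; apply/ffunP => i; rewrite !ffunE permE.
apply/forallP => a; apply/forallP => b.
by rewrite /edge !SubK !permE inE.
Qed.

(** Allowing any finite set of vertices removes the labels from the statements,
    and the value zero on the other graphs lets sums range over all the sets of
    edges. *)
Definition gact (V : finType) (E : {set V * V}) (z : V -> A) : A :=
  eact (preim_edges (enum_val : 'I_#|V| -> V) E) (z \o enum_val).

Lemma gact_bij (V V' : finType) (f : V -> V') E (z : V' -> A) :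
  bijective f -> gact (preim_edges f E) (z \o f) = gact E z.
Proof.
move=> bij_f; pose h (i : 'I_#|V|) : 'I_#|V'| := enum_rank (f (enum_val i)).
have bij_h: bijective h.
  apply: (bij_comp _ (bij_comp bij_f _)).
    exact: (Bijective enum_rankK enum_valK).
  exact: (Bijective enum_valK enum_rankK).
rewrite /gact -(eact_bij _ _ bij_h) !preim_edges_comp.
rewrite (@eq_preim_edges _ _ (enum_val \o h) (f \o enum_val)).
  by apply: eq_eact => i; rewrite /= enum_rankK.
by move=> i; rewrite /= enum_rankK.
Qed.

Lemma gact_ord n E (z : 'I_n -> A) : gact E z = eact E z.
Proof.
rewrite /gact (@eact_bij _ _ (enum_val : 'I_#|'I_n| -> 'I_n) E z) //.
exact: (Bijective enum_valK enum_rankK).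
Qed.

Lemma eq_gact (V : finType) (E : {set V * V}) (z z' : V -> A) :
  z =1 z' -> gact E z = gact E z'.
Proof. by move=> eqz; apply: eq_eact => i; apply: eqz. Qed.

Definition dsg (V : finType) (E : {set V * V}) : bool :=
  is_dsgraph (preim_edges (enum_val : 'I_#|V| -> V) E).

Lemma dsg_bij_ord n (V : finType) (f : 'I_n -> V) (E : {set V * V}) :
  bijective f -> is_dsgraph (preim_edges f E) = dsg E.
Proof.
move=> bij_f; rewrite /dsg.
rewrite (@eq_preim_edges _ _ f (enum_val \o (enum_rank \o f))).
  rewrite -preim_edges_comp is_dsgraph_preim //.
  by apply: (bij_comp _ bij_f); apply: (Bijective enum_rankK enum_valK).
by move=> i; rewrite /= enum_rankK.
Qed.

Lemma gact_eq0 (V : finType) (E : {set V * V}) (z : V -> A) :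
  ~~ dsg E -> gact E z = 0.
Proof. exact: eact_eq0. Qed.

Lemma sum_dsGra n (P : pred {set 'I_n * 'I_n}) (z : 'I_n -> A) :
  \sum_(h : dsGra n | P (val h)) gop h [ffun i => z i]
    = \sum_(E | P E) eact E z.
Proof.
rewrite [RHS](bigID (@is_dsgraph n)) /= [X in _ + X]big1 ?addr0; last first.
  by move=> E /andP[_ nE]; rewrite eact_eq0.
rewrite (reindex_omap (val : dsGra n -> _) insub) /=; last first.
  by move=> E /andP[_ dsE]; rewrite insubT.
apply: eq_big => [h|h _]; last by rewrite eact_val.
by rewrite valK eqxx (valP h) !andbT.
Qed.

(** Blowing up the vertex [None] of G into H can give E. *)
Definition is_blowup (W U : finType) (G : {set option W * option W})
    (H : {set U * U}) (E : {set (W + U) * (W + U)}) : bool :=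
  [&& [forall u, forall v, ((inr u, inr v) \in E) == ((u, v) \in H)],
      [forall w, forall w',
        ((inl w, inl w') \in E) == ((Some w, Some w') \in G)],
      [forall w, ((Some w, None) \in G) == [exists u, (inl w, inr u) \in E]]
    & [forall w, ((None, Some w) \in G) == [exists u, (inr u, inl w) \in E]]].

Lemma origin_outer n1 n2 (j : 'I_n1.+1) :
  j != ord0 -> origin ord0 (outer_label n2 ord0 j) = inl j :> 'I_n1.+1 + 'I_n2.+1.
Proof.
move=> j_n0; have j_gt0 : (0 < j)%N by rewrite lt0n.
have lt_j : (j + n2 < (n1 + n2).+1)%N by rewrite ltnS leq_add2r -ltnS.
rewrite /origin /outer_label /= inordK // add0n.
rewrite leqNgt -[X in (X < _)%N]add0n ltn_add2r j_gt0 /= addnK.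
by congr inl; apply: val_inj; rewrite /= inordK.
Qed.

Lemma origin_inner n1 n2 (b : 'I_n2.+1) :
  origin ord0 (inner_label ord0 b : 'I_(n1 + n2).+1) = inr b :> 'I_n1.+1 + 'I_n2.+1.
Proof.
have lt_b : (b < (n1 + n2).+1)%N.
  by rewrite (leq_trans (ltn_ord b)) // ltnS leq_addl.
rewrite /origin /inner_label /= add0n inordK // leq_ord subn0.
by congr inr; apply: val_inj; rewrite /= inordK.
Qed.

(** The composition axiom at the first vertex, freed from the labels: the
    bijections f1, f2 and f3' number the three sets of vertices as the shifts of
    labels prescribe. *)
Lemma gact_blowup (W U : finType) (G : {set option W * option W})
    (H : {set U * U}) (z : W + U -> A) : dsg G -> dsg H ->
  gact G (fun o => if o is Some w then z (inl w) else gact H (z \o inr))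
    = \sum_(E | is_blowup G H E) gact E z.
Proof.
move=> dsG dsH; have U_gt0: (0 < #|U|)%N by case/and3P: dsH.
pose n1 := #|W|; pose n2 := #|U|.-1; have n2E: n2.+1 = #|U| by rewrite prednK.
pose f1 (j : 'I_n1.+1) : option W :=
  if unlift ord0 j is Some j' then Some (enum_val j') else None.
pose f1' (o : option W) : 'I_n1.+1 :=
  if o is Some w then lift ord0 (enum_rank w) else ord0.
have f1K: cancel f1 f1'.
  by rewrite /f1 => j; case: unliftP => [j'|] -> //=; rewrite enum_valK.
have f1'K: cancel f1' f1.
  by case=> [w|]; rewrite /f1 /f1' ?liftK ?enum_rankK // unlift_none.
have bij_f1: bijective f1 by exists f1'.
have bij_f1': bijective f1' by exists f1.
pose f2 (b : 'I_n2.+1) : U := enum_val (cast_ord n2E b).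
pose f2' (u : U) : 'I_n2.+1 := cast_ord (esym n2E) (enum_rank u).
have f2K: cancel f2 f2' by move=> b; rewrite /f2' enum_valK cast_ordK.
have f2'K: cancel f2' f2 by move=> u; rewrite /f2 cast_ordKV enum_rankK.
have bij_f2: bijective f2 by exists f2'.
pose f3' (v : W + U) : 'I_(n1 + n2).+1 := match v with
  | inl w => outer_label n2 ord0 (f1' (Some w))
  | inr u => inner_label ord0 (f2' u) end.
have or_inl w : origin ord0 (f3' (inl w)) = inl (f1' (Some w)) :> 'I_n1.+1 + 'I_n2.+1.
  exact: origin_outer.
have or_inr u : origin ord0 (f3' (inr u)) = inr (f2' u) :> 'I_n1.+1 + 'I_n2.+1.
  exact: origin_inner.
have inj_f3': injective f3'.
  move=> [w|u] [w'|u'] /(congr1 (@origin n1 n2 ord0)).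
  - rewrite !or_inl => e; have e' := can_inj f1'K (inl_inj e); congr inl; exact: Some_inj e'.
  - by rewrite or_inl or_inr.
  - by rewrite or_inl or_inr.
  by rewrite !or_inr => e; rewrite (can_inj f2'K (inr_inj e)).
have bij_f3': bijective f3'.
  apply: inj_card_bij => //.
  by rewrite card_ord card_sum -/n1 -n2E addnS.
have [f3 f3'K f3K] := bij_f3'.
have dsG1: is_dsgraph (preim_edges f1 G) by rewrite dsg_bij_ord.
have dsG2: is_dsgraph (preim_edges f2 H) by rewrite dsg_bij_ord.
pose g1 : dsGra n1.+1 := Sub _ dsG1; pose g2 : dsGra n2.+1 := Sub _ dsG2.
pose x : {ffun 'I_(n1 + n2).+1 -> A} := [ffun i => z (f3 i)].
rewrite -(gact_bij _ _ bij_f1) gact_ord -[preim_edges _ _]/(val g1) eact_val.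
rewrite [X in gop g1 X](_ : _ = [ffun j => if j == ord0
      then gop g2 [ffun b => x (inner_label ord0 b)]
      else x (outer_label n2 ord0 j)]); last first.
  apply/ffunP => j; rewrite !ffunE /= /f1; case: unliftP => [j'|] -> /=.
    by rewrite -{2}[j']enum_valK -[outer_label _ _ _]/(f3' (inl _)) f3'K.
  rewrite -(gact_bij _ _ bij_f2) gact_ord -[preim_edges _ _]/(val g2) eact_val.
  congr gop; apply/ffunP => b; rewrite !ffunE /=.
  by rewrite -[b in RHS]f2K -[inner_label _ _]/(f3' (inr _)) f3'K.
rewrite gop_comp.
transitivity (\sum_(h : dsGra (n1 + n2).+1 |
    is_blowup G H (preim_edges f3' (val h))) gop h [ffun i => (z \o f3) i]).
  apply: eq_big => [h|h _]; last by congr gop; apply/ffunP => i; rewrite !ffunE.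
  apply/existsP/and4P => [[S /andP[/forallP Sne /'forall_forallP/= hE]]|].
    have edgeE v v' : ((v, v') \in preim_edges f3' (val h))
        = inserted_edge g1 ord0 g2 S (f3' v) (f3' v').
      by rewrite inE -[_ \in _]/(edge h _ _) (eqP (hE _ _)).
    have g1E a b : edge g1 a b = ((f1 a, f1 b) \in G) by rewrite /edge SubK inE.
    have f1_0 : f1 ord0 = None by rewrite -[ord0]/(f1' None) f1'K.
    split; apply/forallP => a.
    - apply/forallP => b; rewrite edgeE /inserted_edge !or_inr.
      by rewrite /edge SubK inE !f2'K.
    - apply/forallP => b; rewrite edgeE /inserted_edge !or_inl.
      by rewrite /edge SubK inE !f1'K.
    - apply/eqP; apply/idP/existsP => [aG|[u]].
        have /set0Pn[b bS]: S (f1' (Some a)) != set0.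
          by apply: (implyP (Sne _)); rewrite g1E f1'K f1_0 aG.
        exists (f2 b); rewrite edgeE /inserted_edge or_inl or_inr f2K bS andbT.
        by rewrite g1E f1'K f1_0.
      rewrite edgeE /inserted_edge or_inl or_inr => /andP[].
      by rewrite g1E f1'K f1_0.
    apply/eqP; apply/idP/existsP => [aG|[u]].
      have /set0Pn[b bS]: S (f1' (Some a)) != set0.
        by apply: (implyP (Sne _)); rewrite !g1E f1'K f1_0 aG orbT.
      exists (f2 b); rewrite edgeE /inserted_edge or_inl or_inr f2K bS andbT.
      by rewrite g1E f1'K f1_0.
    rewrite edgeE /inserted_edge or_inl or_inr => /andP[].
    by rewrite g1E f1'K f1_0.
  case=> /'forall_forallP/= HU /'forall_forallP/= HW /forallP HWU /forallP HUW.
  (* The vertices of U joined to a vertex of W can be read off from h. *)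
  pose S := [ffun j : 'I_n1.+1 => [set b : 'I_n2.+1 |
     if f1 j is Some w then ((inl w, inr (f2 b)) \in preim_edges f3' (val h))
        || ((inr (f2 b), inl w) \in preim_edges f3' (val h)) else true]].
  exists S.
  have g1E a b : edge g1 a b = ((f1 a, f1 b) \in G) by rewrite /edge SubK inE.
  have f1_0 : f1 ord0 = None by rewrite -[ord0]/(f1' None) f1'K.
  have ndiag (V : finType) (E : {set V * V}) v v' : dsg E ->
      (v, v') \in E -> (v', v) \notin E.
    case/and3P => _ /'forall_forallP/= acE _ vE; apply/negP => v'E.
    have := implyP (acE (enum_rank v) (enum_rank v')).
    rewrite inE !enum_rankK => /(_ vE) /negP; apply.
    by apply: connect1; rewrite /= inE /= !enum_rankK.
  apply/andP; split.
    apply/forallP => j; apply/implyP; rewrite !g1E f1_0.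
    case Ej: (f1 j) => [w|] /orP[] wG.
    - have /existsP[u uE]: [exists u, (inl w, inr u) \in preim_edges f3' (val h)].
        by rewrite -(eqP (HWU w)).
      by apply/set0Pn; exists (f2' u); rewrite ffunE inE Ej f2'K uE.
    - have /existsP[u uE]: [exists u, (inr u, inl w) \in preim_edges f3' (val h)].
        by rewrite -(eqP (HUW w)).
      by apply/set0Pn; exists (f2' u); rewrite ffunE inE Ej f2'K uE orbT.
    - by apply/set0Pn; exists ord0; rewrite ffunE inE Ej.
    by apply/set0Pn; exists ord0; rewrite ffunE inE Ej.
  apply/forallP => l; apply/forallP => m.
  rewrite -(f3K l) -(f3K m); move: (f3 l) (f3 m) => v v'.
  have -> : edge h (f3' v) (f3' v') = ((v, v') \in preim_edges f3' (val h)).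
    by rewrite inE.
  rewrite /inserted_edge; case: v v' => [w|u] [w'|u'].
  - by rewrite !or_inl g1E !f1'K (eqP (HW _ _)).
  - rewrite or_inl or_inr g1E f1'K f1_0 ffunE f1'K.
    rewrite [X in _ && X]inE f2'K.
    apply/eqP; apply/idP/andP => [wu|[wG /orP[//|uw]]].
      by rewrite wu (eqP (HWU w)); split=> //; apply/existsP; exists u'.
    have /negP[] := ndiag _ _ _ _ dsG wG.
    by rewrite (eqP (HUW w)); apply/existsP; exists u'.
  - rewrite or_inl or_inr g1E f1'K f1_0 ffunE f1'K.
    rewrite [X in _ && X]inE f2'K.
    apply/eqP; apply/idP/andP => [wu|[wG /orP[uw|//]]].
      by rewrite wu (eqP (HUW w')) orbT; split=> //; apply/existsP; exists u.
    have /negP[] := ndiag _ _ _ _ dsG wG.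
    by rewrite (eqP (HWU w')); apply/existsP; exists u.
  by rewrite !or_inr (eqP (HU _ _)) /edge SubK inE !f2'K.
rewrite (sum_dsGra (fun E => is_blowup G H (preim_edges f3' E))).
rewrite [RHS](reindex (preim_edges f3')) /=; last first.
  exact/onW_bij/preim_edges_bij.
apply: eq_bigr => E _; rewrite -gact_ord -(gact_bij _ _ bij_f3').
by apply: eq_gact => v; rewrite /= f3'K.
Qed.

End GraphAction.

(** * Ordered products of levels *)

Section LeveledSums.
Variables (k : fieldType) (A : graphAlg k).

Definition lowering (V : finType) (lev : V -> nat) (E : {set V * V}) : bool :=
  [forall p in E, (lev p.2 < lev p.1)%N].

Lemma loweringP (V : finType) (lev : V -> nat) (E : {set V * V}) :
  reflect (forall a b, (a, b) \in E -> (lev b < lev a)%N) (lowering lev E).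
Proof.
apply: (iffP 'forall_implyP) => [E_ a b /E_ // | E_ [a b]]; exact: E_.
Qed.

Definition linked (V : finType) (E : {set V * V}) : rel V :=
  connect [rel u v | ((u, v) \in E) || ((v, u) \in E)].

Lemma dsg_linked (V : finType) (E : {set V * V}) a b : dsg E -> linked E a b.
Proof.
case/and3P=> _ _ /'forall_forallP/= cE.
have := cE (enum_rank a) (enum_rank b).
rewrite -[in X in _ -> X](enum_rankK a) -[in X in _ -> X](enum_rankK b).
rewrite /linked -(connect_bij _ _ _ (enum_val_bij V)).
by congr is_true; apply: eq_connect => u v; rewrite /= !inE.
Qed.

(** Levels that decrease along the edges exclude directed cycles, so that only
    connectedness remains to be checked. *)
Lemma dsg_lowering (V : finType) (lev : V -> nat) (E : {set V * V}) (v0 : V) :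
  lowering lev E -> (forall a, linked E v0 a) -> dsg E.
Proof.
move=> /loweringP lowE linkE.
apply/and3P; split.
- by apply/card_gt0P; exists v0.
- apply/'forall_forallP => a b; apply/implyP; rewrite inE => /lowE /= lt_ba.
  apply/negP => /connectP[p]; elim: p b lt_ba => [|c p IHp] b /= lt_ba.
    by move=> _ eq_ab; rewrite eq_ab ltnn in lt_ba.
  rewrite inE => /andP[/lowE /= lt_cb]; apply: IHp.
  exact: ltn_trans lt_cb lt_ba.
apply/'forall_forallP => a b.
have sym: connect_sym [rel u v | ((u, v) \in E) || ((v, u) \in E)].
  by apply: sym_connect_sym => u v; rewrite /= orbC.
have: linked E (enum_val a) (enum_val b).
  by apply: connect_trans (linkE _); rewrite sym; apply: linkE.
rewrite /linked -(connect_bij _ _ _ (enum_val_bij V)).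
by congr is_true; apply: eq_connect => u v; rewrite /= !inE.
Qed.

(** In terms of disconnected graphs, this is the connected part of the product
    of the [z v] in increasing order of their levels, the entries of one level
    being multiplied symmetrically. *)
Definition Tfin (V : finType) (lev : V -> nat) (z : V -> A) : A :=
  \sum_(E | lowering lev E) gact E z.

Lemma lowering_preim (V V' : finType) (f : V -> V') lev E : bijective f ->
  lowering (lev \o f) (preim_edges f E) = lowering lev E.
Proof.
case=> f' fK f'K; apply/loweringP/loweringP => lowE a b.
  by rewrite -[a]f'K -[b]f'K => abE; apply: lowE; rewrite inE.
by rewrite inE => /lowE.
Qed.

Lemma Tfin_bij (V V' : finType) (f : V -> V') lev z : bijective f ->
  Tfin (lev \o f) (z \o f) = Tfin lev z.
Proof.
move=> bij_f; rewrite /Tfin (reindex (preim_edges f)) /=; last first.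
  exact/onW_bij/preim_edges_bij.
by apply: eq_big => [E|E _]; rewrite ?lowering_preim ?gact_bij.
Qed.

Lemma eq_Tfin (V : finType) (lev lev' : V -> nat) (z z' : V -> A) :
  (forall a b, (lev a < lev b)%N = (lev' a < lev' b)%N) -> z =1 z' ->
  Tfin lev z = Tfin lev' z'.
Proof.
move=> eq_lev eqz; apply: eq_big => [E|E _]; last exact: eq_gact.
by apply: eq_forallb => p; rewrite eq_lev.
Qed.

Definition Tseq (s : seq (nat * A)) : A :=
  Tfin (fun i : 'I_(size s) => (nth (0%N, 0) s i).1)
       (fun i : 'I_(size s) => (nth (0%N, 0) s i).2).

Lemma Tfin_Tseq (V : finType) (lev : V -> nat) (z : V -> A) (r : seq V) :
  perm_eq r (enum V) -> Tfin lev z = Tseq [seq (lev v, z v) | v <- r].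
Proof.
move=> perm_r; set t := map _ r.
pose f (i : 'I_(size t)) := tnth (in_tuple r) (cast_ord (size_map _ _) i).
have uniq_r : uniq r by rewrite (perm_uniq perm_r) enum_uniq.
have bij_f : bijective f.
  apply: inj_card_bij => [i j|].
    by move/(tuple_uniqP (in_tuple r) uniq_r)/cast_ord_inj.
  by rewrite card_ord size_map (perm_size perm_r) -cardE.
rewrite -(Tfin_bij _ _ bij_f).
have nthE i : nth (0%N, 0) t (val i) = (lev (f i), z (f i)).
  have lt_i: (val i < size r)%N by have := ltn_ord i; rewrite [X in (_ < X)%N]size_map.
  have fE: nth (f i) r (val i) = f i by rewrite [RHS](tnth_nth (f i)).
  by rewrite (nth_map (f i)) // fE.
by apply: eq_Tfin => [a b|a]; rewrite !nthE.
Qed.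

Lemma Tseq_perm (s t : seq (nat * A)) : perm_eq s t -> Tseq s = Tseq t.
Proof.
move=> perm_st; have := perm_st; rewrite -[t]/(tval (in_tuple t)).
case/tuple_permP => p sE.
have eq_sz: size s = size t by apply: perm_size.
pose f (i : 'I_(size s)) : 'I_(size t) := p (cast_ord eq_sz i).
have bij_f : bijective f.
  apply: inj_card_bij => [i j /perm_inj/cast_ord_inj //|].
  by rewrite !card_ord eq_sz.
rewrite [RHS]/Tseq -(Tfin_bij _ _ bij_f).
have nthE i : nth (0%N, 0) s (val i) = nth (0%N, 0) t (val (f i)).
  have lt_i: (val i < size t)%N by rewrite -eq_sz ltn_ord.
  rewrite /f (_ : cast_ord eq_sz i = Ordinal lt_i); last exact: val_inj.
  move: (val i) lt_i => j lt_j; rewrite sE (nth_map (Ordinal lt_j)).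
    rewrite (tnth_nth (0%N, 0)) /=; congr (nth _ _ (val (p _))).
    by apply: val_inj; rewrite /= nth_enum_ord.
  by rewrite size_enum_ord.
by apply: eq_Tfin => [a b|a]; rewrite /= !nthE.
Qed.

Lemma Tseq_relevel (f : nat -> nat) (s : seq (nat * A)) :
  {in [seq p.1 | p <- s] &, forall i j, (f i < f j)%N = (i < j)%N} ->
  Tseq [seq (f p.1, p.2) | p <- s] = Tseq s.
Proof.
move=> mono_f; pose g (i : 'I_(size s)) := cast_ord (esym (size_map (fun p => (f p.1, p.2)) s)) i.
have bij_g: bijective g.
  by apply: inj_card_bij => [i j /cast_ord_inj //|]; rewrite !card_ord size_map.
rewrite [LHS]/Tseq -(Tfin_bij _ _ bij_g).
have in_s (i : 'I_(size s)) : (nth (0%N, 0) s i).1 \in [seq p.1 | p <- s].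
  by apply: map_f; apply: mem_nth.
by apply: eq_Tfin => [a b|a]; rewrite /= !(nth_map (0%N, 0)) //= mono_f.
Qed.

(** The point [None] stands for the contracted vertices of U. *)
Definition contract_vertex (W U : finType) (v : W + U) : option W :=
  if v is inl w then Some w else None.

Definition contract (W U : finType) (E : {set (W + U) * (W + U)}) :
    {set option W * option W} :=
  [set p | (p != (None, None)) &&
    [exists e in E, (contract_vertex e.1, contract_vertex e.2) == p]].

Lemma is_blowup_contract (W U : finType) (G : {set option W * option W}) H
    (E : {set (W + U) * (W + U)}) : (None, None) \notin G ->
  is_blowup G H E = (preim_edges inr E == H) && (contract E == G).
Proof.
move=> nG; have cE o o' : ((o, o') \in contract E) = ((o, o') != (None, None)) &&
    [exists e in E, (contract_vertex e.1, contract_vertex e.2) == (o, o')].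
  by rewrite inE.
have existsE (P : pred _) a b : (a, b) \in E -> P (a, b) -> [exists e in E, P e].
  by move=> abE Pab; apply/exists_inP; exists (a, b).
apply/and4P/andP => [[HU HW HWU HUW]|[/eqP <- /eqP <-]].
  split; apply/eqP/setP => -[a b].
    by rewrite inE; move/'forall_forallP: HU => /(_ a b)/eqP.
  rewrite cE; case: a b => [w|] [w'|] /=; rewrite ?eqxx ?(negPf nG) //=.
  - rewrite -(eqP ('forall_forallP HW w w')).
    apply/exists_inP/idP => [|wE]; last by exists (inl w, inl w').
    by case=> -[v v'] /= vE /eqP[]; move: v v' vE => [a|//] [b|//] abE [<-] [<-].
  - rewrite (eqP (forallP HWU w)); apply/exists_inP/existsP.
      by case=> -[v v'] /= vE /eqP[]; move: v v' vE => [a|//] [//|b] abE [<-] _; exists b.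
    by case=> u uE; exists (inl w, inr u).
  rewrite (eqP (forallP HUW w')); apply/exists_inP/existsP.
    by case=> -[v v'] /= vE /eqP[]; move: v v' vE => [//|a] [b|//] abE _ [<-]; exists a.
  by case=> u uE; exists (inr u, inl w').
split.
- by apply/'forall_forallP => u v; rewrite inE.
- apply/'forall_forallP => w w'; rewrite cE /=; apply/eqP; apply/idP/exists_inP.
    by move=> wE; exists (inl w, inl w').
  by case=> -[v v'] /= vE /eqP[]; move: v v' vE => [a|//] [b|//] abE [<-] [<-].
- apply/forallP => w; rewrite cE /=; apply/eqP; apply/exists_inP/existsP.
    by case=> -[v v'] /= vE /eqP[]; move: v v' vE => [a|//] [//|b] abE [<-] _; exists b.
  by case=> u uE; exists (inl w, inr u).
apply/forallP => w'; rewrite cE /=; apply/eqP; apply/exists_inP/existsP.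
  by case=> -[v v'] /= vE /eqP[]; move: v v' vE => [//|a] [b|//] abE _ [<-]; exists a.
by case=> u uE; exists (inr u, inl w').
Qed.

Lemma linked_contract (W U : finType) (E : {set (W + U) * (W + U)}) v v' :
  linked E v v' -> linked (contract E) (contract_vertex v) (contract_vertex v').
Proof.
case/connectP=> p; elim: p v => [|c p IHp] v /=; first by move=> _ ->; apply: connect0.
case/andP=> vc pP v'E; apply: connect_trans (IHp c pP v'E).
have [/eqP[-> ->]|ne] := boolP ((contract_vertex v, contract_vertex c) == (None, None)).
  exact: connect0.
apply: connect1; rewrite /= !inE ne.
have ne': (contract_vertex c, contract_vertex v) != (None, None).
  by apply: contra ne => /eqP[-> ->].
rewrite ne' /=; apply/orP.
by case/orP: vc => vcE; [left | right]; apply/exists_inP; [exists (v, c) | exists (c, v)].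
Qed.

(** Group the graphs E by their contractions: the contraction of a connected
    graph is connected, and it has no directed cycle because it respects the
    levels. *)
Lemma Tfin_blowup (W U : finType) (lev : option W -> nat) (H : {set U * U})
    (z : W + U -> A) : dsg H ->
  Tfin lev (fun o => if o is Some w then z (inl w) else gact H (z \o inr))
    = \sum_(E | (preim_edges inr E == H) && lowering lev (contract E)) gact E z.
Proof.
move=> dsH.
have noNN G : lowering lev G -> (None, None) \notin G.
  by move/loweringP=> lowG; apply/negP => /lowG; rewrite ltnn.
rewrite [RHS](partition_big (@contract W U) (lowering lev)) /=; last first.
  by move=> E /andP[].
apply: eq_bigr => G lowG.
have [dsG|ndsG] := boolP (dsg G).
  rewrite (gact_blowup _ dsG dsH); apply: eq_bigl => E.
  rewrite is_blowup_contract ?noNN //.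
  by case: (contract E =P G) => [->|_]; rewrite ?lowG ?andbT ?andbF.
rewrite gact_eq0 // big1 // => E /andP[/andP[_ _] /eqP cE].
apply: gact_eq0; apply: contra ndsG => dsE.
have [u _] : exists u, u \in U by apply/card_gt0P; case/and3P: dsH.
apply: (dsg_lowering (v0 := None) lowG) => o; rewrite -cE.
rewrite -[None]/(contract_vertex (inr u : W + U)).
case: o => [w|]; last exact: connect0.
rewrite -[Some w]/(contract_vertex (inl w : W + U)).
exact/linked_contract/dsg_linked.
Qed.

End LeveledSums.

(** * Splitting off a corolla *)

Section CorollaSplitting.
Variables (k : fieldType) (A : graphAlg k).
Implicit Types (s : seq A) (y : A).

(** Connectedness forces y to be joined to all the entries of s: a single graph
    contributes, the corolla with y on top. *)
Definition corolla s y : A :=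
  Tseq ((1%N, y) :: [seq (0%N, a) | a <- s]).

Lemma perm_enum_sig (V : finType) (P : pred V) :
  perm_eq [seq val u | u <- enum {: {v | P v}}] [seq v <- enum V | P v].
Proof.
apply: uniq_perm.
- by rewrite map_inj_uniq ?enum_uniq //; apply: val_inj.
- by rewrite filter_uniq ?enum_uniq.
move=> v; rewrite mem_filter mem_enum andbT.
apply/mapP/idP => [[u _ ->]|Pv]; first exact: valP.
by exists (Sub v Pv : {v | P v}); rewrite ?mem_enum ?SubK.
Qed.

Section Cluster.
Variables (V : finType) (y : V) (K : {set V}).
Hypothesis yK : y \notin K.
Let in_cluster v := (v == y) || (v \in K).
Local Notation U := {v | in_cluster v}.
Local Notation W := {v | ~~ in_cluster v}.

Let cluster_edges : {set U * U} := [set p | (val p.1 == y) && (val p.2 \in K)].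

Let top : U := Sub y (introT orP (or_introl (eqxx y))).

Let cluster_lowering :
  lowering (fun u : U => (val u == y) : nat) cluster_edges.
Proof.
apply/loweringP => a b; rewrite inE => /andP[/= -> bK].
by case: eqP bK yK => // -> ->.
Qed.

Let cluster_dsg : dsg cluster_edges.
Proof.
apply: (dsg_lowering (v0 := top) cluster_lowering) => u.
have /orP[u_y | uK] := valP u; last first.
  by apply: connect1; rewrite /= !inE /= eqxx uK.
rewrite (_ : u = top); first exact: connect0.
by apply: val_inj; rewrite (eqP u_y).
Qed.

Let corolla_cluster (z : V -> A) :
  corolla [seq z a | a <- enum K] (z y) = gact cluster_edges (z \o val).
Proof.
transitivity (Tfin (fun u : U => (val u == y) : nat) (z \o val)); last first.
  rewrite /Tfin (bigD1 cluster_edges) //= big1 ?addr0 // => E /andP[lowE neE].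
  apply: gact_eq0; apply: contra neE => dsE; rewrite eqEsubset.
  have subE : E \subset cluster_edges.
    apply/subsetP => -[a b] /(loweringP _ _ lowE); rewrite inE /=.
    have /orP[/eqP-> | bK] := valP b; first by rewrite eqxx; case: eqP.
    by rewrite bK andbT; case: (val a == y) => //; rewrite ltn0.
  rewrite subE /=; apply/subsetP => -[a b]; rewrite inE /= => /andP[/eqP a_y bK].
  have /connectP[[|c p] /=] := dsg_linked b a dsE.
    by move=> _ ab; rewrite -ab a_y (negPf yK) in bK.
  case/andP=> bc _ _; case/orP: bc => [bcE | cbE].
    have := subsetP subE _ bcE; rewrite inE /= => /andP[/eqP b_y _].
    by rewrite b_y (negPf yK) in bK.
  have := subsetP subE _ cbE; rewrite inE /= => /andP[/eqP c_y _].
  by rewrite (_ : a = c) //; apply: val_inj; exact: etrans a_y (esym c_y).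
rewrite (Tfin_Tseq _ _ (perm_refl _)).
transitivity (Tseq [seq ((v == y) : nat, z v)
    | v <- [seq val u | u <- enum {: {v | in_cluster v}}]]); last first.
  by rewrite -map_comp.
apply: Tseq_perm; rewrite perm_sym.
apply: (perm_trans (perm_map _ (perm_enum_sig _))).
apply: (@perm_trans _ [seq ((v == y) : nat, z v) | v <- y :: enum K]).
  apply: perm_map; apply: uniq_perm; first by rewrite filter_uniq ?enum_uniq.
    by rewrite /= mem_enum yK enum_uniq.
  by move=> v; rewrite mem_filter mem_enum andbT inE mem_enum.
rewrite /= eqxx -map_comp perm_cons.
suff -> : [seq ((v == y) : nat, z v) | v <- enum K] = [seq (0%N, z v) | v <- enum K].
  exact: perm_refl.
by apply/eq_in_map => v; rewrite mem_enum /= => vK; case: eqP vK yK => // -> ->.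
Qed.

Let join (v : W + U) : V := match v with inl w => val w | inr u => val u end.

Let join_bij : bijective join.
Proof.
pose f v : W + U := if insub v is Some u then inr u
   else if insub v is Some w then inl w else inr top.
exists f => [[w|u]|v]; rewrite /f /=.
- by rewrite insubN ?(valP w) // valK.
- by rewrite valK.
case: insubP => [u _ //|nv].
by case: insubP => [w _ //|]; rewrite /= nv.
Qed.

(** No vertex of the level l outside K is joined to y or K, and all the other
    levels compare in the same way with l and l.+1. The graphs in the sum are
    thus obtained by blowing up a vertex of level l into the corolla on y and K. *)
Lemma sum_gact_cluster (lev : V -> nat) (z : V -> A) (L : {set V}) l :
    K \subset L -> {in L, forall a, lev a = l} -> lev y = l.+1 ->
    (forall v, v \notin L -> v != y -> (lev v != l) && (lev v != l.+1)) ->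
  \sum_(E | lowering lev E && ([set a in L | (y, a) \in E] == K)) gact E z
    = Tseq ((l, corolla [seq z a | a <- enum K] (z y))
            :: [seq (lev v, z v) | v <- enum V & (v != y) && (v \notin K)]).
Proof.
move=> KL levL lev_y lev_other.
pose lev' (o : option W) := if o is Some w then lev (val w) else l.
pose z' (v : W + U) := z (join v).
transitivity (Tfin lev' (fun o => if o is Some w then z' (inl w)
    else gact cluster_edges (z' \o inr))); last first.
  have perm_o : perm_eq (None :: [seq Some w | w <- enum {: {v | ~~ in_cluster v}}]) (enum {: option {v | ~~ in_cluster v}}).
    apply: uniq_perm; rewrite ?enum_uniq //=.
      rewrite map_inj_uniq ?enum_uniq ?andbT; last exact: Some_inj.
      by apply/negP => /mapP[].
    move=> [w|]; rewrite mem_enum inE //=.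
    by apply/mapP; exists w; rewrite ?mem_enum.
  rewrite (Tfin_Tseq _ _ perm_o) /= -corolla_cluster.
  apply: Tseq_perm; rewrite perm_cons -map_comp.
  rewrite perm_sym (_ : [seq _ | w <- enum _] = [seq (lev v, z v)
      | v <- [seq val w | w <- enum {: {v | ~~ in_cluster v}}]]); last first.
    by rewrite -map_comp.
  rewrite perm_sym.
  apply: (perm_trans (perm_map _ (perm_enum_sig _))); apply: perm_map.
  rewrite (@eq_filter _ _ (fun v => (v != y) && (v \notin K))) ?perm_refl //.
  by move=> v; rewrite /in_cluster negb_or.
rewrite (Tfin_blowup _ _ cluster_dsg) [RHS](reindex (preim_edges join)) /=; last first.
  exact/onW_bij/preim_edges_bij.
have levU (u : U) : lev (val u) = (if val u == y then l.+1 else l).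
  have /orP[/eqP-> | uK] := valP u; first by rewrite eqxx lev_y.
  rewrite (levL _ (subsetP KL _ uK)); case: eqP => // u_y.
  by have := yK; rewrite -u_y uK.
have levW (w : W) : lev (val w) != l.+1.
  have := valP w; rewrite /in_cluster negb_or => /andP[w_y _].
  have [/levL-> | wL] := boolP (val w \in L); first by rewrite neq_ltn ltnSn.
  by case/andP: (lev_other _ wL w_y).
have inK (u : U) : (val u \in K) = (val u != y).
  have /orP[/eqP u_y | uK] := valP u; first by rewrite u_y eqxx (negPf yK).
  by rewrite uK; apply/esym; apply: contraNneq yK => <-.
apply: eq_big => [E|E _]; last by rewrite -(gact_bij _ _ join_bij).
apply/andP/andP => -[].
  move=> /loweringP lowE /eqP nbrE; split.
    apply/eqP/setP => -[a b]; rewrite !inE /=.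
    apply/idP/andP => [abE|[/eqP-> ]].
      have := lowE _ _ abE; rewrite !levU.
      move=> lt_ab; apply/andP; rewrite inK; move: lt_ab.
      by case: (val a == y); case: (val b == y); rewrite ?ltnn // ltnNge leqnSn.
    by rewrite -nbrE inE => /andP[].
  apply/loweringP => o o'; rewrite inE => /andP[ne_o].
  case/exists_inP=> -[v v']; rewrite inE /= => vE /eqP[].
  have leU (u : U) : (l <= lev (val u) <= l.+1)%N.
    by rewrite levU; case: ifP; rewrite leqnn leqnSn.
  move: v v' vE => [w|u] [w'|u'] /= vE eq_o eq_o'; move: ne_o;
    rewrite -eq_o -eq_o' //= => _; have := lowE _ _ vE => //=.
  - by apply: leq_ltn_trans; case/andP: (leU u').
  - rewrite levU; case: eqP => // u_y; rewrite ltnS leq_eqVlt.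
    case/orP => // /eqP lev_w.
    have := valP w'; rewrite /= /in_cluster negb_or => /andP[w_y /negP[]].
    move: (sval w') vE lev_w w_y => v' vE lev_w w_y.
    rewrite -nbrE inE -u_y vE andbT.
    apply: contraT => wL; case/andP: (lev_other _ wL w_y).
    by rewrite lev_w eqxx.
move=> /eqP edgesU /loweringP lowC.
have lowE v v' : (join v, join v') \in E ->
    (contract_vertex v, contract_vertex v') != (None, None) ->
    (lev' (contract_vertex v') < lev' (contract_vertex v))%N.
  move=> vE ne_v; apply: lowC; rewrite inE ne_v /=.
  by apply/exists_inP; exists (v, v'); rewrite ?inE.
have inU (u u' : U) : ((val u, val u') \in E) = (val u == y) && (val u' \in K).
  by move/setP/(_ (u, u')): edgesU; rewrite !inE.
have [join' joinK join'K] := join_bij.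
split.
  apply/loweringP => a b; rewrite -(join'K a) -(join'K b).
  move: (join' a) (join' b) => [w|u] [w'|u'] abE.
  - exact: lowE abE _.
  - have /= := lowE _ _ abE isT; rewrite levU => lt_w.
    by case: ifP => // _; rewrite ltn_neqAle eq_sym levW.
  - have /= := lowE _ _ abE isT; rewrite levU => lt_w.
    by case: ifP => // _; apply: leq_trans lt_w _.
  have /andP[u_y u'K] : (val u == y) && (val u' \in K) by rewrite -inU.
  rewrite /= !levU u_y; case: eqP => // u'_y.
  by have := yK; rewrite -u'_y u'K.
apply/eqP/setP => a; rewrite inE; apply/andP/idP => [[aL yaE]|aK].
  apply: contraT => aK; have a_y : a != y.
    by apply: contraTneq aL => ->; apply/negP => /levL/eqP; rewrite lev_y eqn_leq ltnn.
  have a_out : ~~ in_cluster a by rewrite /in_cluster negb_or a_y.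
  have := lowE (inr top) (inl (Sub a a_out)) yaE isT.
  by rewrite /= levL // ltnn.
split; first exact: subsetP KL a aK.
have a_in : in_cluster a by rewrite /in_cluster aK orbT.
by have := inU top (Sub a a_in); rewrite /= eqxx aK.
Qed.

End Cluster.
End CorollaSplitting.

(** * Lists of levels *)

Section Splittings.
Variables (T : Type) (R : nmodType).

Fixpoint splitting_sum (F : seq T -> seq T -> R) (s : seq T) : R :=
  if s is a :: s' then
    splitting_sum (fun s1 s2 => F (a :: s1) s2) s' + splitting_sum (fun s1 s2 => F s1 (a :: s2)) s'
  else F [::] [::].

Lemma eq_splitting_sum (F F' : seq T -> seq T -> R) s :
  (forall s1 s2, F s1 s2 = F' s1 s2) -> splitting_sum F s = splitting_sum F' s.
Proof.
elim: s F F' => [|a s IHs] F F' eqF /=; first exact: eqF.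
by congr (_ + _); apply: IHs => s1 s2; apply: eqF.
Qed.

End Splittings.

Lemma splitting_sum_map (T T' : Type) (R : nmodType) (f : T -> T')
    (F : seq T' -> seq T' -> R) s :
  splitting_sum F (map f s) = splitting_sum (fun s1 s2 => F (map f s1) (map f s2)) s.
Proof. by elim: s F => [|a s IHs] F //=; rewrite !IHs. Qed.

Lemma sum_subset_splitting (V : finType) (R : nmodType) (F : seq V -> seq V -> R)
    (r : seq V) : uniq r ->
  \sum_(K : {set V} | K \subset [set v in r])
     F [seq v <- r | v \in K] [seq v <- r | v \notin K] = splitting_sum F r.
Proof.
elim: r F => [|a r IHr] F /=.
  move=> _; rewrite (big_pred1 set0) // => K.
  by rewrite set_nil subset0.
case/andP=> a_r /IHr{}IHr; rewrite (bigID (fun K : {set V} => a \in K)) /=.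
have subK (K : {set V}) : K \subset [set v in r] -> a \notin K.
  by move/subsetP=> Kr; apply/negP => /Kr; rewrite inE (negPf a_r).
congr (_ + _); rewrite -IHr.
  rewrite (reindex_onto (fun K => a |: K) (fun K => K :\ a)) /=; last first.
    by move=> K /andP[_]; apply: setD1K.
  apply: eq_big => [K|K].
    rewrite setU11 andbT set_cons; apply/andP/idP => [[Kr /eqP eqK]|Kr].
      have := setSD [set a] Kr; rewrite eqK => /subset_trans; apply.
      by apply/subsetP => v; rewrite !inE; case: (v == a).
    by rewrite setU1K ?subK // setUS.
  case/andP=> _ /eqP eqK; rewrite setU11 /=.
  have eq_r v : v \in r -> (v \in a |: K) = (v \in K).
    by rewrite !inE; case: eqP => // ->; rewrite (negPf a_r).
  congr (F (_ :: _) _); apply: eq_in_filter => v vr; by rewrite eq_r.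
apply: eq_big => [K|K /andP[_ aK]]; last by rewrite (negPf aK).
apply/andP/idP => [[Kr aK]|Kr].
  apply/subsetP => v vK; have := subsetP Kr v vK.
  by rewrite !inE; case: eqP vK aK => // -> ->.
split; last exact: subK.
by apply: subset_trans Kr _; apply/subsetP => v; rewrite !inE => ->; rewrite orbT.
Qed.

Section Levels.
Variables (k : fieldType) (A : graphAlg k).
Implicit Types (s : seq A) (y : A) (ls : seq (seq A)).

Fixpoint tagl (i : nat) ls : seq (nat * A) :=
  if ls is s :: ls' then [seq (i, a) | a <- s] ++ tagl i.+1 ls' else [::].

(** The levels are listed from the bottom to the top. *)
Definition Tl ls : A := Tseq (tagl 0 ls).

Lemma tagl_cat i ls1 ls2 :
  tagl i (ls1 ++ ls2) = tagl i ls1 ++ tagl (i + size ls1) ls2.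
Proof.
elim: ls1 i => [|s ls1 IH] i /=; first by rewrite addn0.
by rewrite IH catA addSnnS.
Qed.

Lemma tagl_shift d i ls :
  tagl (d + i) ls = [seq ((d + p.1)%N, p.2) | p <- tagl i ls].
Proof.
by elim: ls i => [|s ls IH] i //=; rewrite -addnS IH map_cat -map_comp.
Qed.

Lemma tagl_level i ls j : j \in [seq p.1 | p <- tagl i ls] ->
  (i <= j < i + size ls)%N.
Proof.
elim: ls i => [|s ls IH] i //=.
rewrite map_cat mem_cat -map_comp => /orP[/mapP[a _ ->] | /IH].
  by rewrite leqnn addnS ltnS leq_addr.
by rewrite addSnnS => /andP[/ltnW-> ->].
Qed.

Lemma Tl_perm ls1 s s' ls2 :
  perm_eq s s' -> Tl (ls1 ++ s :: ls2) = Tl (ls1 ++ s' :: ls2).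
Proof.
move=> perm_s; apply: Tseq_perm; rewrite !tagl_cat perm_cat2l /= perm_cat2r.
exact: perm_map.
Qed.

(** Only the order of the levels matters. Closing the gap left by a level that
    disappears is what [Tl_split] and [Tl_nil] need. *)
Lemma Tseq_gap d ls1 m s ls2 :
  Tseq (tagl 0 ls1 ++ [seq (size ls1 + m, a)%N | a <- s]
        ++ tagl (size ls1 + m + d).+1 ls2) = Tl (ls1 ++ s :: ls2).
Proof.
pose f j := if (j < size ls1)%N then j
  else if (j == size ls1)%N then (j + m)%N else (j + (m + d))%N.
rewrite /Tl tagl_cat /= add0n -[RHS](@Tseq_relevel _ _ f).
  congr Tseq; rewrite !map_cat; congr (_ ++ (_ ++ _)).
  - rewrite -[LHS]map_id; apply/eq_in_map => -[j a] ja; congr (_, _).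
    have := @tagl_level 0 ls1 j (map_f _ ja).
    by rewrite /f /= add0n => ->.
  - by rewrite -map_comp; apply: eq_map => a; rewrite /= /f ltnn eqxx.
  rewrite [(_ + m + d).+1](_ : _ = (m + d + (size ls1).+1)%N); last first.
    by rewrite addnS -addnA addnC.
  rewrite tagl_shift; apply/eq_in_map => -[j a] ja; congr (_, _).
  have := @tagl_level (size ls1).+1 ls2 j (map_f _ ja) => /andP[lt_j _] /=.
  rewrite /f ltnNge ltnW //= -[(j == _)]negbK neq_ltn lt_j orbT /=.
  by rewrite addnC.
have mono_f : {homo f : i j / (i < j)%N}.
  move=> i j lt_ij; rewrite /f; case: (ltngtP i (size ls1)) => [lt_i|lt_i|eq_i].
  - case: (ltngtP j (size ls1)) => [//|_|_].
      exact: leq_trans lt_ij (leq_addr _ _).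
    exact: leq_trans lt_ij (leq_addr _ _).
  - have lt_j := ltn_trans lt_i lt_ij.
    by rewrite [(j < _)%N]ltnNge (ltnW lt_j) (gtn_eqF lt_j) /= ltn_add2r.
  rewrite -eq_i [(j < _)%N]ltnNge (ltnW lt_ij) (gtn_eqF lt_ij) /=.
  by rewrite -addSn leq_add // leq_addr.
by move=> i j _ _; apply: (leqW_mono (leq_mono mono_f)).
Qed.

Lemma Tl_nil ls1 ls2 : Tl (ls1 ++ [::] :: ls2) = Tl (ls1 ++ ls2).
Proof.
case: ls2 => [|s ls2].
  by rewrite /Tl !tagl_cat /= cats0.
rewrite -(Tseq_gap 0 ls1 1 s ls2) /Tl tagl_cat /= add0n.
by rewrite addn1 addn0.
Qed.

Lemma Tseq_corolla s y : corolla s y = Tl [:: s; [:: y]].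
Proof. by apply: Tseq_perm; rewrite /= -cat1s perm_catC. Qed.

Lemma corolla_perm s s' y : perm_eq s s' -> corolla s y = corolla s' y.
Proof. by move=> ?; rewrite !Tseq_corolla; apply: (@Tl_perm [::]). Qed.

Lemma Tseq_split l s y (ctx : seq (nat * A)) :
    (forall j, j \in [seq p.1 | p <- ctx] -> (j != l) && (j != l.+1)) ->
  Tseq ((l.+1, y) :: [seq (l, a) | a <- s] ++ ctx)
    = splitting_sum (fun s1 s2 => Tseq ((l, corolla s1 y) :: [seq (l, a) | a <- s2] ++ ctx)) s.
Proof.
move=> ctx_lev; pose n := size s; pose m := size ctx.
pose V := option ('I_n + 'I_m).
pose z (v : V) : A := match v with
  | None => y | Some (inl i) => nth 0 s i | Some (inr j) => (nth (0%N, 0) ctx j).2 end.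
pose lev (v : V) : nat := match v with
  | None => l.+1 | Some (inl i) => l | Some (inr j) => (nth (0%N, 0) ctx j).1 end.
pose r1 : seq V := [seq Some (inl i) | i <- enum 'I_n].
pose r2 : seq V := [seq Some (inr j) | j <- enum 'I_m].
have r1_lev v : v \in r1 -> lev v = l by case/mapP=> i _ ->.
have z_r1 : map z r1 = s.
  rewrite -map_comp; apply: (@eq_from_nth _ 0); rewrite size_map size_enum_ord //.
  move=> i lt_i; rewrite (nth_map (Ordinal lt_i)) ?size_enum_ord //=.
  by rewrite nth_enum_ord.
have r2E : [seq (lev v, z v) | v <- r2] = ctx.
  rewrite -map_comp; apply: (@eq_from_nth _ (0%N, 0)); rewrite size_map size_enum_ord //.
  move=> i lt_i; rewrite (nth_map (Ordinal lt_i)) ?size_enum_ord //=.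
  by rewrite nth_enum_ord //; case: nth.
have uniq_r1 : uniq r1 by rewrite map_inj_uniq ?enum_uniq // => i j [].
have uniq_r2 : uniq r2 by rewrite map_inj_uniq ?enum_uniq // => i j [].
have perm_r : perm_eq (None :: r1 ++ r2) (enum {: V}).
  apply: uniq_perm; rewrite ?enum_uniq //=.
    rewrite cat_uniq uniq_r1 uniq_r2 mem_cat andbT /=.
    apply/andP; split; first by apply/norP; split; apply/negP => /mapP[].
    by apply/hasPn => v /mapP[j _ ->]; apply/negP => /mapP[].
  move=> [[i|j]|]; rewrite mem_enum inE //= mem_cat.
    by rewrite map_f ?mem_enum.
  by apply/orP; right; rewrite map_f ?mem_enum.
have mem_r v : (v == None) || ((v \in r1) || (v \in r2)).
  by rewrite -mem_cat -in_cons (perm_mem perm_r) mem_enum.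
have r1_map r : {subset r <= r1} -> [seq (lev v, z v) | v <- r] = [seq (l, a) | a <- map z r].
  by move=> r_r1; rewrite -map_comp; apply/eq_in_map => v /r_r1/r1_lev /= ->.
transitivity (Tfin lev z).
  rewrite (Tfin_Tseq _ _ perm_r) /= map_cat r2E r1_map //.
  by rewrite z_r1.
pose L := [set v in r1].
rewrite /Tfin (partition_big (fun E : {set V * V} => [set a in L | (None, a) \in E])
  (fun K : {set V} => K \subset L)) /=; last first.
  by move=> E _; apply/subsetP => a; rewrite inE => /andP[].
rewrite -[in RHS]z_r1 splitting_sum_map -sum_subset_splitting //; apply: eq_bigr => K KL.
rewrite (@sum_gact_cluster _ _ _ None K _ _ _ L l) //.
- have perm_K : perm_eq [seq z a | a <- enum K] [seq z v | v <- r1 & v \in K].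
    apply: perm_map; apply: uniq_perm; rewrite ?enum_uniq ?filter_uniq //.
    move=> v; rewrite mem_enum mem_filter; case: (boolP (v \in K)) => //= vK.
    by have := subsetP KL v vK; rewrite inE => ->.
  rewrite (corolla_perm _ perm_K); apply: Tseq_perm; rewrite perm_cons.
  rewrite -r1_map; last by move=> v; rewrite mem_filter => /andP[].
  rewrite -[in X in perm_eq _ X]r2E -map_cat; apply: perm_map; apply: uniq_perm.
  - by rewrite filter_uniq ?enum_uniq.
  - rewrite cat_uniq filter_uniq // uniq_r2 andbT /=.
    apply/hasPn => v /mapP[j _ ->]; rewrite mem_filter negb_and.
    by apply/orP; right; apply/negP => /mapP[].
  move=> v; rewrite mem_filter mem_enum andbT mem_cat mem_filter.
  have := mem_r v; case: eqP => [->|_] /=.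
    by move=> _; apply/esym/negP => /orP[/andP[_ /mapP[]//]|/mapP[]//].
  case: (boolP (v \in r2)) => [/mapP[j _ ->]|_].
    rewrite !orbT => _; suff -> : Some (inr j) \notin K by [].
    by apply/negP => /(subsetP KL); rewrite inE => /mapP[].
  by rewrite orbF => ->; rewrite andbT orbF.
- by apply/negP => /(subsetP KL); rewrite inE => /mapP[].
- by move=> a; rewrite inE => /r1_lev.
move=> v; rewrite inE => v_r1 v_y.
have := mem_r v; rewrite (negPf v_y) (negPf v_r1) /= => /mapP.
case=> j _ ->; apply: ctx_lev; rewrite -r2E -map_comp.
by apply/mapP; exists (Some (inr j)); rewrite // map_f ?mem_enum.
Qed.

(** Sum over the set s1 of the entries of s below y. Contracting y with them
    leaves the other entries s2 of the level, together with one new entry, the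
    corolla. *)
Lemma Tl_split ls1 s y ls2 :
  Tl (ls1 ++ s :: [:: y] :: ls2)
    = splitting_sum (fun s1 s2 => Tl (ls1 ++ (corolla s1 y :: s2) :: ls2)) s.
Proof.
pose l := size ls1; pose ctx := tagl 0 ls1 ++ tagl l.+2 ls2.
have ctx_lev j : j \in [seq p.1 | p <- ctx] -> (j != l) && (j != l.+1).
  rewrite map_cat mem_cat => /orP[/tagl_level|/tagl_level].
    by rewrite add0n -/l => lt_j; rewrite !ltn_eqF // ltnW.
  by case/andP=> lt_j _; rewrite !gtn_eqF // ltnW.
transitivity (Tseq ((l.+1, y) :: [seq (l, a) | a <- s] ++ ctx)).
  apply: Tseq_perm; rewrite tagl_cat /= -/l.
  rewrite -[(l.+1, y) :: tagl _ _]cat1s -[(l.+1, y) :: _ ++ ctx]cat1s /ctx.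
  by rewrite perm_catCA perm_sym !catA perm_cat2r -!catA perm_catCA perm_cat2l perm_catC.
rewrite Tseq_split //; apply: eq_splitting_sum => s1 s2.
rewrite -(Tseq_gap 1 ls1 0 (_ :: s2) ls2) addn0 addn1 -/l.
by apply: Tseq_perm; rewrite /= -cat_cons perm_catCA.
Qed.

End Levels.

(** * Multilinearity *)

Section Linearity.
Variables (k : fieldType) (A : graphAlg k).
Implicit Types (s : seq A) (y : A) (ls : seq (seq A)).

Lemma eact_linear n (E : {set 'I_n.+1 * 'I_n.+1}) (z : 'I_n.+1 -> A) c u v :
  eact E (fun i => if i == ord0 then c *: u + v else z i)
    = c *: eact E (fun i => if i == ord0 then u else z i)
      + eact E (fun i => if i == ord0 then v else z i).
Proof.
rewrite /eact; case: insub => [h|]; last by rewrite scaler0 addr0.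
have updE w : [ffun i => if i == ord0 then w else z i] = update [ffun i => z i] ord0 w.
  by apply/ffunP => i; rewrite !ffunE.
by rewrite !updE gop_multilinear.
Qed.

Lemma Tseq_linear l c (u v : A) (s : seq (nat * A)) :
  Tseq ((l, c *: u + v) :: s) = c *: Tseq ((l, u) :: s) + Tseq ((l, v) :: s).
Proof.
rewrite /Tseq /Tfin /=.
have lev_eq a (i : 'I_(size s).+1) :
  (nth (0%N, 0) ((l, a) :: s) i).1 = (nth (0%N, 0) ((l, 0) :: s) i).1 by case: i => [[]].
have lowE a E : lowering (fun i : 'I_(size s).+1 => (nth (0%N, 0) ((l, a) :: s) i).1) E
   = lowering (fun i : 'I_(size s).+1 => (nth (0%N, 0) ((l, 0) :: s) i).1) E.
  by apply: eq_forallb => p; rewrite lev_eq (lev_eq a).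
rewrite [LHS](eq_bigl _ _ (lowE _)).
under [X in _ = c *: X + _]eq_bigl do rewrite lowE.
under [X in _ = _ + X]eq_bigl do rewrite lowE.
rewrite scaler_sumr -big_split /=; apply: eq_bigr => E _.
have headE a : gact E (fun i : 'I_(size s).+1 => (nth (0%N, 0) ((l, a) :: s) i).2)
   = eact E (fun i => if i == ord0 then a else (nth (0%N, 0) ((l, 0) :: s) i).2).
  by rewrite gact_ord; apply: eq_eact => -[[]].
by rewrite !headE eact_linear.
Qed.

(** Singling out one entry allows linearity to be declared. *)
Definition Tl_entry ls1 s ls2 (a : A) : A := Tl (ls1 ++ (a :: s) :: ls2).

Lemma Tl_entryE ls1 s ls2 a :
  Tl_entry ls1 s ls2 a = Tseq ((size ls1, a) :: tagl 0 (ls1 ++ s :: ls2)).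
Proof.
apply: Tseq_perm; rewrite !tagl_cat /= add0n.
by rewrite -[X in perm_eq _ X]cat1s -[(_, a) :: _ ++ _]cat1s perm_catCA.
Qed.

Fact Tl_entry_linear ls1 s ls2 : linear (Tl_entry ls1 s ls2).
Proof. by move=> c u v; rewrite !Tl_entryE Tseq_linear. Qed.

HB.instance Definition _ ls1 s ls2 :=
  GRing.isLinear.Build k A A *:%R (Tl_entry ls1 s ls2) (Tl_entry_linear ls1 s ls2).

Lemma eact_unlinked n (z : 'I_n -> A) (i j : 'I_n) : i != j -> eact set0 z = 0.
Proof.
move=> ne_ij; apply: eact_eq0; apply/negP => /and3P[_ _ /'forall_forallP/= /(_ i j)].
case/connectP=> -[|c p] /=; first by move=> _ ji; rewrite ji eqxx in ne_ij.
by rewrite !inE.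
Qed.

(** Without edges, a graph is connected only if it has a single vertex. *)
Lemma Tl_level s : Tl [:: s] = if s is [:: a] then a else 0.
Proof.
rewrite /Tl /= cats0 /Tseq; set t := map _ s.
rewrite /Tfin (big_pred1 set0) => [|E]; last first.
  apply/loweringP/eqP => [lowE|-> a b]; last by rewrite inE.
  apply/setP => -[a b]; rewrite !inE; apply/negP => /lowE.
  rewrite [X in (_ < X)%N](_ : _ = 0%N) ?ltn0 //.
  by rewrite (nth_map 0) //; have := ltn_ord a; rewrite [X in (_ < X)%N]size_map.
rewrite gact_ord {}/t; case: s => [|a [|b s]] /=.
- by rewrite eact_eq0 // /is_dsgraph.
- rewrite -[set0]/(val vertex_graph) eact_val gop_unit ffunE //.
exact: (@eact_unlinked _ _ ord0 (lift ord0 ord0)).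
Qed.

Lemma Tl_empty : Tl [::] = 0 :> A.
Proof. by rewrite -(Tl_nil [::] [::]) (Tl_level [::]). Qed.

Lemma corolla_nil y : corolla [::] y = y.
Proof. by rewrite Tseq_corolla (Tl_nil [::]) (Tl_level [:: y]). Qed.

Lemma corolla1 (a b : A) :
  corolla [:: a] b = gop edge_graph [ffun i => if i == bottom2 then a else b].
Proof.
rewrite Tseq_corolla /Tl /Tseq /=; pose E0 : {set 'I_2 * 'I_2} := [set (top2, bottom2)].
have all2 (i : 'I_2) : i = bottom2 \/ i = top2.
  by case: i => -[|[|i]] lt_i //; [left | right]; apply: val_inj.
rewrite /Tfin (bigD1 E0) /=; last first.
  by apply/loweringP => i j; rewrite inE => /eqP[-> ->].
rewrite big1 => [|E /andP[/loweringP lowE neE]].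
  rewrite addr0 gact_ord -[E0]/(val edge_graph) eact_val; congr gop.
  by apply/ffunP => i; rewrite !ffunE; case: (all2 i) => ->.
suff -> : E = set0 by rewrite gact_ord (@eact_unlinked _ _ bottom2 top2).
have E_E0 : E \subset E0.
  apply/subsetP => -[i j] /lowE.
  by case: (all2 i) => ->; case: (all2 j) => -> //=; rewrite inE.
by have := subset1 E (top2, bottom2); rewrite E_E0 (negPf neE) => /esym/eqP.
Qed.

(** The terms in which a and b are not joined do not depend on their order, and
    an edge between them contracts to a corolla with one leaf. *)
Lemma Tl_commutator ls1 (a b : A) ls2 :
  Tl (ls1 ++ [:: [:: a]; [:: b]] ++ ls2) - Tl (ls1 ++ [:: [:: b]; [:: a]] ++ ls2)
    = Tl (ls1 ++ [:: corolla [:: a] b - corolla [:: b] a] :: ls2).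
Proof.
rewrite /= !Tl_split /= !corolla_nil.
rewrite (@Tl_perm _ _ ls1 [:: b; a] [:: a; b]) ?(perm_catC [:: b] [:: a]) //.
rewrite opprD addrACA subrr addr0.
by rewrite -[RHS]/(Tl_entry ls1 [::] ls2 _) linearB.
Qed.

End Linearity.

(** * Filtrations *)

Record filteredAlg (k : fieldType) := FilteredAlg {
  falg :> graphAlg k;
  Fil : nat -> falg -> Prop;
  Fil_subspace : forall p, subspace (Fil p);
  Fil_full : forall x, Fil 0 x;
  Fil_desc : forall p x, Fil p.+1 x -> Fil p x;
  Fil_gop : forall n (g : dsGra n) (x : {ffun 'I_n -> falg}) (p : 'I_n -> nat),
    (forall i, Fil (p i) (x i)) -> Fil (\sum_i p i)%N (gop g x);
  Fil_separated : forall x, (forall p, Fil p x) -> x = 0;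
  Fil_complete : forall v : nat -> falg,
    (forall p, Fil p (v p.+1 - v p)) -> exists x, forall p, Fil p (x - v p)
}.

Section Filtration.
Variables (k : fieldType) (A : filteredAlg k).
Implicit Types (s : seq A) (x y : A) (ls : seq (seq A)).

Lemma Fil_0 p : Fil p (0 : A).
Proof. by case: (Fil_subspace A p). Qed.

Lemma FilD p x y : Fil p x -> Fil p y -> Fil p (x + y).
Proof. by move=> Fx Fy; case: (Fil_subspace A p) => _ /(_ 1 x y); rewrite scale1r; apply. Qed.

Lemma FilZ p c x : Fil p x -> Fil p (c *: x).
Proof.
move=> Fx; case: (Fil_subspace A p) => F0 /(_ c x 0); rewrite addr0; exact.
Qed.

Lemma FilN p x : Fil p x -> Fil p (- x).
Proof. by rewrite -scaleN1r; apply: FilZ. Qed.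

Lemma FilB p x y : Fil p x -> Fil p y -> Fil p (x - y).
Proof. by move=> Fx /FilN; apply: FilD. Qed.

Lemma Fil_sum p (I : Type) (r : seq I) (P : pred I) (f : I -> A) :
  (forall i, P i -> Fil p (f i)) -> Fil p (\sum_(i <- r | P i) f i).
Proof. by move=> Ff; elim/big_ind: _ => //; [apply: Fil_0 | apply: FilD]. Qed.

Lemma Fil_leq p q x : (p <= q)%N -> Fil q x -> Fil p x.
Proof.
move=> /subnK <-; elim: (q - p)%N => [|d IHd] //; rewrite addSn => /Fil_desc.
exact: IHd.
Qed.

Fixpoint total_index p s : Prop :=
  if s is a :: s' then exists q r, [/\ p = (q + r)%N, Fil q a & total_index r s']
  else p = 0%N.

Lemma total_index_cat p q s1 s2 : total_index p s1 -> total_index q s2 -> total_index (p + q) (s1 ++ s2).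
Proof.
elim: s1 p => [|a s1 IH] p /=; first by move=> ->.
case=> p1 [p2 [-> Fa Fs1]] Fs2; exists p1, (p2 + q)%N.
by split; [rewrite addnA | | apply: IH].
Qed.

Lemma total_index_size s : (forall a, a \in s -> Fil 1 a) -> total_index (size s) s.
Proof.
elim: s => [|a s IHs] //= Fs; exists 1%N, (size s); split=> //.
  by apply: Fs; rewrite mem_head.
by apply: IHs => b bs; apply: Fs; rewrite inE bs orbT.
Qed.

Lemma Fil_Tseq p (s : seq (nat * A)) : total_index p [seq q.2 | q <- s] -> Fil p (Tseq s).
Proof.
move=> Fs; have [w Fw ->] : exists2 w : nat -> nat,
    forall i, (i < size s)%N -> Fil (w i) (nth (0%N, 0) s i).2
    & p = (\sum_(i < size s) w i)%N.
  elim: s p Fs => [|a s IHs] p /=; first by move=> ->; exists id; rewrite ?big_ord0.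
  case=> q [r [-> Fa /IHs[w Fw ->]]].
  exists (fun i => if i is i'.+1 then w i' else q).
    by case=> [|i] //; apply: Fw.
  by rewrite big_ord_recl.
apply: Fil_sum => E _; rewrite gact_ord /eact.
case: insub => [h|]; last exact: Fil_0.
by apply: Fil_gop => i; rewrite ffunE; apply: Fw.
Qed.

Lemma Fil_Tl p ls : total_index p (flatten ls) -> Fil p (Tl ls).
Proof.
move=> Fls; apply: Fil_Tseq; rewrite (_ : map _ _ = flatten ls) //.
elim: ls {Fls} 0%N => [|s ls IH] i //=.
by rewrite map_cat IH -map_comp map_id.
Qed.

Definition congF N x y : Prop := Fil N (x - y).

Lemma congF_refl N x : congF N x x.
Proof. by rewrite /congF subrr; apply: Fil_0. Qed.

Lemma congF_sym N x y : congF N x y -> congF N y x.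
Proof. by rewrite /congF -opprB => /FilN; rewrite opprK. Qed.

Lemma congF_trans N y x z : congF N x y -> congF N y z -> congF N x z.
Proof. by move=> Fxy Fyz; rewrite /congF -(subrKA y); apply: FilD. Qed.

Lemma congFD N x x' y y' : congF N x x' -> congF N y y' -> congF N (x + y) (x' + y').
Proof. by move=> Fx Fy; rewrite /congF opprD addrACA; apply: FilD. Qed.

Lemma congFZ N c x x' : congF N x x' -> congF N (c *: x) (c *: x').
Proof. by move=> Fx; rewrite /congF -scalerBr; apply: FilZ. Qed.

Lemma congFB N x x' y y' : congF N x x' -> congF N y y' -> congF N (x - y) (x' - y').
Proof. by move=> Fx Fy; rewrite /congF opprD addrACA -opprD; apply: FilB. Qed.

Lemma congF_sum N (I : Type) (r : seq I) (P : pred I) (f f' : I -> A) :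
  (forall i, P i -> congF N (f i) (f' i)) ->
  congF N (\sum_(i <- r | P i) f i) (\sum_(i <- r | P i) f' i).
Proof. by move=> Ff; rewrite /congF -sumrB; apply: Fil_sum. Qed.

Lemma congF_leq N N' x y : (N <= N')%N -> congF N' x y -> congF N x y.
Proof. exact: Fil_leq. Qed.

Lemma congF_eq x y : (forall N, congF N x y) -> x = y.
Proof. by move=> Fxy; apply/eqP; rewrite -subr_eq0; apply/eqP/Fil_separated. Qed.

Lemma congF_Fil N x y : congF N x y -> Fil N y -> Fil N x.
Proof. by move=> Fxy Fy; rewrite -(subrK y x); apply: FilD. Qed.

Lemma congF0 N x : congF N x 0 <-> Fil N x.
Proof. by rewrite /congF subr0. Qed.

(** By linearity the difference is the ordered product with a - a' as an entry. *)
Lemma congF_entry p q ls1 s ls2 a a' : congF p a a' ->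
  total_index q (flatten (ls1 ++ s :: ls2)) ->
  congF (p + q) (Tl (ls1 ++ (a :: s) :: ls2)) (Tl (ls1 ++ (a' :: s) :: ls2)).
Proof.
move=> Fa Fs; rewrite /congF -![Tl _]/(Tl_entry _ _ _ _) -linearB /= Tl_entryE.
apply: Fil_Tseq => /=; exists p, q; split=> //.
rewrite (_ : map _ _ = flatten (ls1 ++ s :: ls2)) //.
elim: (ls1 ++ s :: ls2) {Fs} 0%N => [|s' ls IH] i //=.
by rewrite map_cat IH -map_comp map_id.
Qed.

End Filtration.

(** * Levels of graph exponentials *)

Lemma natr_neq0 (k : fieldType) (n : nat) :
  [pchar k] =i pred0 -> (n.+1%:R != 0 :> k).
Proof. by move/pcharf0P => ->. Qed.

Lemma factr_neq0 (k : fieldType) (n : nat) : [pchar k] =i pred0 -> (n`!%:R != 0 :> k).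
Proof. by move/pcharf0P => ->; rewrite -lt0n fact_gt0. Qed.

Section Exponents.
Variable M : nat.

(** The bound M makes these sequences finite in number; it is harmless for those
    of a given sum at most M. *)
Fixpoint exponents n : seq (seq nat) :=
  if n is n'.+1 then [seq i.+1 :: s | i <- index_iota 0 M, s <- exponents n']
  else [:: [::]].

Lemma sum_exponentsS (V : nmodType) n (F : seq nat -> V) :
  \sum_(s <- exponents n.+1) F s
    = \sum_(i < M) \sum_(s <- exponents n) F (i.+1 :: s).
Proof. by rewrite big_allpairs_dep /= big_mkord. Qed.

Lemma sum_exponents0 (V : nmodType) (F : seq nat -> V) :
  \sum_(s <- exponents 0) F s = F [::].
Proof. by rewrite big_seq1. Qed.

Lemma exponents_size n s : s \in exponents n -> size s = n /\ (n <= sumn s)%N.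
Proof.
elim: n s => [|n IHn] s; first by rewrite inE => /eqP->.
case/allpairsPdep=> i [s' [_ /IHn[<- le_s] ->]]; split=> //=.
by rewrite addSn ltnS (leq_trans le_s) // leq_addl.
Qed.

(** By symmetry, each of the n.+1 exponents contributes the same amount to their
    sum. *)
Lemma sum_exponents_sumn (k : fieldType) (V : lmodType k) n (F : seq nat -> V) :
    (forall s s', perm_eq s s' -> F s = F s') ->
  \sum_(s <- exponents n.+1) (sumn s)%:R *: F s
    = n.+1%:R *: \sum_(i < M) i.+1%:R *: \sum_(s <- exponents n) F (i.+1 :: s).
Proof.
elim: n F => [|n IHn] F symF; rewrite sum_exponentsS.
  rewrite scale1r; apply: eq_bigr => i _.
  by rewrite !sum_exponents0 /= addn0.
transitivity (\sum_(i < M) (i.+1%:R *: \sum_(s <- exponents n.+1) F (i.+1 :: s)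
    + \sum_(s <- exponents n.+1) (sumn s)%:R *: F (i.+1 :: s))).
  apply: eq_bigr => i _; rewrite scaler_sumr -big_split /=.
  by apply: eq_bigr => s _; rewrite natrD scalerDl.
rewrite big_split /= -[n.+2]addn1 natrD addrC scalerDl scale1r; congr (_ + _).
rewrite (eq_bigr (fun i : 'I_M => n.+1%:R *: \sum_(j < M) j.+1%:R *:
    \sum_(s <- exponents n) F [:: i.+1, j.+1 & s])) => [|i _]; last first.
  by apply: IHn => s s' perm_s; apply: symF; rewrite perm_cons.
rewrite -scaler_sumr exchange_big /=; congr (_ *: _); apply: eq_bigr => j _.
rewrite -scaler_sumr sum_exponentsS; congr (_ *: _); apply: eq_bigr => i _.
by apply: eq_bigr => s _; apply: symF; rewrite (perm_catCA [:: _] [:: _]).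
Qed.

(** A splitting is a choice of positions, after which the two parts are
    arbitrary. *)
Lemma sum_exponents_splitting (k : fieldType) (V : lmodType k) N
    (F : seq nat -> seq nat -> V) :
  \sum_(s <- exponents N) splitting_sum F s
    = \sum_(i < N.+1) 'C(N, i)%:R *:
        \sum_(s1 <- exponents i) \sum_(s2 <- exponents (N - i)) F s1 s2.
Proof.
elim: N F => [|N IHN] F.
  by rewrite sum_exponents0 big_ord_recl big_ord0 addr0 !sum_exponents0 scale1r.
rewrite sum_exponentsS.
under eq_bigr => j _ do rewrite big_split /= !IHN.
rewrite big_split /= exchange_big /= [X in _ + X]exchange_big /=.
pose S i n := \sum_(s1 <- exponents i) \sum_(s2 <- exponents n) F s1 s2.
transitivity (\sum_(i < N.+1) 'C(N, i)%:R *: S i.+1 (N - i)%N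
    + \sum_(i < N.+1) 'C(N, i)%:R *: S i (N - i).+1).
  congr (_ + _); apply: eq_bigr => i _; rewrite -scaler_sumr; congr (_ *: _).
    by rewrite /S sum_exponentsS.
  rewrite exchange_big /=; apply: eq_bigr => s1 _.
  by rewrite sum_exponentsS.
rewrite -[RHS]/(\sum_(i < N.+2) 'C(N.+1, i)%:R *: S i (N.+1 - i)%N).
rewrite [RHS]big_ord_recl [X in _ + X]big_ord_recl /= !bin0 subn0 addrCA.
congr (_ + _).
under [RHS]eq_bigr => i _.
  rewrite /bump /= add1n subSS binS natrD scalerDl; over.
rewrite big_split /= addrC; congr (_ + _).
rewrite [RHS]big_ord_recr /= bin_small // scale0r addr0.
apply: eq_bigr => i _; rewrite /bump /= add1n; congr (_ *: S _ _).
by rewrite subnSK.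
Qed.

End Exponents.
Arguments exponents M n : simpl never.

Lemma nseqS_cat (T : Type) n (x : T) s : nseq n.+1 x ++ s = nseq n x ++ x :: s.
Proof. by elim: n => //= n ->. Qed.

Lemma sum_ord_trunc (V : nmodType) p q (f : nat -> V) : (p <= q)%N ->
  (forall n, (p <= n)%N -> f n = 0) -> \sum_(n < q) f n = \sum_(n < p) f n.
Proof.
move=> le_pq f0; rewrite -!(big_mkord xpredT f) (big_cat_nat (leq0n p) le_pq) /=.
by rewrite [X in _ + X]big_nat_cond [X in _ + X]big1 ?addr0 // => n /andP[/andP[/f0]].
Qed.

Lemma sum_triangle (V : nmodType) D (a : nat -> nat -> V) :
  \sum_(N < D) \sum_(i < N.+1) a i (N - i)%N = \sum_(i < D) \sum_(n < D - i) a i n.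
Proof.
elim: D => [|D IHD]; first by rewrite !big_ord0.
rewrite big_ord_recr /= IHD [RHS]big_ord_recr /= subSnn big_ord1.
rewrite [X in _ + X]big_ord_recr /= subnn addrA; congr (_ + _).
rewrite -big_split /=; apply: eq_bigr => i _.
by rewrite subSn ?big_ord_recr //= ltnW.
Qed.

Section LevelExponential.
Variables (k : fieldType) (char0 : [pchar k] =i pred0) (A : graphAlg k).
Implicit Types (ls : seq (seq A)) (t : seq nat).
Variable y : A.

(** The part of degree m in y of the graph exponential of y, by
    [exp_term_classes]. *)
Definition exp_term m : A := (m`!%:R)^-1 *: Tl (nseq m [:: y]).

Lemma eq_addn_sub m i j : ((i + j)%N == m) = (i <= m)%N && (j == m - i)%N.
Proof.
case: leqP => [le_im|lt_mi]; first by rewrite -{1}(subnKC le_im) eqn_add2l.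
by rewrite gtn_eqF // (leq_trans lt_mi) ?leq_addr.
Qed.

Lemma splitting_sum_sumn (V : lmodType k) (m : nat) (F : seq nat -> seq nat -> V) t :
  splitting_sum (fun t1 t2 => (sumn t1 + sumn t2 == m)%N%:R *: F t1 t2) t
    = (sumn t == m)%:R *: splitting_sum F t.
Proof.
elim: t m F => [|i t IHt] m F //=; rewrite scalerDr eq_addn_sub.
have [le_im|lt_mi] /= := leqP i m.
  rewrite -!IHt; congr (_ + _); apply: eq_splitting_sum => t1 t2.
    by rewrite /= -addnA eq_addn_sub le_im.
  by rewrite /= addnCA eq_addn_sub le_im.
have split0 (G : seq nat -> seq nat -> V) : (forall t1 t2, G t1 t2 = 0) -> splitting_sum G t = 0.
  by elim: (t) G => [|j t' IH] G G0 /=; rewrite ?G0 // !IH ?addr0 // => *; apply: G0.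
by rewrite !scale0r !split0 // => t1 t2;
  rewrite /= -?addnA ?(addnCA (sumn t1)) eq_addn_sub leqNgt lt_mi scale0r.
Qed.

Lemma sum_indicator D (a b m : nat) (v : A) : (m < D)%N ->
  \sum_(i < D) (i + b == m)%N%:R *: ((a == i)%:R *: v) = (a + b == m)%N%:R *: v.
Proof.
move=> lt_mD; have [lt_aD|le_Da] := ltnP a D.
  rewrite (bigD1 (Ordinal lt_aD)) //= eqxx scale1r big1 ?addr0 // => i ne_i.
  suff -> : (a == i) = false by rewrite mulr0n scale0r scaler0.
  by apply: contraNF ne_i => /eqP ai; apply/eqP/val_inj.
rewrite big1 => [|i _]; last first.
  by rewrite (gtn_eqF (leq_trans (ltn_ord i) le_Da)) mulr0n scale0r scaler0.
by rewrite gtn_eqF ?scale0r // (leq_trans lt_mD) // (leq_trans le_Da) // leq_addr.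
Qed.

(** With the notations of the beginning, this is the coefficient of t^m in E(c)
    = exp (t y), where c is the graph exponential of t y, inside an ordered
    product. Both sides satisfy F' = F * y. Indeed, the derivative of E(c) is
    the symmetric product of E(c) and c', where c' is the connected part of E(c)
    * y by the same identity, applied with y as the only other level; and
    [Tl_split] expresses E(c) * y in this way. For the coefficients this is an
    induction on m: the derivative of the term of degree m.+1 is m.+1 times its
    coefficient. *)
Lemma exp_level D m ls1 ls2 : (m < D)%N ->
  \sum_(n < D) (n`!%:R)^-1 *: \sum_(t <- exponents D n)
      (sumn t == m)%:R *: Tl (ls1 ++ map exp_term t :: ls2)
    = (m`!%:R)^-1 *: Tl (ls1 ++ nseq m [:: y] ++ ls2).
Proof.
elim/ltn_ind: m ls1 ls2 => -[_|m IH] ls1 ls2 lt_mD.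
  case: D lt_mD => // D _.
  rewrite big_ord_recl sum_exponents0 /= scale1r Tl_nil big1 => [|i _]; last first.
    rewrite big_seq big1 ?scaler0 // => t /exponents_size[_].
    by case: sumn => // p _; rewrite scale0r.
  by rewrite addr0.
apply: (scalerI (natr_neq0 m char0)).
have factV n : n.+1%:R * (n.+1`!%:R)^-1 = (n`!%:R)^-1 :> k.
  by rewrite factS natrM invfM mulrA divff ?mul1r ?natr_neq0.
(* The corolla on t1 and y is the derivative of one factor, and t lists the
   exponents of the other factors. *)
pose Psi t1 t := Tl (ls1 ++ (corolla (map exp_term t1) y :: map exp_term t) :: ls2).
pose G p n := \sum_(t1 <- exponents D p) \sum_(t <- exponents D n)
  (sumn t1 + sumn t == m)%N%:R *: Psi t1 t.
have G0 p n : (m < p + n)%N -> G p n = 0.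
  move=> lt_m; rewrite /G big_seq big1 // => t1 /exponents_size[_ le_t1].
  rewrite big_seq big1 // => t /exponents_size[_ le_t].
  by rewrite gtn_eqF ?scale0r // (leq_trans lt_m) // leq_add.
transitivity (\sum_(p < D) \sum_(n < D.-1) (p`!%:R * n`!%:R)^-1 *: G p n); last first.
  have -> : ls1 ++ nseq m.+1 [:: y] ++ ls2 = ls1 ++ nseq m [:: y] ++ [:: y] :: ls2.
    by rewrite nseqS_cat.
  rewrite scalerA factV -IH ?(ltnW lt_mD) //.
  transitivity (\sum_(N < D) \sum_(i < N.+1) (i`!%:R * (N - i)`!%:R)^-1 *: G i (N - i)%N).
    rewrite (sum_triangle D (fun p n => (p`!%:R * n`!%:R)^-1 *: G p n)).
    apply: eq_bigr => p _.
    pose f n := (p`!%:R * n`!%:R)^-1 *: G p n.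
    have f0 n : (m.+1 - p <= n)%N -> f n = 0.
      by move=> le_n; rewrite /f G0 ?scaler0 // -leq_subLR.
    rewrite (@sum_ord_trunc _ (m.+1 - p) _ f) ?(@sum_ord_trunc _ (m.+1 - p) (D - p) f) //.
      by rewrite leq_sub2r // ltnW.
    by rewrite (leq_trans (leq_subr _ _)) // -ltnS prednK // (leq_trans _ lt_mD).
  apply: eq_bigr => N _.
  transitivity ((N`!%:R)^-1 *: \sum_(t <- exponents D N)
      splitting_sum (fun t1 t2 => (sumn t1 + sumn t2 == m)%N%:R *: Psi t1 t2) t).
    rewrite sum_exponents_splitting scaler_sumr; apply: eq_bigr => i _.
    have le_iN : (i <= N)%N by rewrite -ltnS.
    rewrite scalerA; congr (_ *: _); rewrite -(bin_fact le_iN) !natrM.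
    by rewrite [in RHS]invfM mulrAC mulVf ?mul1r // (pcharf0P _).1 // -lt0n bin_gt0.
  congr (_ *: _); apply: eq_bigr => t _; rewrite splitting_sum_sumn; congr (_ *: _).
  by rewrite Tl_split splitting_sum_map.
case: D IH lt_mD @G G0 => // D IH lt_mD G G0.
rewrite big_ord_recl sum_exponents0 scale0r scaler0 add0r scaler_sumr exchange_big /=.
apply: eq_bigr => n _; rewrite /bump add1n.
rewrite scalerA mulrC -scalerA scaler_sumr.
transitivity ((n.+1`!%:R)^-1 *: \sum_(t <- exponents D.+1 n.+1) (sumn t)%:R *:
    ((sumn t == m.+1)%:R *: Tl (ls1 ++ map exp_term t :: ls2))).
  congr (_ *: _); apply: eq_bigr => t _.
  by case: eqP => [->|_] //; rewrite !scale0r !scaler0.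
(* The derivative singles out one of the n.+1 factors. *)
rewrite sum_exponents_sumn => [|t t' perm_t]; last first.
  by rewrite (perm_sumn perm_t); congr (_ *: _); apply: Tl_perm; apply: perm_map.
rewrite scalerA mulrC factV.
transitivity ((n`!%:R)^-1 *: \sum_(i < D.+1) \sum_(t <- exponents D.+1 n)
   (i + sumn t == m)%N%:R *: \sum_(p < D.+1) (p`!%:R)^-1 *:
      \sum_(t1 <- exponents D.+1 p) (sumn t1 == i)%:R *: Psi t1 t).
  congr (_ *: _); apply: eq_bigr => i _; rewrite scaler_sumr.
  apply: eq_bigr => t _; rewrite scalerA mulrC -scalerA /= addSn eqSS.
  case: eqP => [mE|_]; last by rewrite !scale0r.
  (* The singled out factor is expanded by the induction hypothesis for i. *)
  rewrite !scale1r -[Tl _]/(Tl_entry ls1 (map exp_term t) ls2 (exp_term i.+1)).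
  rewrite -linearZ /= /exp_term scalerA factV.
  rewrite -[nseq i.+1 _]cats0 nseqS_cat -[nseq i _ ++ _]cat0s.
  rewrite -IH //; last by rewrite ltnS -mE leq_addr.
  rewrite linear_sum; apply: eq_bigr => p _; rewrite linearZ linear_sum.
  congr (_ *: _); apply: eq_bigr => t1 _; rewrite linearZ /=.
  by rewrite -Tseq_corolla.
rewrite exchange_big /=.
transitivity ((n`!%:R)^-1 *: \sum_(t <- exponents D.+1 n) \sum_(p < D.+1)
   (p`!%:R)^-1 *: \sum_(t1 <- exponents D.+1 p) (sumn t1 + sumn t == m)%N%:R *: Psi t1 t).
  congr (_ *: _); apply: eq_bigr => t _.
  under eq_bigr => i _ do rewrite scaler_sumr.
  rewrite exchange_big /=; apply: eq_bigr => p _.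
  under eq_bigr => i _ do rewrite scalerA mulrC -scalerA scaler_sumr.
  rewrite -scaler_sumr exchange_big /=; congr (_ *: _); apply: eq_bigr => t1 _.
  by rewrite sum_indicator // ltnW.
rewrite exchange_big scaler_sumr /=; apply: eq_bigr => p _.
by rewrite -scaler_sumr scalerA invfM mulrC exchange_big.
Qed.

End LevelExponential.

Section ExponentialSeries.
Variables (k : fieldType) (char0 : [pchar k] =i pred0) (A : filteredAlg k).
Implicit Types (s : seq A) (x y e : A) (ls : seq (seq A)).

Definition entriesF1 ls : Prop := forall a, a \in flatten ls -> Fil 1 a.

Lemma entriesF1_cat ls1 ls2 :
  entriesF1 (ls1 ++ ls2) <-> entriesF1 ls1 /\ entriesF1 ls2.
Proof.
split=> [F12|[F1 F2] a].
  by split=> a a_in; apply: F12; rewrite flatten_cat mem_cat a_in ?orbT.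
by rewrite flatten_cat mem_cat => /orP[/F1|/F2].
Qed.

Lemma entriesF1_cons s ls :
  entriesF1 (s :: ls) <-> (forall a, a \in s -> Fil 1 a) /\ entriesF1 ls.
Proof.
split=> [F12|[F1 F2] a].
  by split=> a a_in; apply: F12; rewrite /= mem_cat a_in ?orbT.
by rewrite /= mem_cat => /orP[/F1|/F2].
Qed.

Lemma entriesF1_nseq n y : Fil 1 y -> entriesF1 (nseq n [:: y]).
Proof.
move=> Fy; elim: n => [|n IHn] a //=.
by rewrite inE => /orP[/eqP->|/IHn].
Qed.

Lemma Fil_Tl_size ls : entriesF1 ls -> Fil (size (flatten ls)) (Tl ls).
Proof. by move=> Fls; apply/Fil_Tl/total_index_size. Qed.

Lemma Fil_Tl_mid p s ls1 ls2 : entriesF1 ls1 -> entriesF1 ls2 -> total_index p s ->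
  Fil p (Tl (ls1 ++ s :: ls2)).
Proof.
move=> Fls1 Fls2 Fs; apply: (@Fil_leq _ _ _ (size (flatten ls1) + (p + size (flatten ls2)))).
  by rewrite addnCA leq_addr.
apply: Fil_Tl; rewrite flatten_cat /=.
by apply: total_index_cat; [|apply: total_index_cat => //]; apply: total_index_size.
Qed.

Lemma Fil_exp_term y m : Fil 1 y -> Fil m (exp_term y m).
Proof.
move=> Fy; apply: FilZ; have := Fil_Tl_size (@entriesF1_nseq m _ Fy).
by rewrite size_flatten /shape map_nseq sumn_nseq mul1n.
Qed.

Lemma total_index_exp_terms y t : Fil 1 y -> total_index (sumn t) (map (exp_term y) t).
Proof.
move=> Fy; elim: t => //= i t IHt; exists i, (sumn t); split=> //.
exact: Fil_exp_term.
Qed.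

Definition is_exp y e : Prop := forall N, congF N e (\sum_(n < N) exp_term y n).

Lemma exp_term0 y : exp_term y 0 = 0.
Proof. by rewrite /exp_term Tl_empty scaler0. Qed.

Lemma is_exp_F1 y e : is_exp y e -> Fil 1 e.
Proof. by move/(_ 1%N)/congF_Fil; rewrite big_ord1 exp_term0; apply; apply: Fil_0. Qed.

Lemma Tl_exp_terms N y e n s ls1 ls2 :
    Fil 1 y -> is_exp y e -> entriesF1 ls1 -> entriesF1 (s :: ls2) ->
  congF N (Tl (ls1 ++ (nseq n e ++ s) :: ls2))
    (\sum_(t <- exponents N n) Tl (ls1 ++ (map (exp_term y) t ++ s) :: ls2)).
Proof.
move=> Fy exp_e Fls1; elim: n s => [|n IHn] s Fsls.
  by rewrite sum_exponents0; apply: congF_refl.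
have Fe := is_exp_F1 exp_e; case/entriesF1_cons: (Fsls) => Fs Fls2.
have eE : congF N e (\sum_(i < N) exp_term y i.+1).
  by have := Fil_desc (exp_e N.+1); rewrite big_ord_recl exp_term0 add0r.
have Fctx : total_index (size (flatten (ls1 ++ (nseq n e ++ s) :: ls2)))
    (flatten (ls1 ++ (nseq n e ++ s) :: ls2)).
  apply/total_index_size/entriesF1_cat; split=> //; apply/entriesF1_cons; split=> // a.
  by rewrite mem_cat mem_nseq => /orP[/andP[_ /eqP->]|/Fs].
rewrite [nseq n.+1 e ++ s]/= sum_exponentsS.
apply: congF_trans (congF_leq (leq_addr _ N) (congF_entry eE Fctx)) _.
rewrite -[Tl _]/(Tl_entry ls1 (nseq n e ++ s) ls2 _) linear_sum.
apply: congF_sum => i _.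
rewrite -[X in congF _ X _]/(Tl (ls1 ++ (exp_term y i.+1 :: nseq n e ++ s) :: ls2)).
rewrite (@Tl_perm _ _ _ _ (nseq n e ++ exp_term y i.+1 :: s)); last first.
  by rewrite -cat1s -[_ :: s]cat1s perm_catCA.
under [X in congF _ _ X]eq_bigr => t _.
  rewrite (@Tl_perm _ _ _ _ (map (exp_term y) t ++ exp_term y i.+1 :: s)); last first.
    by rewrite /= -cat1s -[_ :: s]cat1s perm_catCA.
  over.
apply: IHn; apply/entriesF1_cons; split=> // a; rewrite inE => /orP[/eqP->|/Fs//].
exact: Fil_leq (Fil_exp_term _ Fy).
Qed.

(** Expand every e into its components of given degree in y: those of total
    degree m give [exp_level], and a total degree of at least N is negligible. *)
Lemma level_exp N y e ls1 ls2 :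
    Fil 1 y -> is_exp y e -> entriesF1 ls1 -> entriesF1 ls2 ->
  congF N (\sum_(n < N) (n`!%:R)^-1 *: Tl (ls1 ++ nseq n e :: ls2))
    (\sum_(m < N) (m`!%:R)^-1 *: Tl (ls1 ++ nseq m [:: y] ++ ls2)).
Proof.
move=> Fy exp_e Fls1 Fls2.
under [X in congF _ _ X]eq_bigr => m _.
  rewrite -(exp_level char0 y ls1 ls2 (ltn_ord m)); over.
rewrite exchange_big; apply: congF_sum => n _; rewrite -scaler_sumr; apply: congFZ.
have -> : nseq n e = nseq n e ++ [::] by rewrite cats0.
apply: congF_trans (Tl_exp_terms _ _ Fy exp_e Fls1 _) _.
  by apply/entriesF1_cons; split.
rewrite exchange_big; apply: congF_sum => t _; rewrite cats0 -scaler_suml.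
have [lt_t|le_t] := ltnP (sumn t) N.
  rewrite (bigD1 (Ordinal lt_t)) //= eqxx big1 ?addr0 ?scale1r; first exact: congF_refl.
  move=> i ne_i; suff -> : (sumn t == i) = false by [].
  by apply: contraNF ne_i => /eqP ti; apply/eqP/val_inj.
rewrite big1 ?scale0r => [|i _]; last by rewrite gtn_eqF // (leq_trans (ltn_ord i)).
apply/congF0; apply: Fil_leq le_t _.
by apply: Fil_Tl_mid => //; apply: total_index_exp_terms.
Qed.

End ExponentialSeries.

(** * Noncommutative series evaluated in ordered products *)

Fixpoint words d : seq (seq bool) :=
  if d is d'.+1 then [seq b :: w | b <- [:: true; false], w <- words d']
  else [:: [::]].

Lemma sum_wordsS (V : nmodType) d (F : seq bool -> V) :
  \sum_(w <- words d.+1) F w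
    = \sum_(w <- words d) F (true :: w) + \sum_(w <- words d) F (false :: w).
Proof. by rewrite big_allpairs_dep /= 2!big_cons big_nil addr0. Qed.
Arguments words d : simpl never.

Lemma sum_words0 (V : nmodType) (F : seq bool -> V) :
  \sum_(w <- words 0) F w = F [::].
Proof. by rewrite big_seq1. Qed.

Lemma words_size d w : w \in words d -> size w = d.
Proof.
elim: d w => [|d IHd] w; first by rewrite inE => /eqP->.
by case/allpairsPdep=> b [w' [_ /IHd <- ->]].
Qed.

Lemma sum_words_cat (V : nmodType) m n (F : seq bool -> V) :
  \sum_(w <- words (m + n)) F w
    = \sum_(u <- words m) \sum_(v <- words n) F (u ++ v).
Proof.
elim: m F => [|m IHm] F; first by rewrite sum_words0.
by rewrite addSn !sum_wordsS !IHm.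
Qed.

Lemma sum_words1 (k : fieldType) (V : lmodType k) (F : seq bool -> V) v :
  \sum_(w <- words (size v)) (w == v)%:R *: F w = F v.
Proof.
elim: v F => [|b v IHv] F; first by rewrite sum_words0 eqxx scale1r.
rewrite /= sum_wordsS; have IH := IHv (fun w => F (b :: w)).
case: b IH => IH.
  by rewrite [X in _ + X]big1 ?addr0 ?IH // => w _; rewrite scale0r.
by rewrite [X in X + _]big1 ?add0r ?IH // => w _; rewrite scale0r.
Qed.

Lemma ncexpn_var (k : fieldType) b n w :
  ncexpn (ncvar k b) n w = (w == nseq n b)%:R.
Proof.
elim: n w => [|n IHn] w //=; rewrite /ncmul.
case: w => [|c w] /=; first by rewrite big_ord1 /ncvar mul0r.
rewrite big_ord_recl mul0r add0r big_ord_recl /= take0 drop0 big1 => [|i _].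
  by rewrite addr0 IHn /ncvar !eqseq_cons andbT; case: (c == b); rewrite ?mul1r ?mul0r.
rewrite /ncvar /bump !add1n /=; case: w i => [|d w] i; first by case: i.
by rewrite eqseq_cons andbF mul0r.
Qed.

Lemma ncexp_var (k : fieldType) b w :
  ncexp (ncvar k b) w = ((size w)`!%:R)^-1 * (w == nseq (size w) b)%:R.
Proof.
rewrite /ncexp big_nat_recr //= big_nat_cond big1 ?add0r ?ncexpn_var // => n.
case/andP=> /andP[_ lt_n] _; rewrite ncexpn_var; case: eqP => [w_n|_]; last exact: mulr0.
by rewrite w_n size_nseq ltnn in lt_n.
Qed.

Section WordSums.
Variables (k : fieldType) (A : filteredAlg k).
Implicit Types (f h : ncseries k) (K : seq bool -> A).

(** Words of length at least N are left out, as [K] maps them to the N-th part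
    of the filtration in the applications. *)
Definition word_sum N f K : A := \sum_(d < N) \sum_(w <- words d) f w *: K w.

(** The sides differ by the pairs of words of total length at least N. *)
Lemma word_sum_mul N f h K : (forall w, Fil (size w) (K w)) ->
  congF N (word_sum N (ncmul f h) K)
    (word_sum N f (fun u => word_sum N h (fun v => K (u ++ v)))).
Proof.
move=> FK; pose a i j := \sum_(u <- words i) \sum_(v <- words j) (f u * h v) *: K (u ++ v).
have -> : word_sum N (ncmul f h) K = \sum_(d < N) \sum_(i < d.+1) a i (d - i)%N.
  apply: eq_bigr => d _.
  transitivity (\sum_(w <- words d) \sum_(i < d.+1) (f (take i w) * h (drop i w)) *: K w).
    rewrite big_seq [RHS]big_seq; apply: eq_bigr => w /words_size w_d.
    by rewrite /ncmul w_d scaler_suml.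
  rewrite exchange_big /=; apply: eq_bigr => i _.
  have {1}-> : nat_of_ord d = (i + (d - i))%N by rewrite subnKC // -ltnS.
  rewrite sum_words_cat /a big_seq [RHS]big_seq; apply: eq_bigr => u /words_size u_i.
  by apply: eq_bigr => v _; rewrite take_size_cat ?drop_size_cat.
have -> : word_sum N f (fun u => word_sum N h (fun v => K (u ++ v)))
    = \sum_(i < N) \sum_(j < N) a i j.
  apply: eq_bigr => i _; rewrite /a [RHS]exchange_big; apply: eq_bigr => u _.
  rewrite scaler_sumr; apply: eq_bigr => j _; rewrite scaler_sumr.
  by apply: eq_bigr => v _; rewrite scalerA.
rewrite sum_triangle; apply: congF_sum => i _.
rewrite -!(big_mkord xpredT (a i)) [X in congF _ _ X](@big_cat_nat _ _ _ (N - i)) ?leq_subr //=.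
rewrite -[X in congF _ X _]addr0; apply: congFD; first exact: congF_refl.
apply/congF_sym/congF0; rewrite big_nat_cond; apply: Fil_sum => j /andP[/andP[le_j _] _].
rewrite /a big_seq; apply: Fil_sum => u /words_size u_i.
rewrite big_seq; apply: Fil_sum => v /words_size v_j.
by apply: FilZ; apply: Fil_leq (FK _); rewrite size_cat u_i v_j -leq_subLR.
Qed.

Lemma word_sum_expvar N b K :
  word_sum N (ncexp (ncvar k b)) K = \sum_(d < N) (d`!%:R)^-1 *: K (nseq d b).
Proof.
apply: eq_bigr => d _; have := sum_words1 K (nseq d b); rewrite size_nseq => <-.
rewrite scaler_sumr big_seq [RHS]big_seq.
by apply: eq_bigr => w /words_size w_d; rewrite ncexp_var w_d scalerA.
Qed.

Lemma eq_word_sum N f f' K K' : f =1 f' -> K =1 K' -> word_sum N f K = word_sum N f' K'.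
Proof.
by move=> eqf eqK; apply: eq_bigr => d _; apply: eq_bigr => w _; rewrite eqf eqK.
Qed.

Lemma congF_word_sum N f K K' : (forall w, congF N (K w) (K' w)) ->
  congF N (word_sum N f K) (word_sum N f K').
Proof.
by move=> eqK; apply: congF_sum => d _; apply: congF_sum => w _; apply: congFZ.
Qed.

End WordSums.

Lemma ncexpn_eq0 (k : fieldType) (f : ncseries k) n w :
  f [::] = 0 -> (size w < n)%N -> ncexpn f n w = 0.
Proof.
move=> f0; elim: n w => [|n IHn] w //; rewrite ltnS => le_w.
rewrite /= /ncmul big1 // => -[[|i] lt_i] _ /=; first by rewrite take0 f0 mul0r.
rewrite IHn ?mulr0 // size_drop; move: lt_i le_w; rewrite ltnS.
case: (size w) => // m _ le_m; rewrite subSS.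
by apply: leq_trans le_m; rewrite ltnS leq_subr.
Qed.

Lemma big_all (R : Type) (idx : R) (op : R -> R -> R) (I : Type) (r : seq I)
    (P : pred I) (F : I -> R) :
  all P r -> \big[op/idx]_(i <- r) F i = \big[op/idx]_(i <- r | P i) F i.
Proof.
elim: r => [|i r IHr] /=; first by rewrite !big_nil.
by case/andP=> Pi /IHr eq_r; rewrite !big_cons Pi eq_r.
Qed.

Lemma lie_degree_gt0 t : (0 < lie_degree t)%N.
Proof. by elim: t => //= t1 gt_t1 t2 _; rewrite addn_gt0 gt_t1. Qed.

Lemma lie_expand_size (k : fieldType) t w :
  size w != lie_degree t -> lie_expand k t w = 0.
Proof.
elim: t w => [b|t1 IH1 t2 IH2] w /=.
  by move=> ne_w; rewrite /ncvar; case: (w =P [:: b]) ne_w => [->|].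
move=> ne_w; rewrite /ncsub.
have mul0 f1 f2 d1 d2 : (forall w, size w != d1 -> f1 w = 0 :> k) ->
    (forall w, size w != d2 -> f2 w = 0 :> k) -> size w != (d1 + d2)%N ->
    ncmul f1 f2 w = 0.
  move=> f10 f20 ne; rewrite /ncmul big1 // => i _.
  have le_i : (i <= size w)%N by rewrite -ltnS.
  have [si|] := eqVneq (size (take i w)) d1; last by move=> ne_i; rewrite f10 ?mul0r.
  rewrite f20 ?mulr0 //; apply: contra ne => /eqP <-.
  by rewrite -si size_takel // size_drop subnKC.
by rewrite (mul0 _ _ _ _ IH1 IH2) // (mul0 _ _ _ _ IH2 IH1) ?subrr // addnC.
Qed.

(** * The Baker-Campbell-Hausdorff theorem *)

Section DerivativeOfExponential.
Variables (k : fieldType) (char0 : [pchar k] =i pred0) (R : algType k).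
Variables (D : R -> R) (Z : R).
Hypothesis DM : forall a b, D (a * b) = D a * b + a * D b.
Hypothesis DZ : forall c a, D (c *: a) = c *: D a.

Definition divpow (a : R) j : R := (j`!%:R)^-1 *: a ^+ j.

Definition ring_ad (a b : R) : R := a * b - b * a.

(** With c = 0 these are the terms of exp (- ad Z) applied to X, and with c = 1
    those of (1 - exp (- ad Z)) / ad Z applied to X. *)
Definition ad_term (c : nat) (X : R) i : R :=
  ((-1) ^+ i * ((i + c)`!%:R)^-1) *: iter i (ring_ad Z) X.

Lemma divpowS a j : j.+1%:R *: divpow a j.+1 = divpow a j * a.
Proof.
rewrite /divpow scalerA factS natrM invfM mulrA divff ?natr_neq0 // mul1r.
by rewrite -scalerAl -exprSr.
Qed.

Lemma ad_termM c X i :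
  ad_term c X i * Z = Z * ad_term c X i + (i.+1 + c)%:R *: ad_term c X i.+1.
Proof.
rewrite /ad_term scalerA.
have -> : (i.+1 + c)%:R * ((-1) ^+ i.+1 * ((i.+1 + c)`!%:R)^-1)
    = - ((-1) ^+ i * ((i + c)`!%:R)^-1) :> k.
  rewrite addSn factS natrM invfM exprS mulN1r mulNr mulrN mulrCA.
  by rewrite mulVKf ?natr_neq0.
rewrite -scalerAl -scalerAr iterS /ring_ad scaleNr scalerBr opprB.
by rewrite addrCA subrr addr0.
Qed.

(** Right multiplication by Z is left multiplication by Z minus ad Z, and the
    last two operators commute; the divided powers absorb the binomial
    coefficients. *)
Lemma mul_divpow X j :
  X * divpow Z j = \sum_(i < j.+1) divpow Z (j - i) * ad_term 0 X i.
Proof.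
elim: j => [|j IHj].
  by rewrite big_ord1 /divpow /ad_term /= !expr0 !fact0 invr1 mul1r !scale1r mulr1 mul1r.
apply: (scalerI (natr_neq0 j char0)).
rewrite scalerAr divpowS mulrA IHj mulr_suml.
transitivity (\sum_(i < j.+2) (j.+1 - i)%:R *: (divpow Z (j.+1 - i) * ad_term 0 X i)
   + \sum_(i < j.+2) i%:R *: (divpow Z (j.+1 - i) * ad_term 0 X i)); last first.
  rewrite -big_split scaler_sumr; apply: eq_bigr => i _ /=.
  by rewrite -scalerDl -natrD subnK // -ltnS.
rewrite [X in _ = X + _]big_ord_recr /= subnn scale0r addr0.
rewrite [X in _ = _ + X]big_ord_recl scale0r add0r -big_split.
apply: eq_bigr => i _ /=; have le_ij : (i <= j)%N by rewrite -ltnS.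
rewrite -mulrA ad_termM mulrDr mulrA -divpowS addn0 -subSn // -scalerAl.
by rewrite -[_ * (i.+1%:R *: _)]scalerAr /bump /= add1n subSS.
Qed.

(** Leibniz rule for Z^j.+1, the factors Z being moved to the left of D Z. *)
Lemma derive_divpow j :
  D (divpow Z j.+1) = \sum_(i < j.+1) divpow Z (j - i) * ad_term 1 (D Z) i.
Proof.
elim: j => [|j IHj].
  rewrite big_ord1 /divpow /ad_term /= !expr0 expr1 factS !fact0 muln1 invr1.
  by rewrite mul1r !scale1r mul1r.
apply: (scalerI (natr_neq0 j.+1 char0)).
rewrite -DZ divpowS DM IHj mulr_suml.
transitivity (\sum_(i < j.+2) (j.+1 - i)%:R *: (divpow Z (j.+1 - i) * ad_term 1 (D Z) i)
   + \sum_(i < j.+2) i.+1%:R *: (divpow Z (j.+1 - i) * ad_term 1 (D Z) i)); last first.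
  rewrite -big_split scaler_sumr; apply: eq_bigr => i _ /=.
  by rewrite -scalerDl -natrD addnS subnK // -ltnS.
rewrite [X in _ = X + _]big_ord_recr /= subnn scale0r addr0.
rewrite [X in _ = _ + X]big_ord_recl /= addrCA addrC; congr (_ + _); last first.
  by rewrite subn0 scale1r /ad_term /= expr0 mul1r factS fact0 invr1 scale1r.
rewrite -big_split.
apply: eq_bigr => i _ /=; have le_ij : (i <= j)%N by rewrite -ltnS.
rewrite -mulrA ad_termM mulrDr mulrA -divpowS addn1 -subSn // -scalerAl.
by rewrite -[_ * (i.+2%:R *: _)]scalerAr /bump /= add1n subSS.
Qed.

End DerivativeOfExponential.

Section ExpLogPolynomials.
Variables (k : fieldType) (char0 : [pchar k] =i pred0).

Lemma coef_Xmul_lt (p : {poly k}) n i : (i < n)%N -> ('X^n * p)`_i = 0.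
Proof. by move=> lt_i; rewrite coefXnM lt_i. Qed.

(** Both sides satisfy (1 + X) Q' = Q modulo X^N and take the value 1 at 0. *)
Lemma explog_poly N i : (i <= N)%N ->
  (\sum_(j < N.+1) (j`!%:R)^-1 *:
     (\sum_(m < N) ((-1) ^+ m / m.+1%:R) *: 'X^(m.+1)) ^+ j : {poly k})`_i
   = (1 + 'X : {poly k})`_i.
Proof.
set P := \sum_(m < N) _; set Q := \sum_(j < N.+1) _.
have P_X : exists P1, P = 'X * P1.
  exists (\sum_(m < N) ((-1) ^+ m / m.+1%:R) *: 'X^m).
  by rewrite mulr_sumr; apply: eq_bigr => m _; rewrite -scalerAr exprS.
have dP : (1 + 'X) * P^`() = 1 - (-1) ^+ N *: 'X^N.
  have -> : P^`() = \sum_(m < N) (-1) ^+ m *: 'X^m.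
    rewrite raddf_sum; apply: eq_bigr => m _ /=.
    by rewrite derivZ derivXn -scaler_nat scalerA mulrVK ?unitfE ?natr_neq0.
  elim: (N) => [|n IHn]; first by rewrite big_ord0 mulr0 expr0 scale1r subrr.
  rewrite big_ord_recr /= mulrDr IHn exprS mulN1r scaleNr opprK exprS.
  by rewrite mulrDl mul1r -scalerAr addrA subrK.
have dQ : (1 + 'X) * Q^`() = (1 - (-1) ^+ N *: 'X^N) * (Q - (N`!%:R)^-1 *: P ^+ N).
  have -> : Q - (N`!%:R)^-1 *: P ^+ N = \sum_(j < N) (j`!%:R)^-1 *: P ^+ j.
    by rewrite /Q big_ord_recr /= addrK.
  rewrite -dP -mulrA; congr (_ * _).
  rewrite /Q big_ord_recl derivD derivZ expr0 derivC scaler0 add0r.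
  rewrite raddf_sum mulr_sumr; apply: eq_bigr => j _ /=.
  rewrite derivZ deriv_exp /bump /= add1n -scaler_nat scalerA. rewrite -[RHS]scalerAr add0n.
  congr (_ *: _); rewrite factS natrM invfM mulrAC mulVf ?mul1r ?natr_neq0 //.
have rec j : (j < N)%N -> Q`_j.+1 *+ j.+1 = Q`_j - Q`_j *+ j.
  move=> lt_j; have := congr1 (fun p : {poly k} => p`_j) dQ => /=.
  have [P1 PE] := P_X; rewrite PE exprMn.
  rewrite mulrDl mul1r coefD coefXM coef_deriv.
  rewrite mulrBl mul1r -scalerAl !coefB !coefZ !coef_Xmul_lt //.
  rewrite !mulr0 !subr0 => recE; apply: (canRL (addrK _)); rewrite -[RHS]recE.
  by congr (_ + _); case: (j) => //= j'; rewrite coef_deriv.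
have Q0 : Q`_0 = 1.
  rewrite -horner_coef0 /Q horner_sum big_ord_recl hornerZ expr0 hornerC big1.
    by rewrite addr0 fact0 invr1 mulr1.
  move=> j _; have [P1 ->] := P_X.
  by rewrite hornerZ horner_exp hornerM hornerX mul0r expr0n /= mulr0.
have inj j (c : k) : c *+ j.+1 = 0 -> c = 0.
  by move/eqP; rewrite -mulr_natr mulf_eq0 (negPf (natr_neq0 j char0)) orbF => /eqP.
case: i => [|i]; first by rewrite Q0 coefD coef1 coefX addr0.
elim: i => [|i IHi] lt_i.
  have := rec 0%N lt_i; rewrite mulr1n mulr0n subr0 Q0 => ->.
  by rewrite coefD coef1 coefX add0r.
rewrite coefD coef1 coefX addr0 /=; apply: (inj i.+1); rewrite rec // IHi 1?ltnW //.
rewrite coefD coef1 coefX add0r /=; case: (i) => [|i'] /=; first by rewrite mulr1n subrr.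
by rewrite mul0rn subrr.
Qed.

End ExpLogPolynomials.

Section SeriesMatrices.
Variables (k : fieldType) (char0 : [pchar k] =i pred0) (w : seq bool).
Implicit Types (f h : ncseries k).
Let n := size w.
Local Notation R := 'M[k]_n.+1.

Definition slice (i j : nat) := take (j - i) (drop i w).

Lemma slice_size i j : (i <= j <= n)%N -> size (slice i j) = (j - i)%N.
Proof.
case/andP=> le_ij le_jn; rewrite size_takel // size_drop.
by rewrite leq_sub2r.
Qed.

Lemma take_slice i j l : (l <= j - i)%N -> take l (slice i j) = slice i (i + l).
Proof. by move=> le_l; rewrite /slice take_takel // addKn. Qed.

Lemma drop_slice i j l : (l <= j - i)%N -> drop l (slice i j) = slice (i + l) j.
Proof.
by move=> le_l; rewrite /slice -{1}(subnK le_l) -take_drop drop_drop subnDA addnC.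
Qed.

(** The value at w of a product of series depends on their values at the
    subwords of w. Arranged in upper triangular matrices, the latter are
    multiplied like matrices, so that identities at w can be proved in a finite-
    dimensional algebra. *)
Definition smx f : R := \matrix_(i, j) if (i <= j)%N then f (slice i j) else 0.

Definition band p (M : R) : Prop :=
  forall i j : 'I_n.+1, (j < i + p)%N -> M i j = 0.

Lemma band_mul p q (M N : R) : band p M -> band q N -> band (p + q) (M * N).
Proof.
move=> bM bN i j lt_j; rewrite mxE big1 // => l _.
have [lt_l|le_l] := ltnP l (i + p); first by rewrite bM ?mul0r.
by rewrite bN ?mulr0 // (leq_trans lt_j) // addnA leq_add2r.
Qed.

Lemma band0 p : band p 0. Proof. by move=> i j _; rewrite mxE. Qed.

Lemma bandD p M N : band p M -> band p N -> band p (M + N).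
Proof. by move=> bM bN i j lt_j; rewrite mxE bM // bN // addr0. Qed.

Lemma bandZ p c M : band p M -> band p (c *: M).
Proof. by move=> bM i j lt_j; rewrite mxE bM ?mulr0. Qed.

Lemma bandN p M : band p M -> band p (- M).
Proof. by rewrite -scaleN1r; apply: bandZ. Qed.

Lemma band_sum p (I : Type) (r : seq I) (P : pred I) (F : I -> R) :
  (forall i, P i -> band p (F i)) -> band p (\sum_(i <- r | P i) F i).
Proof. by move=> bF; elim/big_ind: _ => //; [apply: band0 | apply: bandD]. Qed.

Lemma band_eq0 p M : (n < p)%N -> band p M -> M = 0.
Proof.
move=> lt_p bM; apply/matrixP => i j; rewrite mxE bM //.
by rewrite (leq_trans (ltn_ord j)) // (leq_trans lt_p) // leq_addl.
Qed.

Lemma band_leq p q M : (p <= q)%N -> band q M -> band p M.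
Proof.
move=> le_pq bM i j lt_j; apply: bM.
by rewrite (leq_trans lt_j) // leq_add2l.
Qed.

Lemma band_smx f : band 0 (smx f).
Proof. by move=> i j; rewrite addn0 mxE ltnNge; case: leqP. Qed.

Lemma band1_smx f : f [::] = 0 -> band 1 (smx f).
Proof.
move=> f0 i j; rewrite addn1 ltnS mxE => le_ji; case: leqP => // le_ij.
by rewrite /slice (eqP (_ : (j - i)%N == 0%N)) ?take0 // subn_eq0.
Qed.

Lemma band_exp M j : band 1 M -> band j (M ^+ j).
Proof.
move=> bM; elim: j => [|j IHj]; last by rewrite exprS; apply: (band_mul bM).
move=> i j; rewrite addn0 expr0 => lt_ji; rewrite -[1]/(1%:M) mxE.
by case: eqP => // ij; rewrite ij ltnn in lt_ji.
Qed.

Lemma smx_mul f h : smx (ncmul f h) = smx f * smx h.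
Proof.
apply/matrixP => i j; rewrite mxE [in RHS]mxE.
under [RHS]eq_bigr => l _ do rewrite !mxE.
case: leqP => [le_ij|lt_ji]; last first.
  rewrite big1 // => l _; case: leqP => [le_il|]; last by rewrite mul0r.
  by rewrite leqNgt (leq_trans lt_ji le_il) mulr0.
have le_jn : (j <= n)%N by rewrite -ltnS.
pose F l := (if (i <= l)%N then f (slice i l) else 0)
  * (if (l <= j)%N then h (slice l j) else 0).
rewrite -(big_mkord xpredT F) (big_cat_nat (leq0n i)) ?(ltnW (ltn_ord i)) //=.
rewrite big_nat_cond big1 ?add0r => [|l /andP[/andP[_ lt_l] _]]; last first.
  by rewrite /F leqNgt lt_l mul0r.
rewrite (big_cat_nat (n := j.+1)) ?(leqW le_ij) //= [X in _ + X]big_nat_cond.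
rewrite [X in _ + X]big1 ?addr0 => [|l /andP[/andP[lt_l _] _]]; last first.
  by rewrite /F [(l <= j)%N]leqNgt lt_l mulr0.
have -> : \sum_(i <= l < j.+1) F l = \sum_(0 <= l < j.+1 - i) F (l + i)%N.
  by rewrite -{1}[nat_of_ord i]add0n big_addn.
rewrite subSn // big_mkord /ncmul.
rewrite slice_size ?le_ij //; apply: eq_bigr => l _.
have le_l : (l <= j - i)%N by rewrite -ltnS.
rewrite take_slice // drop_slice // /F leq_addl [(l + i)%N]addnC.
by rewrite -(leq_subRL _ le_ij) le_l.
Qed.

Lemma smx_sub f h : smx (ncsub f h) = smx f - smx h.
Proof. by apply/matrixP => i j; rewrite !mxE; case: leqP; rewrite ?subrr. Qed.

Lemma smx1 : smx (nc1 k) = 1.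
Proof.
apply/matrixP => i j; rewrite -[1]/(1%:M) !mxE.
case: leqP => [le_ij|lt_ji]; last by case: eqP => // ij; rewrite ij ltnn in lt_ji.
have le_jn : (j <= n)%N by rewrite -ltnS.
rewrite /nc1 -size_eq0 slice_size ?le_ij // subn_eq0.
by rewrite -val_eqE eqn_leq le_ij.
Qed.

Lemma smx_expn f j : smx (ncexpn f j) = smx f ^+ j.
Proof. by elim: j => [|j IHj]; rewrite ?smx1 // exprS -IHj -smx_mul. Qed.

Lemma smx_lincomb f (c : nat -> k) : f [::] = 0 ->
  smx (fun v => \sum_(j < (size v).+1) c j * ncexpn f j v)
    = \sum_(j < n.+1) c j *: smx f ^+ j.
Proof.
move=> f0; apply/matrixP => i j; rewrite mxE summxE.
under [RHS]eq_bigr => l _ do rewrite mxE -smx_expn mxE.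
case: leqP => [le_ij|_]; last by rewrite big1 // => l _; rewrite mulr0.
have le_jn : (j <= n)%N by rewrite -ltnS.
rewrite slice_size ?le_ij //.
rewrite (@sum_ord_trunc _ (j - i).+1 n.+1 (fun l => c l * ncexpn f l (slice i j))) //.
  by rewrite ltnS (leq_trans (leq_subr _ _)).
by move=> l lt_l; rewrite ncexpn_eq0 ?mulr0 // slice_size ?le_ij.
Qed.

(** On strictly upper triangular matrices, which are nilpotent, this truncation
    is the whole exponential series. *)
Definition mexp (M : R) : R := \sum_(j < n.+1) divpow M j.

Lemma smx_exp f : f [::] = 0 -> smx (ncexp f) = mexp (smx f).
Proof.
move=> f0; rewrite -[RHS](smx_lincomb (fun j => (j`!%:R)^-1) f0).
by apply/matrixP => i j; rewrite !mxE /ncexp big_mkord.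
Qed.

(** The matrix of h - 1 is nilpotent, so that [explog_poly] can be evaluated at
    it. *)
Lemma mexp_log h : h [::] = 1 -> mexp (smx (nclog h)) = smx h.
Proof.
move=> h1; pose u := ncsub h (nc1 k); have u0 : u [::] = 0 by rewrite /u /ncsub h1 subrr.
pose c j : k := if j is j'.+1 then (-1) ^+ j' / j'.+1%:R else 0.
have -> : smx (nclog h) = \sum_(j < n.+1) c j *: smx u ^+ j.
  rewrite -(smx_lincomb c u0); apply/matrixP => i j; rewrite !mxE.
  case: leqP => // _; rewrite big_ord_recl mul0r add0r /nclog big_add1 big_mkord.
  by apply: eq_bigr => l _.
have uN : smx u ^+ n.+1 = 0 by apply: (band_eq0 (ltnSn n)); apply/band_exp/band1_smx.
pose P : {poly k} := \sum_(m < n) ((-1) ^+ m / m.+1%:R) *: 'X^(m.+1).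
pose Q : {poly k} := \sum_(j < n.+1) (j`!%:R)^-1 *: P ^+ j.
have -> : \sum_(j < n.+1) c j *: smx u ^+ j = horner_mx (smx u) P.
  rewrite big_ord_recl scale0r add0r linear_sum; apply: eq_bigr => m _ /=.
  by rewrite linearZ rmorphXn /= horner_mx_X.
have -> : mexp (horner_mx (smx u) P) = horner_mx (smx u) Q.
  rewrite [RHS]linear_sum; apply: eq_bigr => j _.
  by rewrite [RHS]linearZ rmorphXn.
have -> : smx h = horner_mx (smx u) (1 + 'X).
  by rewrite rmorphD rmorph1 /= horner_mx_X smx_sub smx1 addrC subrK.
have take_eq : take_poly n.+1 Q = take_poly n.+1 (1 + 'X).
  by apply/polyP => i; rewrite !coef_take_poly; case: ltnP => // lt_i; rewrite explog_poly.
have take_mx p : horner_mx (smx u) p = horner_mx (smx u) (take_poly n.+1 p).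
  rewrite -{1}(poly_take_drop n.+1 p) rmorphD rmorphM rmorphXn /= horner_mx_X uN.
  by rewrite mulr0 addr0.
by rewrite (take_mx Q) take_eq -take_mx.
Qed.

End SeriesMatrices.

Section BCHRecursion.
Variables (k : fieldType) (char0 : [pchar k] =i pred0) (w : seq bool).
Implicit Types (f h : ncseries k).
Let n := size w.
Local Notation R := 'M[k]_n.+1.

Definition ncdeg f : ncseries k := fun v => (size v)%:R * f v.

(** An entry (i, j) comes from a subword of length j - i: this is [ncdeg] on
    matrices, and a derivation since it is the commutator with a diagonal
    matrix. *)
Definition mxdeg (M : R) : R := \matrix_(i, j) ((j%:R - i%:R) * M i j).

Lemma mxdegM M N : mxdeg (M * N) = mxdeg M * N + M * mxdeg N.
Proof.
apply/matrixP => i j; rewrite !mxE mulr_sumr -big_split; apply: eq_bigr => l _ /=.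
rewrite !mxE [M i l * (_ * _)]mulrCA -!mulrA -mulrDl; congr (_ * _).
by rewrite [RHS]addrC addrA subrK.
Qed.

Lemma mxdegZ c M : mxdeg (c *: M) = c *: mxdeg M.
Proof. by apply/matrixP => i j; rewrite !mxE mulrCA. Qed.

Lemma mxdeg_sum (I : Type) (r : seq I) (F : I -> R) :
  mxdeg (\sum_(i <- r) F i) = \sum_(i <- r) mxdeg (F i).
Proof.
apply/matrixP => i j; rewrite mxE !summxE mulr_sumr.
by apply: eq_bigr => l _; rewrite mxE.
Qed.

Lemma mxdeg_smx f : mxdeg (smx w f) = smx w (ncdeg f).
Proof.
apply/matrixP => i j; rewrite !mxE; case: leqP => [le_ij|_]; last exact: mulr0.
have le_jn : (j <= n)%N by rewrite -ltnS.
by rewrite /ncdeg slice_size ?le_ij // natrB.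
Qed.

Lemma band_divpow (M : R) j : band 1 M -> band j (divpow M j).
Proof. by move=> bM; apply/bandZ/band_exp. Qed.

Lemma band_ad_term (M X : R) c p i :
  band 1 M -> band p X -> band (i + p) (ad_term M c X i).
Proof.
move=> bM bX; apply: bandZ; elim: i => [|i IHi] //=.
apply: bandD; first exact: band_mul bM IHi.
by apply: bandN; rewrite addSn -addn1; apply: band_mul IHi bM.
Qed.

Lemma mexpE (M : R) (b : nat -> R) p : band 1 M -> (forall i, band (i + p) (b i)) ->
  \sum_(j < n.+1 - p) \sum_(i < j.+1) divpow M (j - i) * b i
    = mexp M * \sum_(i < n.+1) b i.
Proof.
move=> bM bb; rewrite /mexp mulr_suml.
under [RHS]eq_bigr => l _ do rewrite mulr_sumr.
rewrite exchange_big /=.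
pose a i l := divpow M l * b i.
have a0 i l : (n.+1 - p - i <= l)%N -> a i l = 0.
  move=> le_l; apply: (band_eq0 (p := l + (i + p))); last exact/band_mul/bb/band_divpow.
  by move: le_l; rewrite -subnDA leq_subLR [(p + i)%N]addnC [(l + _)%N]addnC.
rewrite (sum_triangle (n.+1 - p) a).
rewrite (@sum_ord_trunc _ (n.+1 - p) n.+1 (fun i => \sum_(l < n.+1) a i l)) ?leq_subr //.
  apply: eq_bigr => i _; rewrite (@sum_ord_trunc _ (n.+1 - p - i) n.+1 (a i)) //.
    by rewrite -subnDA leq_subr.
  exact: a0.
move=> i le_i; rewrite big1 // => l _; apply: a0.
by move: le_i; rewrite -subn_eq0 => /eqP->.
Qed.

(** Conjugation by an exponential is the exponential of the adjoint action. *)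
Lemma mul_mexp (M X : R) : band 1 M -> band 0 X ->
  X * mexp M = mexp M * \sum_(i < n.+1) ad_term M 0 X i.
Proof.
move=> bM bX; rewrite -(@mexpE _ _ 0) //; last by move=> i; apply: band_ad_term.
by rewrite subn0 mulr_sumr; apply: eq_bigr => j _; rewrite mul_divpow.
Qed.

Lemma derive_mexp (M : R) : band 1 M -> 
  mxdeg (mexp M) = mexp M * \sum_(i < n.+1) ad_term M 1 (mxdeg M) i.
Proof.
move=> bM; have bDM : band 1 (mxdeg M).
  by move=> i j lt_j; rewrite mxE bM ?mulr0.
rewrite -(@mexpE _ _ 1) //; last by move=> i; apply: band_ad_term.
rewrite subn1 /mexp mxdeg_sum big_ord_recl [X in X + _](_ : _ = 0) ?add0r.
  by apply: eq_bigr => j _; rewrite (@derive_divpow _ char0 _ _ M mxdegM mxdegZ).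
rewrite /divpow mxdegZ expr0 (_ : mxdeg 1 = 0) ?scaler0 //.
apply/matrixP => i j; rewrite -[1]/(1%:M) !mxE; case: eqP => [->|_].
  by rewrite subrr mul0r.
by rewrite mulr0.
Qed.

(** The matrix [mexp M] is the sum of 1 and of a nilpotent matrix. *)
Lemma mexp_cancel (M N : R) : band 1 M -> band 0 N -> mexp M * N = 0 -> N = 0.
Proof.
move=> bM bN; rewrite /mexp big_ord_recl /divpow expr0 fact0 invr1 scale1r.
set V := \sum_(i < n) _ => eN.
have bV : band 1 V.
  by apply: band_sum => j _; apply/bandZ/(band_leq (q := j.+1))/band_exp.
have NE : N = - (V * N) by apply/eqP; rewrite -addr_eq0 -{1}[N]mul1r -mulrDl eN.
have bandN_ p : band p N.
  elim: p => // p IHp; rewrite NE; apply: bandN.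
  by rewrite -add1n; apply: band_mul.
exact: (band_eq0 (ltnSn n)).
Qed.

Definition ncad f h : ncseries k := ncsub (ncmul f h) (ncmul h f).

Lemma smx_iter_ad f h i :
  smx w (iter i (ncad f) h) = iter i (ring_ad (smx w f)) (smx w h).
Proof. by elim: i => //= i <-; rewrite smx_sub !smx_mul. Qed.

Lemma smx_end f : f w = smx w f ord0 ord_max.
Proof. by rewrite mxE /slice drop0 subn0 take_size. Qed.

Lemma smx_ad_term f h c i : ad_term (smx w f) c (smx w h) i ord0 ord_max
  = (-1) ^+ i / (i + c)`!%:R * iter i (ncad f) h w.
Proof. by rewrite mxE -smx_iter_ad -smx_end. Qed.

Definition bch_log : ncseries k :=
  nclog (ncmul (ncexp (ncvar k true)) (ncexp (ncvar k false))).

Lemma bch_log0 : bch_log [::] = 0.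
Proof. by rewrite /bch_log /nclog big_geq. Qed.

Lemma smx_bch_log :
  mexp (smx w bch_log) = mexp (smx w (ncvar k true)) * mexp (smx w (ncvar k false)).
Proof.
rewrite /bch_log mexp_log //.
  by rewrite smx_mul !smx_exp.
by rewrite /ncmul big_ord1 /= /ncexp !big_nat1 /ncexpn /= /nc1 !fact0 !invr1 !mulr1.
Qed.

(** Compare the two expressions of the degree derivation of exp Z = e^X e^Y,
    where Z is [bch_log]. As Z has no constant term, the brackets on the right
    only involve components of Z of degree less than n. *)
Lemma bch_recursion :
  n%:R * bch_log w = ncvar k false w
    + \sum_(i < n.+1) (-1) ^+ i / i`!%:R * iter i (ncad (ncvar k false)) (ncvar k true) w
    - \sum_(i < n) (-1) ^+ i.+1 / i.+2`!%:R * iter i.+1 (ncad bch_log) (ncdeg bch_log) w.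
Proof.
set Z := smx w bch_log; pose X := smx w (ncvar k true); pose Y := smx w (ncvar k false).
have bZ : band 1 Z by apply/band1_smx/bch_log0.
have bX : band 1 X by apply: band1_smx.
have bY : band 1 Y by apply: band1_smx.
have degX b : mxdeg (smx w (ncvar k b)) = smx w (ncvar k b).
  rewrite mxdeg_smx; apply/matrixP => i j; rewrite !mxE; case: leqP => // _.
  by rewrite /ncdeg /ncvar; case: eqP => [->|_]; rewrite ?mulr0 ?mulr1.
have deg_exp (M : R) : band 1 M -> mxdeg M = M -> mxdeg (mexp M) = mexp M * M.
  move=> bM dM; rewrite derive_mexp // dM; congr (_ * _).
  rewrite big_ord_recl big1 ?addr0 => [|i _].
    by rewrite /ad_term /= expr0 factS fact0 invr1 mulr1 scale1r.
  rewrite /ad_term lift0.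
  suff -> : forall j, iter j.+1 (ring_ad M) M = 0 by rewrite scaler0.
  elim=> [|j IHj]; first by rewrite /= /ring_ad subrr.
  by rewrite iterS IHj /ring_ad mulr0 mul0r subrr.
(* Both sides, multiplied by e^Z = e^X e^Y, give its derivative. *)
have key : \sum_(i < n.+1) ad_term Z 1 (mxdeg Z) i = \sum_(i < n.+1) ad_term Y 0 X i + Y.
  apply/eqP; rewrite -subr_eq0; apply/eqP/(mexp_cancel bZ).
    have band_ad (M X' : R) c i : band 1 M -> band 0 X' -> band 0 (ad_term M c X' i).
      by move=> bM bX'; apply: (band_leq (q := i + 0)); last exact: band_ad_term.
    apply: bandD; last (apply/bandN/bandD; last exact: band_smx).
      by apply: band_sum => i _; apply: band_ad; rewrite // mxdeg_smx; apply: band_smx.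
    by apply: band_sum => i _; apply: band_ad; rewrite //; apply: band_smx.
  rewrite mulrBr -derive_mexp // smx_bch_log -/X -/Y mxdegM !deg_exp // ?degX //.
  rewrite -!mulrA mulrDr -mul_mexp //; last exact: band_smx.
  by rewrite -mulrDr subrr.
have := congr1 (fun M : R => M ord0 ord_max) key => /=.
rewrite mxE !summxE -smx_end big_ord_recl mxdeg_smx.
under [X in _ + X = _]eq_bigr => i _ do rewrite smx_ad_term.
under [X in _ = X + _]eq_bigr => i _ do rewrite smx_ad_term addn0.
rewrite smx_ad_term /= expr0 factS fact0 invr1 !mul1r => keyE.
rewrite [X in _ = X - _]addrC -keyE -addrA.
under [X in _ + (X - _)]eq_bigr => i _ do rewrite /bump /= add1n addn1.
by rewrite subrr addr0.
Qed.

End BCHRecursion.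

Lemma ncexp_bch_log (k : fieldType) : [pchar k] =i pred0 ->
  ncexp (bch_log k) =1 ncmul (ncexp (ncvar k true)) (ncexp (ncvar k false)).
Proof.
move=> char0 w; rewrite !smx_end smx_exp ?bch_log0 // smx_bch_log //.
by rewrite smx_mul !smx_exp.
Qed.

Section BCHTheorem.
Variables (k : fieldType) (char0 : [pchar k] =i pred0).
Implicit Types (f h : ncseries k).

Definition is_lie n f : Prop := exists B : seq (k * lie_monomial),
  all (fun ct => lie_degree ct.2 == n) B /\
  forall w, size w = n -> \sum_(ct <- B) ct.1 * lie_expand k ct.2 w = f w.

Lemma is_lie_ext n f f' : (forall w, size w = n -> f w = f' w) ->
  is_lie n f -> is_lie n f'.
Proof.
move=> eqf [B [degB BE]]; exists B; split=> // w w_n.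
by rewrite BE // eqf.
Qed.

Lemma is_lie0 n f : (forall w, size w = n -> f w = 0) -> is_lie n f.
Proof. by move=> f0; exists [::]; split=> // w /f0->; rewrite big_nil. Qed.

Lemma is_lieD n f h : is_lie n f -> is_lie n h -> is_lie n (fun w => f w + h w).
Proof.
move=> [B [degB BE]] [C [degC CE]]; exists (B ++ C); rewrite all_cat degB degC.
by split=> // w w_n; rewrite big_cat /= BE // CE.
Qed.

Lemma is_lieZ n c f : is_lie n f -> is_lie n (fun w => c * f w).
Proof.
move=> [B [degB BE]]; exists [seq (c * ct.1, ct.2) | ct <- B]; split.
  by rewrite all_map.
by move=> w w_n; rewrite big_map -BE // mulr_sumr; apply: eq_bigr => ct _; rewrite mulrA.
Qed.

Lemma is_lie_sum n m (F : nat -> ncseries k) :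
  (forall i, (i < m)%N -> is_lie n (F i)) -> is_lie n (fun w => \sum_(i < m) F i w).
Proof.
elim: m => [|m IHm] FL; first by apply: is_lie0 => w _; rewrite big_ord0.
apply: (@is_lie_ext _ (fun w => \sum_(i < m) F i w + F m w)).
  by move=> w _; rewrite big_ord_recr.
by apply: is_lieD; [apply: IHm => i /ltnW; apply: FL | apply: FL].
Qed.

Lemma is_lie_var n b : is_lie n (ncvar k b).
Proof.
have [->|ne_n] := eqVneq n 1%N.
  exists [:: (1, LVar b)]; split=> // w _.
  by rewrite big_seq1 mul1r.
by apply: is_lie0 => w w_n; rewrite /ncvar; case: (w =P [:: b]) => // wb;
  rewrite -w_n wb in ne_n.
Qed.

Lemma ncmul_expand t1 t2 w i : lie_degree t1 = i -> (i <= size w)%N ->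
  ncmul (lie_expand k t1) (lie_expand k t2) w
    = lie_expand k t1 (take i w) * lie_expand k t2 (drop i w).
Proof.
move=> deg1 le_i; have lt_i : (i < (size w).+1)%N by [].
rewrite /ncmul (bigD1 (Ordinal lt_i)) //= big1 ?addr0 // => j ne_j.
rewrite lie_expand_size ?mul0r // size_takel ?deg1 //.
by rewrite -ltnS.
Qed.

Lemma is_lie_bracket i j f h : is_lie i f -> is_lie j h ->
  is_lie (i + j)%N (fun w => f (take i w) * h (drop i w) - h (take j w) * f (drop j w)).
Proof.
move=> [B [degB BE]] [C [degC CE]].
exists [seq (a.1 * b.1, LBracket a.2 b.2) | a <- B, b <- C]; split.
  elim: B degB {BE} => //= a B IHB /andP[/eqP deg_a /IHB]; rewrite all_cat => ->.
  rewrite andbT all_map; apply: sub_all degC => b /eqP deg_b /=.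
  by rewrite deg_a deg_b.
move=> w w_n; rewrite big_allpairs_dep /=.
have sz1 : size (take i w) = i by rewrite size_takel // w_n leq_addr.
have sz2 : size (drop i w) = j by rewrite size_drop w_n addKn.
have sz3 : size (take j w) = j by rewrite size_takel // w_n leq_addl.
have sz4 : size (drop j w) = i by rewrite size_drop w_n addnK.
rewrite -(BE _ sz1) -(BE _ sz4) -(CE _ sz2) -(CE _ sz3).
rewrite [X in _ - X]mulrC !mulr_suml -sumrB.
rewrite (big_all _ _ _ degB) [RHS](big_all _ _ _ degB); apply: eq_bigr => a /eqP deg_a.
rewrite !mulr_sumr -sumrB.
rewrite (big_all _ _ _ degC) [RHS](big_all _ _ _ degC); apply: eq_bigr => b /eqP deg_b.
rewrite /ncsub (ncmul_expand _ deg_a) ?w_n ?leq_addr //.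
rewrite (ncmul_expand _ deg_b) ?w_n ?leq_addl // mulrBr.
by congr (_ - _); rewrite [RHS]mulrACA // [X in _ = _ * X]mulrC.
Qed.

(** As f and h have no constant terms, the component of degree n of their
    bracket only involves their components of degrees 1 to n - 1. *)
Lemma is_lie_ad n f h : f [::] = 0 -> h [::] = 0 ->
    (forall m, (m < n)%N -> is_lie m f) -> (forall m, (m < n)%N -> is_lie m h) ->
  is_lie n (ncad f h).
Proof.
move=> f0 h0 fL hL.
pose F i w := f (take i w) * h (drop i w) - h (take (n - i) w) * f (drop (n - i) w).
apply: (@is_lie_ext _ (fun w => \sum_(i < n.+1) F i w)).
  move=> w w_n; rewrite /ncad /ncsub /ncmul w_n sumrB; congr (_ - _).
  rewrite (reindex_inj rev_ord_inj); apply: eq_bigr => i _ /=.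
  by rewrite subSS subKn // -ltnS.
apply: is_lie_sum => i; rewrite ltnS => le_i.
have [i0|i_gt0] := posnP i.
  apply: is_lie0 => w w_n; rewrite /F i0 take0 f0 mul0r subn0 -w_n drop_size f0 mulr0.
  by rewrite subrr.
have [i_n|ne_i] := eqVneq i n.
  apply: is_lie0 => w w_n; rewrite /F i_n subnn -w_n drop_size h0 take0 h0.
  by rewrite mulr0 mul0r subrr.
have lt_i : (i < n)%N by rewrite ltn_neqAle ne_i.
have lt_ni : (n - i < n)%N by rewrite ltn_subrL i_gt0 (leq_trans _ lt_i).
by have := is_lie_bracket (fL i lt_i) (hL _ lt_ni); rewrite subnKC.
Qed.

Lemma is_lie_iter_ad n f h i : f [::] = 0 -> h [::] = 0 ->
    (forall m, (m < n)%N -> is_lie m f) -> (forall m, (m < n)%N -> is_lie m h) ->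
  is_lie n (iter i.+1 (ncad f) h).
Proof.
move=> f0 h0 fL hL.
have ad0 j : iter j (ncad f) h [::] = 0.
  by case: j => //= j; rewrite /ncad /ncsub /ncmul !big_ord1 /= f0 mul0r mulr0 subrr.
rewrite iterS; apply: is_lie_ad => //.
elim: i => [|i IHi] //= m lt_m; apply: is_lie_ad; rewrite ?ad0 //.
  by move=> l lt_l; apply/fL/(ltn_trans lt_l).
by move=> l lt_l; apply/IHi/(ltn_trans lt_l).
Qed.

(** The Baker-Campbell-Hausdorff theorem, by induction on the degree and
    [bch_recursion]. *)
Lemma bch_log_lie n : is_lie n (bch_log k).
Proof.
elim/ltn_ind: n => -[_|n IHn].
  by apply: is_lie0 => w /size0nil ->; apply: bch_log0.
pose Z := bch_log k; have Z0 : Z [::] = 0 := bch_log0 k.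
apply: (@is_lie_ext _ (fun w => n.+1%:R^-1 * (ncvar k false w
    + \sum_(i < n.+2) (-1) ^+ i / i`!%:R * iter i (ncad (ncvar k false)) (ncvar k true) w
    + -1 * \sum_(i < n.+1) (-1) ^+ i.+1 / i.+2`!%:R * iter i.+1 (ncad Z) (ncdeg Z) w))).
  move=> w w_n; have := bch_recursion char0 w; rewrite w_n mulN1r => <-.
  by rewrite mulKf ?natr_neq0.
apply/is_lieZ/is_lieD.
  apply: is_lieD; first exact: is_lie_var.
  apply: (@is_lie_sum _ _ (fun i w => (-1) ^+ i / i`!%:R
      * iter i (ncad (ncvar k false)) (ncvar k true) w)) => -[|i] _; apply: is_lieZ.
    exact: is_lie_var.
  by apply: is_lie_iter_ad => // m _; apply: is_lie_var.
apply: is_lieZ; apply: (@is_lie_sum _ _ (fun i w => (-1) ^+ i.+1 / i.+2`!%:R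
    * iter i.+1 (ncad Z) (ncdeg Z) w)) => i _; apply: is_lieZ.
apply: is_lie_iter_ad => //; first by rewrite /ncdeg mul0r.
move=> m lt_m; apply: (@is_lie_ext _ (fun w => m%:R * Z w)).
  by move=> w w_m; rewrite /ncdeg w_m.
exact/is_lieZ/IHn.
Qed.

Lemma bch_seriesP : is_bch_series (bch_series k).
Proof.
apply: epsilon_spec.
pose P n (B : seq (k * lie_monomial)) := all (fun ct => lie_degree ct.2 == n) B /\
  forall w, size w = n -> \sum_(ct <- B) ct.1 * lie_expand k ct.2 w = bch_log k w.
exists (fun n => epsilon (inhabits [::]) (P n)).
have PB n : P n (epsilon (inhabits [::]) (P n)) by apply: epsilon_spec; apply: bch_log_lie.
by split=> [n|w]; [case: (PB n) | case: (PB (size w)) => _; apply].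
Qed.

End BCHTheorem.

(** * Lie series in ordered products *)

Section LieValues.
Variables (k : fieldType) (A : graphAlg k) (x y : A).
Implicit Types (ls : seq (seq A)).

Definition gbracket (a b : A) : A := corolla [:: a] b - corolla [:: b] a.

Fixpoint lie_val (t : lie_monomial) : A :=
  match t with
  | LVar b => if b then x else y
  | LBracket t1 t2 => gbracket (lie_val t1) (lie_val t2)
  end.

Definition letters (w : seq bool) : seq (seq A) :=
  [seq [:: if b then x else y] | b <- w].

Lemma letters_cat u v : letters (u ++ v) = letters u ++ letters v.
Proof. exact: map_cat. Qed.

Lemma letters_nseq n b : letters (nseq n b) = nseq n [:: if b then x else y].
Proof. exact: map_nseq. Qed.

Lemma sum_ncmul_words (f h : ncseries k) d1 d2 (K : seq bool -> A) :
    (forall w, size w != d1 -> f w = 0) ->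
  \sum_(w <- words (d1 + d2)) ncmul f h w *: K w
    = \sum_(u <- words d1) f u *: \sum_(v <- words d2) h v *: K (u ++ v).
Proof.
move=> f0; rewrite sum_words_cat big_seq [RHS]big_seq.
apply: eq_bigr => u /words_size u_d; rewrite scaler_sumr.
apply: eq_bigr => v _; rewrite scalerA; congr (_ *: _).
have lt_d : (d1 < (size (u ++ v)).+1)%N by rewrite ltnS size_cat u_d leq_addr.
rewrite /ncmul (bigD1 (Ordinal lt_d)) //= take_size_cat // drop_size_cat //.
rewrite big1 ?addr0 // => i ne_i; rewrite f0 ?mul0r //.
by rewrite size_takel // -ltnS.
Qed.

(** Ordered products behave like the products of an enveloping algebra, since
    brackets become commutators in them ([Tl_commutator]). *)
Lemma Tl_lie t ls1 ls2 :
  Tl (ls1 ++ [:: lie_val t] :: ls2)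
    = \sum_(w <- words (lie_degree t)) lie_expand k t w *: Tl (ls1 ++ letters w ++ ls2).
Proof.
elim: t ls1 ls2 => [b|t1 IH1 t2 IH2] ls1 ls2 /=.
  have -> : ls1 ++ [:: if b then x else y] :: ls2 = ls1 ++ letters [:: b] ++ ls2 by [].
  by rewrite -(sum_words1 (fun w => Tl (ls1 ++ letters w ++ ls2)) [:: b]).
have expand2 t t' : (forall ls1 ls2, Tl (ls1 ++ [:: lie_val t] :: ls2)
    = \sum_(w <- words (lie_degree t)) lie_expand k t w *: Tl (ls1 ++ letters w ++ ls2)) ->
   (forall ls1 ls2, Tl (ls1 ++ [:: lie_val t'] :: ls2)
    = \sum_(w <- words (lie_degree t')) lie_expand k t' w *: Tl (ls1 ++ letters w ++ ls2)) ->
   Tl (ls1 ++ [:: [:: lie_val t]; [:: lie_val t']] ++ ls2)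
    = \sum_(w <- words (lie_degree t + lie_degree t'))
        ncmul (lie_expand k t) (lie_expand k t') w *: Tl (ls1 ++ letters w ++ ls2).
  move=> IH IH'; rewrite sum_ncmul_words; last exact: lie_expand_size.
  rewrite -[ls1 ++ _]/(ls1 ++ [:: lie_val t] :: [:: lie_val t'] :: ls2) IH.
  apply: eq_bigr => u _; congr (_ *: _); rewrite catA IH'.
  by apply: eq_bigr => v _; rewrite letters_cat !catA.
rewrite -Tl_commutator (expand2 _ _ IH1 IH2) (expand2 _ _ IH2 IH1) addnC -sumrB.
by apply: eq_bigr => w _; rewrite -scalerBl.
Qed.

End LieValues.

Definition is_bch (k : fieldType) (A : filteredAlg k) (x y b : A) : Prop := forall N,
  congF N b (\sum_(d < N) \sum_(ct <- bch_series k d) ct.1 *: lie_val x y ct.2).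

Section LieSeries.
Variables (k : fieldType) (char0 : [pchar k] =i pred0) (A : filteredAlg k).
Variables (x y : A).
Hypotheses (Fx : Fil 1 x) (Fy : Fil 1 y).
Implicit Types (ls : seq (seq A)).

Lemma Fil_corolla1 p q (a b : A) : Fil p a -> Fil q b -> Fil (p + q) (corolla [:: a] b).
Proof.
move=> Fa Fb; rewrite Tseq_corolla; apply: Fil_Tl => /=.
by exists p, q; split=> //; exists q, 0%N; rewrite addn0.
Qed.

Lemma Fil_lie_val t : Fil (lie_degree t) (lie_val x y t).
Proof.
elim: t => [[]|t1 F1 t2 F2] //=.
by apply: FilB; [|rewrite addnC]; apply: Fil_corolla1.
Qed.

Lemma entriesF1_letters w : entriesF1 (letters x y w).
Proof.
elim: w => [|b w IHw] a //=; rewrite inE => /orP[/eqP->|/IHw //].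
by case: b.
Qed.

Lemma Fil_word w ls1 ls2 : entriesF1 ls1 -> entriesF1 ls2 ->
  Fil (size w) (Tl (ls1 ++ letters x y w ++ ls2)).
Proof.
move=> F1 F2; apply: (@Fil_leq _ _ _ (size (flatten (ls1 ++ letters x y w ++ ls2)))).
  rewrite !flatten_cat !size_cat addnCA -leq_subLR (_ : size (flatten _) = size w).
    by rewrite subnn.
  by elim: (w) => //= b w' ->.
by apply/Fil_Tl_size/entriesF1_cat; split=> //; apply/entriesF1_cat; split=> //;
  apply: entriesF1_letters.
Qed.

Section WordSeries.
Variables (Z : ncseries k) (b : A).

Hypothesis Tl_b : forall N ls1 ls2, entriesF1 ls1 -> entriesF1 ls2 ->
  congF N (Tl (ls1 ++ [:: b] :: ls2))
    (word_sum N Z (fun w => Tl (ls1 ++ letters x y w ++ ls2))).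

Lemma Tl_series_expn N n ls1 ls2 : Fil 1 b -> entriesF1 ls1 -> entriesF1 ls2 ->
  congF N (Tl (ls1 ++ nseq n [:: b] ++ ls2))
    (word_sum N (ncexpn Z n) (fun w => Tl (ls1 ++ letters x y w ++ ls2))).
Proof.
move=> Fb; elim: n ls1 => [|n IHn] ls1 F1 F2.
  case: N => [|N]; first by apply: Fil_full.
  rewrite /word_sum big_ord_recl sum_words0 scale1r big1 ?addr0 => [|i _].
    exact: congF_refl.
  rewrite big_seq big1 // => -[|c w] /words_size //= _.
  by rewrite /nc1 scale0r.
have F2' : entriesF1 (nseq n [:: b] ++ ls2).
  by apply/entriesF1_cat; split=> //; apply: entriesF1_nseq.
apply: congF_trans (Tl_b N F1 F2') _.
apply: congF_trans (congF_sym (word_sum_mul N Z (ncexpn Z n) _)); last first.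
  by move=> w; apply: Fil_word.
apply: congF_word_sum => u.
have F1u : entriesF1 (ls1 ++ letters x y u).
  by apply/entriesF1_cat; split=> //; apply: entriesF1_letters.
rewrite catA; apply: congF_trans (IHn _ F1u F2) _.
rewrite (@eq_word_sum _ _ _ _ (ncexpn Z n) _
  (fun w => Tl (ls1 ++ letters x y (u ++ w) ++ ls2))) //; first exact: congF_refl.
by move=> w; rewrite letters_cat !catA.
Qed.

Lemma Tl_series_exp N ls1 ls2 : Fil 1 b -> Z [::] = 0 ->
    entriesF1 ls1 -> entriesF1 ls2 ->
  congF N (\sum_(n < N) (n`!%:R)^-1 *: Tl (ls1 ++ nseq n [:: b] ++ ls2))
    (word_sum N (ncexp Z) (fun w => Tl (ls1 ++ letters x y w ++ ls2))).
Proof.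
move=> Fb Z0 F1 F2; pose K w := Tl (ls1 ++ letters x y w ++ ls2).
rewrite -[word_sum _ _ _]/(word_sum N (ncexp Z) K).
apply: (@congF_trans _ _ _ (\sum_(n < N) (n`!%:R)^-1 *: word_sum N (ncexpn Z n) K)).
  by apply: congF_sum => n _; apply/congFZ/Tl_series_expn.
suff -> : word_sum N (ncexp Z) K
    = \sum_(n < N) (n`!%:R)^-1 *: word_sum N (ncexpn Z n) K by exact: congF_refl.
rewrite /word_sum; under [RHS]eq_bigr => n _ do rewrite scaler_sumr.
rewrite [RHS]exchange_big; apply: eq_bigr => d _.
under [RHS]eq_bigr => n _ do rewrite scaler_sumr.
rewrite [RHS]exchange_big big_seq [RHS]big_seq; apply: eq_bigr => w /words_size w_d.
under [RHS]eq_bigr => n _ do rewrite scalerA.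
rewrite -scaler_suml; congr (_ *: _).
rewrite /ncexp big_mkord w_d.
rewrite (@sum_ord_trunc _ d.+1 N (fun n => (n`!%:R)^-1 * ncexpn Z n w)) //.
by move=> n lt_d; rewrite ncexpn_eq0 ?mulr0 ?w_d.
Qed.

End WordSeries.

(** Expand the entries b into words in x and y: the exponential of the series
    log (e^X e^Y) is e^X e^Y. *)
Lemma level_bch (b : A) N ls1 ls2 :
    is_bch x y b -> entriesF1 ls1 -> entriesF1 ls2 ->
  congF N (\sum_(n < N) (n`!%:R)^-1 *: Tl (ls1 ++ nseq n [:: b] ++ ls2))
    (\sum_(i < N) (i`!%:R)^-1 *: \sum_(j < N) (j`!%:R)^-1 *:
        Tl (ls1 ++ nseq i [:: x] ++ nseq j [:: y] ++ ls2)).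
Proof.
move=> bE F1 F2; have [B_deg B_log] := bch_seriesP char0.
have explog := ncexp_bch_log char0.
have Fb : Fil 1 b.
  have := congF_Fil (bE 1%N); apply; rewrite big_ord1.
  rewrite (big_all _ _ _ (B_deg 0%N)); apply: Fil_sum => ct /eqP ct0.
  by have := lie_degree_gt0 ct.2; rewrite ct0.
pose Z := bch_log k; have Z0 : Z [::] = 0 := bch_log0 k.
have Tl_b N' ls ls' : entriesF1 ls -> entriesF1 ls' ->
  congF N' (Tl (ls ++ [:: b] :: ls'))
    (word_sum N' Z (fun w => Tl (ls ++ letters x y w ++ ls'))).
  move=> F F'; have Fctx : total_index (size (flatten (ls ++ [::] :: ls'))) (flatten (ls ++ [::] :: ls')).
    by apply/total_index_size/entriesF1_cat; split=> //; apply/entriesF1_cons.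
  apply: congF_trans (congF_leq (leq_addr _ N') (congF_entry (bE N') Fctx)) _.
  rewrite -[Tl _]/(Tl_entry ls [::] ls' _) linear_sum.
  apply: congF_sum => d _.
  rewrite -[X in congF _ X _]/(Tl_entry ls [::] ls' (\sum_(ct <- bch_series k d) ct.1 *: lie_val x y ct.2)).
  suff -> : Tl_entry ls [::] ls' (\sum_(ct <- bch_series k d) ct.1 *: lie_val x y ct.2)
      = \sum_(w <- words d) Z w *: Tl (ls ++ letters x y w ++ ls').
    exact: congF_refl.
  transitivity (\sum_(ct <- bch_series k d) \sum_(w <- words d) ct.1 *: (lie_expand k ct.2 w *:
      Tl (ls ++ letters x y w ++ ls'))).
    rewrite linear_sum (big_all _ _ _ (B_deg d)) [RHS](big_all _ _ _ (B_deg d)).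
    apply: eq_bigr => ct /eqP ct_d.
    rewrite linearZ -scaler_sumr; congr (_ *: _).
    by rewrite -ct_d -Tl_lie.
  rewrite exchange_big big_seq [RHS]big_seq; apply: eq_bigr => w /words_size w_d.
  rewrite /Z /bch_log -B_log w_d scaler_suml; apply: eq_bigr => ct _.
  by rewrite scalerA.
apply: congF_trans (Tl_series_exp Tl_b N Fb Z0 F1 F2) _.
rewrite (eq_word_sum N explog (fun _ => erefl)).
apply: congF_trans (word_sum_mul N _ _ _) _; first by move=> w; apply: Fil_word.
rewrite word_sum_expvar.
under eq_bigr => i _ do rewrite word_sum_expvar.
apply: congF_sum => i _; apply/congFZ/congF_sum => j _; apply: congFZ.
by rewrite letters_cat !letters_nseq !catA; apply: congF_refl.
Qed.

End LieSeries.

(** * Sums over isomorphism classes *)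

Section OrbitSums.
Variables (k : fieldType) (char0 : [pchar k] =i pred0) (V : lmodType k).

(** The orbit-stabiliser theorem: an orbit has as many elements as the group,
    divided by the order of a stabiliser. *)
Lemma sum_transversal (aT : finGroupType) (X : finType) (to : {action aT &-> X})
    (D : {set X}) (R : rel X) (f : X -> V) :
    (forall x s, x \in D -> to x s \in D) ->
    (forall x s, x \in D -> f (to x s) = f x) ->
    {in D &, forall x y, R x y = (y \in orbit to [set: aT] x)} ->
  \sum_(x in transversal (equivalence_partition R D) D)
      (#|[set s | to x s == x]|%:R)^-1 *: f x
    = (#|aT|%:R)^-1 *: \sum_(x in D) f x.
Proof.
move=> toD f_inv RE; set P := equivalence_partition R D; set X0 := transversal P D.
have eqR : {in D & &, equivalence_rel R}.
  move=> x y z xD yD zD; rewrite !RE // orbit_refl; split=> // /orbit_in_eqP.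
  by move=> ->; rewrite ?subsetT.
have partP : partition P D by apply: equivalence_partitionP.
have coverP : cover P = D by case/and3P: (partP) => /eqP.
have trX : is_transversal X0 P D by apply: transversalP.
clearbody X0; rewrite [X in _ = _ *: X](set_partition_big P partP) /= -(pblock_transversal trX) big_imset /=; last first.
  exact: (pblock_inj trX).
rewrite scaler_sumr; apply: eq_bigr => x xX0.
have xD : x \in D by apply: (subsetP (transversal_sub trX)).
have pbE y : (y \in pblock P x) = (y \in orbit to [set: aT] x).
  have [yD|nyD] := boolP (y \in D).
    by rewrite (pblock_equivalence_partition eqR) // RE.
  apply/idP/orbitP => [yP|[s _ sx]]; last by rewrite -sx toD in nyD.
  case/negP: nyD; rewrite -coverP; apply/bigcupP.
  by exists (pblock P x); rewrite // pblock_mem // coverP.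
rewrite (eq_bigr (fun=> f x)) => [|y]; last by rewrite pbE => /orbitP[s _ <-]; apply: f_inv.
rewrite sumr_const -scaler_nat scalerA (eq_card pbE).
have := card_orbit_stab to [set: aT] x; rewrite cardsT => <-.
have -> : ('C_[set: aT][x | to])%g = [set s | to x s == x].
  by apply/setP => s; rewrite setTI !inE sub1set inE.
have orb_gt0 : (0 < #|orbit to [set: aT] x|)%N.
  by apply/card_gt0P; exists x; apply: orbit_refl.
rewrite natrM invfM mulrAC mulVf ?mul1r // ((pcharf0P _).1 char0).
by rewrite -lt0n.
Qed.

End OrbitSums.

Section GraphRelabelling.
Variable n : nat.
Implicit Types (h : dsGra n) (s t : 'S_n) (hT : dsGra n * {set 'I_n}).

Lemma is_dsgraph_move s h : is_dsgraph (preim_edges (s^-1)%g (val h)).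
Proof.
by rewrite is_dsgraph_preim ?(valP h) //; apply: (Bijective (permKV s) (permK s)).
Qed.

Definition gmove h s : dsGra n := Sub _ (is_dsgraph_move s h).

Lemma edge_gmove h s a b : edge (gmove h s) (s a) (s b) = edge h a b.
Proof. by rewrite /edge SubK inE /= !permK. Qed.

Lemma giso_gmove s h h' : giso s h h' = (h' == gmove h s).
Proof.
apply/'forall_forallP/eqP => [/= hh'|-> a b]; last by rewrite /= edge_gmove.
apply: val_inj; apply/setP => -[a b].
rewrite -[LHS]/(edge h' a b) -[RHS]/(edge (gmove h s) a b).
by rewrite -[a](permKV s) -[b](permKV s) edge_gmove (eqP (hh' _ _)).
Qed.

Lemma gmove1 : gmove^~ 1%g =1 id.
Proof. by move=> h; apply: val_inj; rewrite /= invg1 preim_edges_id // => a; rewrite perm1. Qed.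

Lemma gmoveM h : act_morph gmove h.
Proof.
move=> s t; apply: val_inj; rewrite /= preim_edges_comp.
by apply: eq_preim_edges => a; rewrite /= invMg permM.
Qed.

Definition graph_action : {action 'S_n &-> dsGra n} := TotalAction gmove1 gmoveM.

Definition lmove (hT : dsGra n * {set 'I_n}) s :=
  (gmove hT.1 s, [set a | (s^-1)%g a \in hT.2]).

Lemma lmove1 : lmove^~ 1%g =1 id.
Proof.
case=> h T; rewrite /lmove gmove1 /=; congr (_, _).
by apply/setP => a; rewrite inE invg1 perm1.
Qed.

Lemma lmoveM hT : act_morph lmove hT.
Proof.
move=> s t; rewrite /lmove /= gmoveM; congr (_, _).
by apply/setP => a; rewrite !inE invMg permM.
Qed.

Definition leveled_action : {action 'S_n &-> dsGra n * {set 'I_n}} :=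
  TotalAction lmove1 lmoveM.

Lemma leveled_giso_lmove s hT hT' : leveled_giso s hT hT' = (hT' == lmove hT s).
Proof.
case: hT hT' => h T [h' T']; rewrite /leveled_giso giso_gmove xpair_eqE /=.
congr (_ && _); apply/forallP/eqP => [TT'|-> a]; last by rewrite inE permK.
by apply/setP => a; rewrite inE -{1}[a](permKV s) (eqP (TT' _)).
Qed.

Lemma leveled_lowering hT :
  leveled hT = lowering (fun a => (a \in hT.2) : nat) (val hT.1).
Proof.
case: hT => h T; rewrite /leveled /=.
apply/'forall_forallP/loweringP => [hT a b abE|lowE a b] /=.
  by have /implyP/(_ abE)/andP[-> /negPf->] := hT a b.
by apply/implyP => /lowE; case: (a \in T); case: (b \in T).
Qed.

Lemma leveled_lmove hT s : leveled (lmove hT s) = leveled hT.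
Proof.
rewrite !leveled_lowering /= -(@lowering_preim _ _ s); last first.
  exact: (Bijective (permK s) (permKV s)).
rewrite preim_edges_comp preim_edges_id; last by move=> a; rewrite /= permK.
by apply: eq_forallb => p; rewrite /= !inE !permK.
Qed.

Lemma total_levelisation_gmove h t :
  total_levelisation h t = lowering val (val (gmove h t)).
Proof.
apply/'forall_forallP/loweringP => [/= hl a b|lowE a b].
  rewrite -[is_true (_ \in _)]/(is_true (edge (gmove h t) a b)).
  by rewrite -[a](permKV t) -[b](permKV t) edge_gmove; move/(implyP (hl _ _)).
apply/implyP => /= abE; apply: lowE.
by rewrite -[is_true _]/(is_true (edge (gmove h t) (t a) (t b))) edge_gmove.
Qed.

(** Automorphisms act freely on total levelisations, whose levels are distinct. *)
Lemma card_total_levelisation h :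
  #|[set t | total_levelisation h t]|
    = (nb_total_levelisations h * #|[set s | gmove h s == h]|)%N.
Proof.
rewrite /nb_total_levelisations; set D := [set t | _].
set R := fun t t' => _.
have RE t t' : R t t' = (gmove h (t * t'^-1)%g == h).
  apply/existsP/eqP => [[s /andP[sh /forallP st]]|fix_h].
    have -> : (t * t'^-1)%g = s.
      by apply/permP => a; rewrite permM -(eqP (st a)) permK.
    by apply/esym/eqP; rewrite -giso_gmove.
  exists (t * t'^-1)%g; rewrite giso_gmove fix_h eqxx.
  by apply/forallP => a; rewrite permM permKV.
have Aut1 : gmove h 1 = h by apply: gmove1.
have AutM s t : gmove h s = h -> gmove h t = h -> gmove h (s * t)%g = h.
  by move=> hs ht; rewrite gmoveM hs ht.
have AutV s : gmove h s = h -> gmove h s^-1%g = h.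
  by move=> hs; rewrite -{1}hs -gmoveM mulgV gmove1.
have eqR : {in D & &, equivalence_rel R}.
  move=> t u v _ _ _; rewrite !RE mulgV Aut1 eqxx; split=> // /eqP tu.
  apply/eqP/eqP => ht.
    have -> : (u * v^-1 = (t * u^-1)^-1 * (t * v^-1))%g by rewrite invMg invgK mulgA mulgKV.
    by apply: AutM => //; apply: AutV.
  have -> : (t * v^-1 = (t * u^-1) * (u * v^-1))%g by rewrite mulgA mulgKV.
  exact: AutM.
rewrite (card_uniform_partition (n := #|[set s | gmove h s == h]|) _ (equivalence_partitionP eqR)) // => B.
case/imsetP=> t tD ->.
have inj_f : injective (fun s => (s^-1 * t)%g) by move=> s s' /mulIg/invg_inj.
rewrite -[RHS](card_imset _ inj_f); apply: eq_card => u; rewrite inE RE.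
apply/andP/imsetP => [[_ /eqP tu]|[s]].
  exists (t * u^-1)%g; first by rewrite inE tu.
  by rewrite invMg invgK mulgKV.
rewrite inE => /eqP hs ->; rewrite invMg invgK mulKVg hs.
split=> //.
by move: tD; rewrite !inE !total_levelisation_gmove gmoveM AutV.
Qed.

End GraphRelabelling.

Section ClassSums.
Variables (k : fieldType) (char0 : [pchar k] =i pred0).

(** As automorphisms act freely on total levelisations, the number of classes of
    levelisations is the number of levelisations divided by the order of the
    automorphism group. Relabelling by a levelisation then turns each graph into
    one whose edges decrease the labels. *)
Lemma sum_dsGra_classes (V : lmodType k) n (F : dsGra n -> V) :
    (forall h s, F (gmove h s) = F h) ->
  \sum_(h in dsGra_classes n) ((nb_total_levelisations h)%:R / n`!%:R) *: F h
    = (n`!%:R)^-1 *: \sum_(h : dsGra n | lowering val (val h)) F h.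
Proof.
move=> F_inv; pose TL (h : dsGra n) := [set t | total_levelisation h t].
have TL_inv h s : #|TL (gmove h s)| = #|TL h|.
  rewrite -(card_imset (TL (gmove h s)) (mulgI s)); apply: eq_card => t.
  apply/imsetP/idP => [[u]|tTL].
    by rewrite !inE !total_levelisation_gmove -gmoveM => uTL ->.
  exists (s^-1 * t)%g; last by rewrite mulKVg.
  by move: tTL; rewrite !inE !total_levelisation_gmove -gmoveM mulKVg.
have -> : \sum_(h in dsGra_classes n) ((nb_total_levelisations h)%:R / n`!%:R) *: F h
    = (n`!%:R)^-1 *: \sum_(h in dsGra_classes n)
        (#|[set s | graph_action n h s == h]|%:R)^-1 *: (#|TL h|%:R *: F h).
  rewrite scaler_sumr; apply: eq_bigr => h _.
  rewrite !scalerA card_total_levelisation natrM; congr (_ *: _).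
  have Aut_n0 : #|[set s | gmove h s == h]|%:R != 0 :> k.
    rewrite (pcharf0P _).1 // -lt0n; apply/card_gt0P.
    by exists 1%g; rewrite inE gmove1.
  rewrite [LHS]mulrC -[RHS]mulrA; congr (_ * _); rewrite [RHS]mulrC.
  apply/esym/(mulfK Aut_n0).
rewrite (@sum_transversal k char0 V _ _ (graph_action n)) //; first last.
- move=> h h' _ _; apply/existsP/orbitP => [[s]|[s _ <-]].
    by rewrite giso_gmove => /eqP ->; exists s.
  by exists s; rewrite giso_gmove.
- by move=> h s _; rewrite TL_inv F_inv.
congr (_ *: _).
transitivity ((n`!%:R)^-1 *: \sum_(t : 'S_n) \sum_(h : dsGra n | lowering val (val h)) F h).
  rewrite card_Sn; congr (_ *: _).
  transitivity (\sum_(h : dsGra n) \sum_(t : 'S_n | total_levelisation h t) F h).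
    apply: eq_big => [h|h _]; first by rewrite inE.
    by rewrite sumr_const scaler_nat cardsE.
  rewrite (exchange_big_dep xpredT) //=; apply: eq_bigr => t _.
  rewrite [RHS](reindex_inj (act_inj (graph_action n) t)) /=.
  by apply: eq_big => [h|h _]; rewrite ?total_levelisation_gmove ?F_inv.
rewrite sumr_const -scaler_nat scalerA (_ : #|_| = n`!) ?mulVf ?scale1r ?factr_neq0 //.
by rewrite card_Sn.
Qed.

Lemma sum_leveled_classes (V : lmodType k) n (F : dsGra n * {set 'I_n} -> V) :
    (forall hT s, F (lmove hT s) = F hT) ->
  \sum_(hT in leveled_classes n) (#|leveled_Aut hT|%:R)^-1 *: F hT
    = (n`!%:R)^-1 *: \sum_(hT | leveled hT) F hT.
Proof.
move=> F_inv.
have -> : \sum_(hT in leveled_classes n) (#|leveled_Aut hT|%:R)^-1 *: F hT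
    = \sum_(hT in leveled_classes n)
       (#|[set s | leveled_action n hT s == hT]|%:R)^-1 *: F hT.
  apply: eq_bigr => hT _; congr (_%:R^-1 *: _); apply: eq_card => s.
  by rewrite !inE leveled_giso_lmove eq_sym.
rewrite (@sum_transversal k char0 V _ _ (leveled_action n)) //; first last.
- move=> h h' _ _; apply/existsP/orbitP => [[s]|[s _ <-]].
    by rewrite leveled_giso_lmove => /eqP ->; exists s.
  by exists s; rewrite leveled_giso_lmove.
- by move=> h s _; apply: F_inv.
- by move=> h s; rewrite !inE leveled_lmove.
rewrite card_Sn; congr (_ *: _); apply: eq_bigl => hT.
by rewrite inE.
Qed.

Variable A : graphAlg k.
Implicit Types x y : A.

Lemma gop_gmove n (h : dsGra n) s (z : {ffun 'I_n -> A}) :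
  gop (gmove h s) z = gop h [ffun a => z (s a)].
Proof. by apply: gop_equivariant; rewrite giso_gmove. Qed.

(** A totally levelised graph, labelled by its levels, is a term of the product
    of n levels reduced to x. *)
Lemma exp_term_classes x n :
  \sum_(h in dsGra_classes n)
     ((nb_total_levelisations h)%:R / n`!%:R) *: gop h [ffun=> x] = exp_term x n.
Proof.
rewrite sum_dsGra_classes => [|h s]; last first.
  by rewrite gop_gmove; congr gop; apply/ffunP => a; rewrite !ffunE.
congr (_ *: _); rewrite /Tl.
have -> : tagl 0 (nseq n [:: x]) = [seq (nat_of_ord i, x) | i <- enum 'I_n].
  rewrite (map_comp (fun i => (i, x)) (@nat_of_ord n)) val_enum_ord.
  by elim: n 0%N => //= n IHn i; rewrite IHn.
rewrite -(Tfin_Tseq (fun i : 'I_n => nat_of_ord i) (fun=> x) (perm_refl _)) /Tfin.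
under [RHS]eq_bigr => E _ do rewrite gact_ord.
by rewrite -sum_dsGra; apply: eq_bigr => h _; congr gop; apply/ffunP => a; rewrite !ffunE.
Qed.

Lemma sum_subsets_card (V : lmodType k) n (G : nat -> V) :
  \sum_(T : {set 'I_n}) G #|T| = \sum_(j < n.+1) 'C(n, j)%:R *: G j.
Proof.
have lt_T (T : {set 'I_n}) : (#|T| < n.+1)%N.
  by rewrite ltnS -[X in (_ <= X)%N](card_ord n) max_card.
rewrite (partition_big (fun T => Ordinal (lt_T T)) xpredT) //=.
apply: eq_bigr => j _; rewrite (eq_bigr (fun=> G j)) => [|T /eqP/(congr1 val) <- //].
rewrite sumr_const scaler_nat; congr (_ *+ _).
rewrite -[n in 'C(n, _)]card_ord -card_draws -[RHS]cardsE; apply: eq_card => T.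
by rewrite !inE unfold_in.
Qed.

(** The terms with n vertices of the circled product, j of them on the upper
    level; see [circ_term_classes]. *)
Definition circ_term x y n : A :=
  \sum_(j < n.+1) ((j`!%:R)^-1 * ((n - j)`!%:R)^-1) *: Tl [:: nseq (n - j) x; nseq j y].

Lemma circ_term_classes x y n :
  \sum_(hT in leveled_classes n) (#|leveled_Aut hT|%:R)^-1 *:
     gop hT.1 [ffun a => if a \in hT.2 then y else x] = circ_term x y n.
Proof.
rewrite (sum_leveled_classes
  (F := fun hT => gop hT.1 [ffun a => if a \in hT.2 then y else x])) => [|hT s]; last first.
  by rewrite gop_gmove; congr gop; apply/ffunP => a; rewrite !ffunE /= inE permK.
transitivity ((n`!%:R)^-1 *: \sum_(T : {set 'I_n}) Tl [:: nseq (n - #|T|) x; nseq #|T| y]).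
  congr (_ *: _).
  transitivity (\sum_(T : {set 'I_n}) \sum_(h : dsGra n | leveled (h, T))
      gop h [ffun a => if a \in T then y else x]).
    rewrite [RHS](exchange_big_dep xpredT) //= pair_big_dep /=.
    by apply: eq_big => -[h T].
  apply: eq_bigr => T _.
  transitivity (Tfin (fun a : 'I_n => (a \in T) : nat) (fun a => if a \in T then y else x)).
    rewrite /Tfin; under [RHS]eq_bigr => E _ do rewrite gact_ord.
    rewrite -sum_dsGra; apply: eq_bigl => h.
    exact: leveled_lowering.
  rewrite (Tfin_Tseq _ _ (perm_refl _)); apply: Tseq_perm.
  rewrite /= cats0 !map_nseq.
  have mapE (P : pred 'I_n) (c : nat * A) (f : 'I_n -> nat * A) :
      (forall a, P a -> f a = c) -> map f (filter P (enum 'I_n)) = nseq #|P| c.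
    move=> fP; have -> : #|P| = size (map f (filter P (enum 'I_n))).
      by rewrite size_map cardE enumT.
    apply/all_pred1P/allP => _ /mapP[a + ->]; rewrite mem_filter => /andP[Pa _].
    by rewrite /= fP.
  rewrite -(mapE [in T] _ (fun a => ((a \in T) : nat, if a \in T then y else x))); last first.
    by move=> a /= ->.
  rewrite (_ : (n - #|T|)%N = #|[predC [in T]]|); last first.
    by rewrite -[X in (X - _)%N](card_ord n) -(cardC [in T]) addKn.
  rewrite -(mapE [predC [in T]] _ (fun a => ((a \in T) : nat, if a \in T then y else x))); last first.
    by move=> a /= /negPf->.
  by rewrite -map_cat; apply: perm_map; rewrite perm_sym perm_catC perm_filterC.
rewrite (sum_subsets_card _ (fun j => Tl [:: nseq (n - j) x; nseq j y])) scaler_sumr.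
apply: eq_bigr => j _; rewrite scalerA; congr (_ *: _).
have le_j : (j <= n)%N by rewrite -ltnS.
rewrite -(bin_fact le_j) natrM invfM mulrAC mulVf ?mul1r ?natrM ?invfM //.
by rewrite (pcharf0P _).1 // -lt0n bin_gt0.
Qed.

End ClassSums.

(** * The graph exponential and the BCH product *)

Section GaugeGroups.
Variables (k : fieldType) (char0 : [pchar k] =i pred0) (A : filteredAlg k).
Implicit Types (x y z b c e : A) (ls : seq (seq A)).

Definition is_circ x y c : Prop :=
  forall N, congF N c (\sum_(n < N) circ_term x y n).

Definition exp_sum2 N (F : nat -> nat -> A) : A :=
  \sum_(i < N) (i`!%:R)^-1 *: \sum_(j < N) (j`!%:R)^-1 *: F i j.

Lemma congF_exp_sum2 N F F' : (forall i j, congF N (F i j) (F' i j)) ->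
  congF N (exp_sum2 N F) (exp_sum2 N F').
Proof.
move=> FF'; apply: congF_sum => i _; apply/congFZ/congF_sum => j _.
exact: congFZ.
Qed.

(** The terms with i + j at least N are negligible. *)
Lemma exp_sum2_diag N F : (forall i j, Fil (i + j) (F i j)) ->
  congF N (exp_sum2 N F)
    (\sum_(n < N) \sum_(j < n.+1) ((j`!%:R)^-1 * ((n - j)`!%:R)^-1) *: F (n - j)%N j).
Proof.
move=> FF; pose a i j := ((j`!%:R)^-1 * (i`!%:R)^-1) *: F i j.
rewrite (eq_bigr (fun n : 'I_N => \sum_(i < n.+1) a i (n - i)%N)) => [|n _]; last first.
  rewrite (reindex_inj rev_ord_inj); apply: eq_bigr => j _ /=.
  by rewrite subSS /a subKn // -ltnS.
rewrite sum_triangle; apply: congF_sum => i _.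
rewrite scaler_sumr; under eq_bigr => j _ do rewrite scalerA mulrC.
rewrite -!(big_mkord xpredT (a i)) (@big_cat_nat _ _ _ (N - i)) ?leq_subr //=.
rewrite -[X in congF _ _ X]addr0; apply: congFD; first exact: congF_refl.
apply/congF0; rewrite big_nat_cond; apply: Fil_sum => j /andP[/andP[le_j _] _].
by apply: FilZ; apply: Fil_leq (FF _ _); rewrite -leq_subLR.
Qed.

Lemma entriesF1_level n x : Fil 1 x -> entriesF1 [:: nseq n x].
Proof. by move=> Fx a; rewrite /= cats0 mem_nseq => /andP[_ /eqP->]. Qed.

Lemma entriesF1_nil : entriesF1 ([::] : seq (seq A)). Proof. by []. Qed.

Lemma Fil_circ_term x y n : Fil 1 x -> Fil 1 y -> Fil n (circ_term x y n).
Proof.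
move=> Fx Fy; apply: Fil_sum => j _; apply: FilZ.
have le_j : (j <= n)%N by rewrite -ltnS.
have F12 : entriesF1 [:: nseq (n - j) x; nseq j y].
  by apply/(@entriesF1_cat _ _ [:: nseq (n - j) x]); split; apply: entriesF1_level.
by have := Fil_Tl_size F12; rewrite /= cats0 size_cat !size_nseq subnK.
Qed.

Lemma is_circ_exists x y : Fil 1 x -> Fil 1 y -> exists c, is_circ x y c.
Proof.
move=> Fx Fy; apply: Fil_complete => p.
by rewrite big_ord_recr /= addrAC subrr add0r; apply: Fil_circ_term.
Qed.

Lemma is_circ_sum x y c N : Fil 1 x -> Fil 1 y -> is_circ x y c ->
  congF N c (exp_sum2 N (fun i j => Tl [:: nseq i x; nseq j y])).
Proof.
move=> Fx Fy cE; apply: congF_trans (cE N) _; apply: congF_sym.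
apply: exp_sum2_diag => i j.
have F12 : entriesF1 [:: nseq i x; nseq j y].
  by apply/(@entriesF1_cat _ _ [:: nseq i x]); split; apply: entriesF1_level.
by have := Fil_Tl_size F12; rewrite /= cats0 size_cat !size_nseq.
Qed.

Lemma exp_term_sum N x :
  \sum_(n < N) exp_term x n
    = \sum_(n < N) (n`!%:R)^-1 *: Tl ([::] ++ nseq n [:: x] ++ [::]).
Proof. by apply: eq_bigr => n _; rewrite cats0. Qed.

(** Replace the upper level by e^y and the lower one by e^x ([level_exp]); e^x
    e^y is the ordered exponential of the BCH product ([level_bch]). *)
Lemma is_exp_bch x y b ex ey c : Fil 1 x -> Fil 1 y ->
    is_exp x ex -> is_exp y ey -> is_bch x y b -> is_circ ex ey c ->
  is_exp b c.
Proof.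
move=> Fx Fy exE eyE bE cE N.
have Fex := is_exp_F1 exE; have Fey := is_exp_F1 eyE.
apply: congF_trans (is_circ_sum N Fex Fey cE) _.
apply: (@congF_trans _ _ _ (exp_sum2 N (fun i j => Tl ([:: nseq i ex] ++ nseq j [:: y] ++ [::])))).
  apply: congF_sum => i _; apply: congFZ.
  exact: (level_exp char0 N Fy eyE (entriesF1_level (n := i) Fex) entriesF1_nil).
apply: (@congF_trans _ _ _ (exp_sum2 N (fun i j => Tl ([::] ++ nseq i [:: x] ++ nseq j [:: y] ++ [::])))).
  rewrite /exp_sum2; under eq_bigr => i _ do rewrite scaler_sumr.
  under [X in congF _ _ X]eq_bigr => i _ do rewrite scaler_sumr.
  rewrite exchange_big [X in congF _ _ X]exchange_big; apply: congF_sum => j _ /=.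
  under eq_bigr => i _ do rewrite scalerA mulrC -scalerA.
  under [X in congF _ _ X]eq_bigr => i _ do rewrite scalerA mulrC -scalerA.
  rewrite -!scaler_sumr; apply: congFZ; rewrite cats0.
  exact: (level_exp char0 N Fx exE entriesF1_nil (@entriesF1_nseq _ _ j _ Fy)).
rewrite exp_term_sum; apply: congF_sym.
exact: level_bch bE entriesF1_nil entriesF1_nil.
Qed.

Lemma is_exp_exists x : Fil 1 x -> exists e, is_exp x e.
Proof.
move=> Fx; apply: Fil_complete => p.
by rewrite big_ord_recr /= addrAC subrr add0r; apply: Fil_exp_term.
Qed.

Lemma Tl_nseq_congr p n x x' ls1 : Fil 1 x -> Fil 1 x' -> congF p x x' ->
    entriesF1 ls1 -> (1 <= size (flatten ls1))%N ->
  congF p.+1 (Tl (ls1 ++ nseq n [:: x])) (Tl (ls1 ++ nseq n [:: x'])).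
Proof.
move=> Fx Fx' xx'; elim: n ls1 => [|n IHn] ls1 F1 gt_1; first exact: congF_refl.
have Fctx : total_index (size (flatten (ls1 ++ [::] :: nseq n [:: x])))
    (flatten (ls1 ++ [::] :: nseq n [:: x])).
  apply/total_index_size/entriesF1_cat; split=> //; apply/entriesF1_cons; split=> //.
  exact: entriesF1_nseq.
apply: (@congF_trans _ _ _ (Tl (ls1 ++ [:: x'] :: nseq n [:: x]))).
  apply: (congF_leq _ (congF_entry xx' Fctx)).
  by rewrite -addn1 leq_add2l flatten_cat size_cat (leq_trans gt_1) // leq_addr.
rewrite -!cat_rcons; apply: IHn.
  rewrite -cats1; apply/entriesF1_cat; split=> //; apply/entriesF1_cons; split=> // a.
  by rewrite inE => /eqP->.
by rewrite -cats1 flatten_cat size_cat (leq_trans gt_1) // leq_addr.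
Qed.

Lemma exp_term1 x : exp_term x 1 = x.
Proof. by rewrite /exp_term factS fact0 invr1 scale1r Tl_level. Qed.

(** In the terms with at least two vertices, an error in one entry is multiplied
    by another entry, which lies in the first part of the filtration. *)
Lemma is_exp_contract p x x' e e' : Fil 1 x -> Fil 1 x' ->
    is_exp x e -> is_exp x' e' -> congF p x x' ->
  congF p.+1 (e - x) (e' - x').
Proof.
move=> Fx Fx' eE e'E xx'.
have tailE y f : is_exp y f -> congF p.+1 (f - y) (\sum_(n < p) exp_term y n.+2).
  move=> fE; have := congF_leq (leqnSn _) (fE p.+2).
  rewrite 2!big_ord_recl exp_term0 add0r exp_term1 => fE'.
  by rewrite /congF -addrA -opprD.
apply: congF_trans (tailE _ _ eE) _; apply: congF_trans (congF_sym (tailE _ _ e'E)).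
apply: congF_sum => n _; apply: congFZ.
have Fctx : total_index (size (flatten ([::] ++ [::] :: nseq n.+1 [:: x])))
    (flatten ([::] ++ [::] :: nseq n.+1 [:: x])).
  by apply: total_index_size => a; apply: (@entriesF1_nseq _ _ n.+1 _ Fx).
apply: (@congF_trans _ _ _ (Tl ([:: x'] :: nseq n.+1 [:: x]))).
  apply: (congF_leq _ (@congF_entry _ _ _ _ [::] [::] _ _ _ xx' Fctx)).
  by rewrite -addn1 leq_add2l.
apply: (@Tl_nseq_congr _ _ _ _ [:: [:: x']]) => // a.
by rewrite inE => /eqP->.
Qed.

Lemma is_exp_inj x x' e : Fil 1 x -> Fil 1 x' -> is_exp x e -> is_exp x' e -> x = x'.
Proof.
move=> Fx Fx' eE eE'; apply: congF_eq => N; elim: N => [|N IHN]; first exact: Fil_full.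
have := is_exp_contract Fx Fx' eE eE' IHN.
by rewrite /congF opprB addrC addrA subrK => /congF_sym.
Qed.

Lemma is_exp0 : is_exp (0 : A) 0.
Proof.
have F0 : Fil 1 (0 : A) by apply: Fil_0.
suff term0 n : exp_term (0 : A) n = 0.
  by move=> N; rewrite big1 //; apply: congF_refl.
case: n => [|n]; first exact: exp_term0.
rewrite /exp_term -[nseq n.+1 _]/([::] ++ [:: 0] :: nseq n [:: 0]).
by rewrite -[Tl _]/(Tl_entry [::] [::] _ 0) linear0 scaler0.
Qed.

Lemma is_exp_fil p x e : (0 < p)%N -> Fil p x -> is_exp x e -> Fil p e.
Proof.
move=> p_gt0 Fx eE; have Fx1 := Fil_leq p_gt0 Fx.
have xx0 : congF p x 0 by apply/congF0.
have := is_exp_contract Fx1 (Fil_0 _ _) eE is_exp0 xx0.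
by rewrite subrr => /congF0/Fil_desc Fex; rewrite -[e](subrK x); apply: FilD.
Qed.

Lemma is_exp_fil_inv p x e : Fil 1 x -> is_exp x e -> Fil p e -> Fil p x.
Proof.
move=> Fx eE Fe; suff Fq q : (q <= p)%N -> Fil q x by apply: Fq.
elim: q => [|q IHq] lt_q; first exact: Fil_full.
have xx0 : congF q x 0 by apply/congF0/IHq/ltnW.
have := is_exp_contract Fx (Fil_0 _ _) eE is_exp0 xx0.
rewrite subrr => /congF0 Fex; rewrite -[x](subKr e).
by apply: FilB Fex; apply: Fil_leq Fe.
Qed.

(** Solve x = e - (exp x - x) by successive approximations, which converge by
    [is_exp_contract]. *)
Lemma is_exp_surj e : Fil 1 e -> exists2 x, Fil 1 x & is_exp x e.
Proof.
move=> Fe; pose E x : A := epsilon (inhabits 0) (is_exp x).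
have EP x : Fil 1 x -> is_exp x (E x) by move=> /is_exp_exists; apply: epsilon_spec.
pose v := fix v n := if n is n'.+1 then e - (E (v n') - v n') else 0 : A.
have Fv n : Fil 1 (v n).
  elim: n => [|n IHn] /=; first exact: Fil_0.
  by apply/(FilB Fe)/FilB => //; apply/is_exp_F1/EP.
have v_step n : congF n (v n.+1) (v n).
  elim: n => [|n IHn]; first exact: Fil_full.
  have := is_exp_contract (Fv _) (Fv _) (EP _ (Fv n.+1)) (EP _ (Fv n)) IHn.
  exact: congFB (congF_refl _ _).
have [x xE] := Fil_complete v_step.
have Fx : Fil 1 x by apply: congF_Fil (xE 1%N) (Fv _).
exists x => //; suff <- : E x = e by apply: EP.
apply: congF_eq => -[|N]; first exact: Fil_full.
have Ev := is_exp_contract Fx (Fv N) (EP _ Fx) (EP _ (Fv N)) (xE N).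
have eE : e = v N.+1 + (E (v N) - v N) by rewrite /= subrK.
rewrite eE addrC -[E x](subrK x).
by apply: congFD (xE N.+1).
Qed.

Lemma Fil_bch_term x y d : Fil 1 x -> Fil 1 y ->
  Fil d (\sum_(ct <- bch_series k d) ct.1 *: lie_val x y ct.2).
Proof.
move=> Fx Fy; rewrite (big_all _ _ _ ((bch_seriesP char0).1 d)).
by apply: Fil_sum => ct /eqP <-; apply/FilZ/Fil_lie_val.
Qed.

Lemma is_bch_exists x y : Fil 1 x -> Fil 1 y -> exists b, is_bch x y b.
Proof.
move=> Fx Fy; apply: Fil_complete => p.
by rewrite big_ord_recr /= addrAC subrr add0r; apply: Fil_bch_term.
Qed.

Lemma is_bch_fil p x y b : (0 < p)%N -> Fil p x -> Fil p y -> is_bch x y b -> Fil p b.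
Proof.
move=> p_gt0 Fx Fy /(_ p)/congF_Fil; apply.
apply: Fil_sum => d _; apply: Fil_sum => ct _; apply: FilZ.
elim: ct.2 => [[]|t1 F1 t2 F2] //=.
by apply: FilB; apply: (Fil_leq (leq_addr p p)); apply: Fil_corolla1.
Qed.

Lemma exp_sum_inj b b' : Fil 1 b -> Fil 1 b' ->
    (forall N, congF N (\sum_(n < N) exp_term b n) (\sum_(n < N) exp_term b' n)) ->
  b = b'.
Proof.
move=> Fb Fb' bb'; have [e eE] := is_exp_exists Fb; apply: (is_exp_inj Fb Fb' eE) => N.
exact: congF_trans (eE N) (bb' N).
Qed.

Lemma bch_exp_sum x y b N : Fil 1 x -> Fil 1 y -> is_bch x y b ->
  congF N (\sum_(n < N) exp_term b n)
    (exp_sum2 N (fun i j => Tl (nseq i [:: x] ++ nseq j [:: y]))).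
Proof.
move=> Fx Fy bE; rewrite exp_term_sum.
apply: (@congF_trans _ _ _ (exp_sum2 N (fun i j =>
    Tl ([::] ++ nseq i [:: x] ++ nseq j [:: y] ++ [::])))).
  exact: (level_bch char0 Fx Fy N bE entriesF1_nil entriesF1_nil).
by apply: congF_exp_sum2 => i j; rewrite cats0; apply: congF_refl.
Qed.

(** Both sides have the same ordered exponential e^x e^y e^z. *)
Lemma is_bch_assoc x y z xy yz b b' : Fil 1 x -> Fil 1 y -> Fil 1 z ->
    is_bch x y xy -> is_bch y z yz -> is_bch x yz b -> is_bch xy z b' -> b = b'.
Proof.
move=> Fx Fy Fz xyE yzE bE b'E.
have Fxy := is_bch_fil (ltn0Sn 0) Fx Fy xyE; have Fyz := is_bch_fil (ltn0Sn 0) Fy Fz yzE.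
apply: exp_sum_inj => [||N].
- exact: is_bch_fil bE.
- exact: is_bch_fil b'E.
pose T3 := exp_sum2 N (fun i j => \sum_(l < N) (l`!%:R)^-1 *:
  Tl (nseq i [:: x] ++ nseq j [:: y] ++ nseq l [:: z])).
apply: (@congF_trans _ _ _ T3).
  apply: congF_trans (bch_exp_sum N Fx Fyz bE) _.
  apply: congF_sum => i _; apply: congFZ.
  have := level_bch char0 Fy Fz N yzE (entriesF1_nseq (n := i) Fx) entriesF1_nil.
  under eq_bigr => n _ do rewrite cats0.
  move/congF_trans; apply; apply: congF_sum => j _; apply: congFZ.
  by under eq_bigr => l _ do rewrite cats0; apply: congF_refl.
apply: congF_sym; apply: congF_trans (bch_exp_sum N Fxy Fz b'E) _.
rewrite /exp_sum2; under eq_bigr => i _ do rewrite scaler_sumr.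
rewrite exchange_big /=.
apply: (@congF_trans _ _ _ (\sum_(l < N) (l`!%:R)^-1 *: exp_sum2 N (fun i j =>
   Tl (nseq i [:: x] ++ nseq j [:: y] ++ nseq l [:: z])))).
  apply: congF_sum => l _.
  under eq_bigr => i _ do rewrite scalerA mulrC -scalerA.
  rewrite -scaler_sumr; apply: congFZ.
  exact: (level_bch char0 Fx Fy N xyE entriesF1_nil (entriesF1_nseq (n := l) Fz)).
rewrite /T3 /exp_sum2; under eq_bigr => l _ do rewrite scaler_sumr.
rewrite exchange_big; apply: congF_sum => i _ /=.
under eq_bigr => l _ do rewrite scalerA mulrC -scalerA scaler_sumr.
rewrite -scaler_sumr; apply: congFZ; rewrite exchange_big /=.
apply: congF_sum => j _; rewrite scaler_sumr; apply: congF_sum => l _.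
by rewrite scalerA mulrC -scalerA; apply: congF_refl.
Qed.

Lemma Tl_nseq_scale n a x ls1 ls2 :
  Tl (ls1 ++ nseq n [:: a *: x] ++ ls2) = a ^+ n *: Tl (ls1 ++ nseq n [:: x] ++ ls2).
Proof.
elim: n ls1 => [|n IHn] ls1; first by rewrite scale1r.
rewrite -[Tl _]/(Tl_entry ls1 [::] (nseq n [:: a *: x] ++ ls2) (a *: x)) linearZ.
rewrite -[X in _ *: X = _]/(Tl (ls1 ++ [:: x] :: nseq n [:: a *: x] ++ ls2)).
by rewrite -cat_rcons IHn cat_rcons scalerA exprS.
Qed.

Lemma sum_exp_coefs n (a : k) :
  \sum_(j < n.+1) ((j`!%:R)^-1 * ((n - j)`!%:R)^-1) * a ^+ j
    = (n`!%:R)^-1 * (1 + a) ^+ n.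
Proof.
rewrite exprDn mulr_sumr; apply: eq_bigr => j _; rewrite expr1n mul1r -[_ *+ 'C(n, j)]mulr_natl mulrA.
congr (_ * _); have le_j : (j <= n)%N by rewrite -ltnS.
rewrite -(bin_fact le_j) !natrM !invfM mulrAC mulVf ?mul1r //.
by rewrite (pcharf0P _).1 // -lt0n bin_gt0.
Qed.

(** This is e^x e^(a x) = e^((1 + a) x); a = -1 gives the inverses and a = 0 the
    right unit. *)
Lemma is_bch_scale x a b : Fil 1 x -> is_bch x (a *: x) b -> b = (1 + a) *: x.
Proof.
move=> Fx bE; have Fax : Fil 1 (a *: x) by apply: FilZ.
apply: exp_sum_inj => [||N]; first exact: is_bch_fil bE.
  exact: FilZ.
apply: congF_trans (bch_exp_sum N Fx Fax bE) _.
apply: congF_trans (exp_sum2_diag N _) _ => [i j|].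
  have F12 : entriesF1 (nseq i [:: x] ++ nseq j [:: a *: x]).
    by apply/entriesF1_cat; split; apply: entriesF1_nseq.
  have := Fil_Tl_size F12; rewrite size_flatten /shape map_cat !map_nseq sumn_cat.
  by rewrite !sumn_nseq !mul1n.
apply: congF_sum => n _.
rewrite /exp_term -[nseq n _ in X in congF _ _ X]cats0 (Tl_nseq_scale _ _ _ [::]) cats0.
rewrite scalerA -sum_exp_coefs scaler_suml; apply: congF_sum => j _.
have le_j : (j <= n)%N by rewrite -ltnS.
rewrite -[nseq j _]cats0 Tl_nseq_scale scalerA cats0 cat0s.
rewrite (_ : nseq (n - j) [:: x] ++ nseq j [:: x] = nseq n [:: x]); last first.
  by rewrite -nseqD subnK.
exact: congF_refl.
Qed.

Lemma is_bch0l x b : Fil 1 x -> is_bch 0 x b -> b = x.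
Proof.
move=> Fx bE; have F0 := Fil_0 A 1.
apply: exp_sum_inj => // [|N]; first exact: is_bch_fil bE.
apply: congF_trans (bch_exp_sum N F0 Fx bE) _.
case: N => [|N]; first exact: Fil_full.
rewrite /exp_sum2 big_ord_recl [X in congF _ (_ + X) _]big1 => [|i _].
  by rewrite addr0 fact0 invr1 scale1r; apply: congF_refl.
rewrite big1 ?scaler0 // => j _; rewrite lift0.
rewrite -[Tl _]/(Tl_entry [::] [::] (nseq i [:: 0] ++ nseq j [:: x]) 0).
by rewrite linear0 scaler0.
Qed.

End GaugeGroups.

(** * The degree-zero part of a complete Lie-graph algebra *)

Section DegreeZero.
Variables (k : fieldType) (g : completeLieGraphAlg k).

Lemma F0_0 p : F0 p (0 : g). Proof. by case: (@fil_subspace k g p 0). Qed.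

Definition deg0 : {pred g} :=
  fun x => if excluded_middle_informative (F0 0 x) then true else false.

Lemma deg0P (x : g) : reflect (F0 0 x) (x \in deg0).
Proof.
rewrite unfold_in /deg0.
by case: excluded_middle_informative => Fx; constructor.
Qed.

Fact deg0_submod : submod_closed deg0.
Proof.
case: (@fil_subspace k g 0 0) => F00 F0lin; split; first exact/deg0P.
by move=> a x y /deg0P Fx /deg0P Fy; apply/deg0P/F0lin.
Qed.

HB.instance Definition _ := GRing.isSubmodClosed.Build k g deg0 deg0_submod.

(** With a type of its own, homogeneity and signs disappear from the statements. *)
Record degree0 := Degree0 { degree0_val : g; degree0_P : degree0_val \in deg0 }.

HB.instance Definition _ := [isSub for degree0_val].
HB.instance Definition _ := [Choice of degree0 by <:].
HB.instance Definition _ := [SubChoice_isSubLmodule of degree0 by <:].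

Lemma degree0_F (x : degree0) : F0 0 (val x).
Proof. exact/deg0P/valP. Qed.

Lemma act_deg0 n (h : dsGra n) (x : {ffun 'I_n -> degree0}) :
  Defs.act h [ffun i => val (x i)] \in deg0.
Proof.
apply/deg0P/fil_full.
rewrite (_ : 0 = \sum_(i < n) (0 : int)); last by rewrite big1.
by apply: act_homog => i; rewrite ffunE; apply/fil_full/degree0_F.
Qed.

Definition gop0 n (h : dsGra n) (x : {ffun 'I_n -> degree0}) : degree0 :=
  Degree0 (act_deg0 h x).

Lemma gop0_multilinear n (h : dsGra n) (x : {ffun 'I_n -> degree0})
    (i : 'I_n) (a : k) (u v : degree0) :
  gop0 h (update x i (a *: u + v)) = a *: gop0 h (update x i u) + gop0 h (update x i v).
Proof.
have updE w : [ffun j => val (update x i w j)] = update [ffun j => val (x j)] i (val w).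
  by apply/ffunP => j; rewrite !ffunE; case: eqP.
apply: val_inj; rewrite [RHS]linearP /= !updE.
by rewrite linearP act_multilinear.
Qed.

Lemma gop0_unit (x : {ffun 'I_1 -> degree0}) : gop0 vertex_graph x = x ord0.
Proof. by apply: val_inj; rewrite /= act_unit ffunE. Qed.

Lemma gop0_equivariant n (s : 'S_n) (h h' : dsGra n) (x : {ffun 'I_n -> degree0}) :
  giso s h h' -> gop0 h' x = gop0 h [ffun a => x (s a)].
Proof.
move=> hh'; apply: val_inj => /=.
rewrite (act_equivariant (d := fun=> 0) hh') => [|i]; last first.
  by rewrite ffunE; apply/fil_full/degree0_F.
rewrite /koszul big1 // scale1r; congr Defs.act.
by apply/ffunP => a; rewrite !ffunE.
Qed.

Lemma gop0_comp n1 n2 (g1 : dsGra n1.+1) (i : 'I_n1.+1)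
    (g2 : dsGra n2.+1) (x : {ffun 'I_(n1 + n2).+1 -> degree0}) :
  gop0 g1 [ffun j => if j == i then gop0 g2 [ffun b => x (inner_label i b)]
                      else x (outer_label n2 i j)]
    = \sum_(h : dsGra (n1 + n2).+1 | is_insertion g1 i g2 h) gop0 h x.
Proof.
apply: val_inj; rewrite raddf_sum /= -act_comp; congr Defs.act.
apply/ffunP => j; rewrite !ffunE; case: eqP => // _ /=.
by congr Defs.act; apply/ffunP => b; rewrite !ffunE.
Qed.

Definition degree0_graphAlg : graphAlg k := GraphAlg gop0_multilinear gop0_unit
  gop0_equivariant gop0_comp.

Definition Fil0 p (x : degree0_graphAlg) : Prop := F0 p (val (x : degree0)).

Lemma Fil0_subspace p : subspace (Fil0 p).
Proof.
case: (@fil_subspace k g p 0) => F00 F0lin; split; first by rewrite /Fil0 raddf0.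
by move=> a x y Fx Fy; rewrite /Fil0 linearP; apply: F0lin.
Qed.

Lemma Fil0_gop n (h : dsGra n) (x : {ffun 'I_n -> degree0_graphAlg}) (p : 'I_n -> nat) :
  (forall i, Fil0 (p i) (x i)) -> Fil0 (\sum_i p i)%N (gop h x).
Proof.
move=> Fx; rewrite /Fil0 /F0 /= (_ : 0 = \sum_(i < n) (0 : int)); last by rewrite big1.
by apply: fil_act => i; rewrite ffunE; apply: Fx.
Qed.

Lemma Fil0_separated (x : degree0_graphAlg) : (forall p, Fil0 p x) -> x = 0.
Proof. by move=> Fx; apply: val_inj; rewrite raddf0; apply: fil_separated Fx. Qed.

Lemma Fil0_complete (v : nat -> degree0_graphAlg) :
  (forall p, Fil0 p (v p.+1 - v p)) -> exists x, forall p, Fil0 p (x - v p).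
Proof.
move=> Fv; have [||x Hx xE] := @fil_complete _ g 0 (fun p => val (v p : degree0)).
- by move=> p; apply/fil_full/degree0_F.
- by move=> p; have := Fv p; rewrite /Fil0 raddfB.
have x_deg0 : x \in deg0 by apply/deg0P/fil_full.
by exists (Degree0 x_deg0 : degree0) => p; rewrite /Fil0 raddfB; apply: xE.
Qed.

Definition degree0_filteredAlg : filteredAlg k :=
  FilteredAlg Fil0_subspace degree0_F (fun p x => @fil_desc _ g p 0 (val (x : degree0)))
    Fil0_gop Fil0_separated Fil0_complete.

Local Notation A := degree0_filteredAlg.
Definition v0 (x : A) : g := val (x : degree0).

Fact v0_linear : linear v0.
Proof. by move=> a X Y; apply: linearP. Qed.

HB.instance Definition _ := GRing.isLinear.Build k A g *:%R v0 v0_linear.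

Lemma lift0 x : F0 1 x -> exists2 X : A, v0 X = x & Fil 1 X.
Proof.
move=> Fx; have x_deg0 : x \in deg0 by apply/deg0P/fil_desc.
by exists (Degree0 x_deg0 : degree0).
Qed.

(** The filtration is separated, so that sums are unique. *)
Lemma infinite_sumE (u : nat -> g) (U : nat -> A) (S : A) :
    (forall n, u n = v0 (U n)) -> (forall N, congF N S (\sum_(n < N) U n)) ->
    (forall n, Fil n (U n)) ->
  infinite_sum u = v0 S.
Proof.
move=> uU SE FU.
have S_sum : has_sum u (v0 S).
  move=> p; exists p => m le_pm.
  have -> : \sum_(n < m) u n = v0 (\sum_(n < m) U n).
    by rewrite raddf_sum; apply: eq_bigr => n _; apply: uU.
  have := congF_leq le_pm (SE m); rewrite /congF /= /Fil0.
  by rewrite raddfB.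
have inf_sum : has_sum u (infinite_sum u).
  by apply: epsilon_spec; exists (v0 S).
apply/eqP; rewrite -subr_eq0; apply/eqP/(fil_separated (d := 0)) => p.
have [M1 sum1] := S_sum p; have [M2 sum2] := inf_sum p.
have := sum1 _ (leq_maxl M1 M2); have := sum2 _ (leq_maxr M1 M2).
move: (\sum_(n < _) u n) => s F2 F1.
case: (@fil_subspace k g p 0) => _ /(_ (-1) _ _ F1 F2).
by rewrite scaleN1r opprB addrC addrA subrK.
Qed.

End DegreeZero.

(** * The two groups *)

Section Translation.
Variables (k : fieldType) (char0 : [pchar k] =i pred0) (g : completeLieGraphAlg k).
Local Notation A := (degree0_filteredAlg g).
Implicit Types (X Y B E : A).

Lemma star_v0 X Y : star (v0 X) (v0 Y) = v0 (corolla [:: X] Y).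
Proof.
rewrite corolla1 /star /v0 /=; congr Defs.act.
by apply/ffunP => i; rewrite !ffunE; case: eqP.
Qed.

Lemma lie_eval_v0 X Y t : lie_eval (v0 X) (v0 Y) t = v0 (lie_val X Y t).
Proof.
elim: t => [[]|t1 IH1 t2 IH2] //=.
by rewrite IH1 IH2 /bracket !star_v0 raddfB.
Qed.

Lemma bch_v0 X Y B : Fil 1 X -> Fil 1 Y -> is_bch X Y B -> bch (v0 X) (v0 Y) = v0 B.
Proof.
move=> FX FY BE; 
apply: (infinite_sumE (U := fun n => \sum_(ct <- bch_series k n) ct.1 *: lie_val X Y ct.2)
  _ BE) => n; last exact: Fil_bch_term.
rewrite linear_sum; apply: eq_bigr => ct _.
by rewrite lie_eval_v0 linearZ.
Qed.

Lemma graph_exp_v0 X E : Fil 1 X -> is_exp X E ->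
  graph_exp (v0 X : gauge_group g) = OnePlus (v0 E).
Proof.
move=> FX EE; congr OnePlus; apply: (infinite_sumE (U := exp_term X) _ EE) => n; last exact: Fil_exp_term.
rewrite -exp_term_classes // linear_sum; apply: eq_bigr => h _.
rewrite linearZ; congr (_ *: Defs.act h _).
by apply/ffunP => a; rewrite !ffunE.
Qed.

Lemma circ_v0 X Y (C : A) : Fil 1 X -> Fil 1 Y -> is_circ X Y C ->
  circledcirc (OnePlus (v0 X)) (OnePlus (v0 Y)) = OnePlus (v0 C).
Proof.
move=> FX FY CE; congr OnePlus; apply: (infinite_sumE (U := circ_term X Y) _ CE) => n; last exact: Fil_circ_term.
rewrite -circ_term_classes // linear_sum; apply: eq_bigr => h _.
rewrite linearZ; congr (_ *: Defs.act h.1 _).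
by apply/ffunP => a; rewrite !ffunE; case: ifP.
Qed.

Implicit Types (x y z : gauge_group g) (u v w : deformation_gauge_group g).

Lemma F0_leq p q (x : g) : (p <= q)%N -> F0 q x -> F0 p x.
Proof.
move=> /subnK <-; elim: (q - p)%N => [|d IHd] //; rewrite addSn => /fil_desc.
exact: IHd.
Qed.

Lemma lift_fil p (x : g) : (0 < p)%N -> F0 p x -> exists2 X : A, v0 X = x & Fil p X.
Proof.
move=> p_gt0 Fx; have [X Xx FX] := lift0 (F0_leq p_gt0 Fx).
by exists X; rewrite // /Fil /= /Fil0 -/(v0 X) Xx.
Qed.

Lemma bch_fil p x y : (0 < p)%N -> F0 p x -> F0 p y -> F0 p (bch x y).
Proof.
move=> p_gt0 /(lift_fil p_gt0)[X <- FX] /(lift_fil p_gt0)[Y <- FY].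
have [FX1 FY1] := (Fil_leq p_gt0 FX, Fil_leq p_gt0 FY).
have [B BE] := is_bch_exists char0 FX1 FY1.
by rewrite (bch_v0 FX1 FY1 BE); apply: is_bch_fil BE.
Qed.

Lemma bchA x y z : F0 1 x -> F0 1 y -> F0 1 z -> bch x (bch y z) = bch (bch x y) z.
Proof.
move=> /lift0[X <- FX] /lift0[Y <- FY] /lift0[Z <- FZ].
have [XY XYE] := is_bch_exists char0 FX FY; have [YZ YZE] := is_bch_exists char0 FY FZ.
have FXY := is_bch_fil (ltn0Sn 0) FX FY XYE.
have FYZ := is_bch_fil (ltn0Sn 0) FY FZ YZE.
have [B BE] := is_bch_exists char0 FX FYZ; have [B' B'E] := is_bch_exists char0 FXY FZ.
rewrite (bch_v0 FX FY XYE) (bch_v0 FY FZ YZE) (bch_v0 FX FYZ BE) (bch_v0 FXY FZ B'E).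
by congr v0; apply: is_bch_assoc XYE YZE BE B'E.
Qed.

Lemma bch_scale x (a : k) : F0 1 x -> bch x (a *: x) = (1 + a) *: x.
Proof.
move=> /lift0[X <- FX]; have FaX : Fil 1 (a *: X) by apply: FilZ.
have [B BE] := is_bch_exists char0 FX FaX.
have vZ c : v0 (c *: X) = c *: v0 X by rewrite linearZ.
by rewrite -vZ (bch_v0 FX FaX BE) (is_bch_scale char0 FX BE) vZ.
Qed.

Lemma v0_0 : v0 (0 : A) = 0. Proof. exact: raddf0. Qed.

Lemma bch0x x : F0 1 x -> bch 0 x = x.
Proof.
move=> /lift0[X <- FX]; have FZ := Fil_0 A 1.
have [B BE] := is_bch_exists char0 FZ FX.
by rewrite -v0_0 (bch_v0 FZ FX BE) (is_bch0l char0 FX BE).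
Qed.

Lemma bchx0 x : F0 1 x -> bch x 0 = x.
Proof. by move=> Fx; rewrite -[0 in LHS](scale0r x) bch_scale // addr0 scale1r. Qed.

Lemma bchxN x : F0 1 x -> bch x (- x) = 0.
Proof. by move=> Fx; rewrite -scaleN1r bch_scale // subrr scale0r. Qed.

Lemma F0N p (x : g) : F0 p x -> F0 p (- x).
Proof.
case: (@fil_subspace k g p 0) => F00 /(_ (-1) x 0) Flin Fx.
by rewrite -scaleN1r -[_ *: x]addr0; apply: Flin.
Qed.

Lemma gauge_group_is_group : is_filtered_group (gauge_group g).
Proof.
split=> /=.
- by move=> p u _; apply: fil_desc.
- by move=> p _; apply: F0_0.
- by move=> p u v p_gt0; apply: bch_fil.
- move=> p u p_gt0 Fu; have Fu1 := F0_leq p_gt0 Fu; have FNu := F0N Fu1.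
  exists (- u); split; [exact: F0N | exact: bchxN|].
  by have := bchxN FNu; rewrite opprK.
- exact: bchA.
by move=> u Fu; split; [apply: bch0x | apply: bchx0].
Qed.

Lemma graph_exp_bch x y : F0 1 x -> F0 1 y ->
  graph_exp (bch x y : gauge_group g) = circledcirc (graph_exp x) (graph_exp y).
Proof.
move=> /lift0[X <- FX] /lift0[Y <- FY].
have [B BE] := is_bch_exists char0 FX FY.
have FB := is_bch_fil (ltn0Sn 0) FX FY BE.
have [EX EXE] := is_exp_exists FX; have [EY EYE] := is_exp_exists FY.
have [C CE] := is_circ_exists (is_exp_F1 EXE) (is_exp_F1 EYE).
rewrite (bch_v0 FX FY BE) (graph_exp_v0 FX EXE) (graph_exp_v0 FY EYE).
rewrite (circ_v0 (is_exp_F1 EXE) (is_exp_F1 EYE) CE).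
exact: graph_exp_v0 FB (is_exp_bch char0 FX FY EXE EYE BE CE).
Qed.

Lemma graph_exp0 : graph_exp (0 : gauge_group g) = OnePlus 0.
Proof. by rewrite -v0_0 (graph_exp_v0 (Fil_0 A 1) (is_exp0 A)). Qed.

Lemma graph_exp_fil p x : (0 < p)%N -> F0 p x -> F0 p (one_plus_tail (graph_exp x)).
Proof.
move=> p_gt0 /(lift_fil p_gt0)[X <- FX]; have FX1 := Fil_leq p_gt0 FX.
have [E EE] := is_exp_exists FX1.
by rewrite (graph_exp_v0 FX1 EE); apply: is_exp_fil FX EE.
Qed.

Lemma graph_exp_fil_inv p x : F0 1 x -> F0 p (one_plus_tail (graph_exp x)) -> F0 p x.
Proof.
move=> /lift0[X <- FX]; have [E EE] := is_exp_exists FX.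
by rewrite (graph_exp_v0 FX EE) => FE; apply: (is_exp_fil_inv FX EE).
Qed.

Lemma graph_exp_inj x y : F0 1 x -> F0 1 y -> graph_exp x = graph_exp y -> x = y.
Proof.
move=> /lift0[X <- FX] /lift0[Y <- FY].
have [E EE] := is_exp_exists FX; have [E' E'E] := is_exp_exists FY.
rewrite (graph_exp_v0 FX EE) (graph_exp_v0 FY E'E) => -[/val_inj EE'].
by rewrite -EE' in E'E; rewrite (is_exp_inj FX FY EE E'E).
Qed.

Lemma graph_logP u : F0 1 (one_plus_tail u) ->
  F0 1 (graph_log u) /\ graph_exp (graph_log u) = u.
Proof.
case: u => e /= /lift0[E <- FE].
apply: (epsilon_spec _ (fun x => F0 1 x /\ graph_exp x = OnePlus (v0 E))).
have [X FX XE] := is_exp_surj FE.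
by exists (v0 X); split=> //; apply: graph_exp_v0.
Qed.

Lemma graph_expK x : F0 1 x -> graph_log (graph_exp x) = x.
Proof.
move=> Fx; have [Fl El] := graph_logP (graph_exp_fil (ltn0Sn 0) Fx).
exact: graph_exp_inj.
Qed.

Lemma graph_log_fil p u : (0 < p)%N -> F0 p (one_plus_tail u) -> F0 p (graph_log u).
Proof.
move=> p_gt0 Fu; have [Fl El] := graph_logP (F0_leq p_gt0 Fu).
by apply: graph_exp_fil_inv => //; rewrite El.
Qed.

(** Every element is a graph exponential, so that the axioms hold because they
    hold in the gauge group. *)
Lemma deformation_gauge_group_is_group :
  is_filtered_group (deformation_gauge_group g).
Proof.
have [_ _ _ fV mA m1] := gauge_group_is_group.
have expE u : F0 1 (one_plus_tail u) -> exists2 x, F0 1 x & u = graph_exp x.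
  by move=> /graph_logP[Fl El]; exists (graph_log u).
split.
- by move=> p u _; apply: fil_desc.
- by move=> p _; apply: F0_0.
- move=> p u v p_gt0 Fu Fv.
  have [[Flu Elu] [Flv Elv]] := (graph_logP (F0_leq p_gt0 Fu), graph_logP (F0_leq p_gt0 Fv)).
  rewrite -Elu -Elv -[fg_mul _ _]/(circledcirc _ _) -graph_exp_bch //.
  by apply: graph_exp_fil => //; apply: bch_fil => //; apply: graph_log_fil.
- move=> p u p_gt0 Fu; have [Fl El] := graph_logP (F0_leq p_gt0 Fu).
  have [x [Fx ux xu]] := fV p _ p_gt0 (graph_log_fil p_gt0 Fu).
  have Fx1 : F0 1 x := F0_leq p_gt0 Fx.
  exists (graph_exp x); split; first exact: graph_exp_fil.
    rewrite -{1}El -[fg_mul _ _]/(circledcirc _ _) -graph_exp_bch //.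
    by rewrite (ux : bch (graph_log u) x = 0) graph_exp0.
  rewrite -{1}El -[fg_mul _ _]/(circledcirc _ _) -graph_exp_bch //.
  by rewrite (xu : bch x (graph_log u) = 0) graph_exp0.
- move=> _ _ _ /expE[x Fx ->] /expE[y Fy ->] /expE[z Fz ->].
  have [Fxy Fyz] := (bch_fil (ltn0Sn 0) Fx Fy, bch_fil (ltn0Sn 0) Fy Fz).
  rewrite -![fg_mul _ _]/(circledcirc _ _) -!graph_exp_bch //.
  by rewrite bchA.
move=> _ /expE[x Fx ->]; rewrite -[fg_one _]graph_exp0 -![fg_mul _ _]/(circledcirc _ _).
have F0' := F0_0 g 1.
by rewrite -!graph_exp_bch // bch0x ?bchx0.
Qed.

(** The translate by u of a part of the filtration is mapped into the translate
    by f u of the part of the same index. *)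
Lemma filtered_morphism_continuous (G H : filteredData) (f : G -> H) :
  is_filtered_group G -> is_filtered_morphism f -> fg_continuous f.
Proof.
move=> grpG [_ fM f_fil] U [U_car U_open]; split=> [u [] //|u [Gu Ufu]].
have [p p_gt0 Up] := U_open _ Ufu; exists p => // h Fh.
have Gh : fg_carrier h.
  elim: p p_gt0 {Up} Fh => // p IHp _ Fh; case: p IHp Fh => // p IHp Fh.
  by apply: IHp => //; apply: fg_desc Fh.
split; first exact: fg_filM.
by rewrite fM //; apply/Up/f_fil.
Qed.

End Translation.

Theorem theorem2p22 (k : fieldType) (char0 : [pchar k]%R =i pred0)
    (g : completeLieGraphAlg k) :
  [/\ is_filtered_group (gauge_group g),
      is_filtered_group (deformation_gauge_group g),
      is_filtered_isomorphism (@graph_exp k g) (@graph_log k g),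
      fg_continuous (@graph_exp k g)
    & fg_continuous (@graph_log k g)].
Proof.
have grpG := gauge_group_is_group char0 g.
have grpH := deformation_gauge_group_is_group char0 g.
have exp_mor : is_filtered_morphism (@graph_exp k g).
  split; first exact: graph_exp0.
    by move=> x y; apply: graph_exp_bch.
  by move=> p x; apply: graph_exp_fil.
have log_mor : is_filtered_morphism (@graph_log k g).
  split.
  - have F01 : F0 1 (0 : g) := F0_0 g 1.
    by have := graph_expK char0 F01; rewrite graph_exp0.
  - move=> u v Fu Fv.
    have [[Flu Elu] [Flv Elv]] := (graph_logP char0 Fu, graph_logP char0 Fv).
    rewrite -{1}Elu -{1}Elv -[fg_mul (graph_exp _) _]/(circledcirc _ _).
    by rewrite -graph_exp_bch // graph_expK //; apply: bch_fil.
  by move=> p u; apply: graph_log_fil.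
split=> //; last 2 first.
- exact: filtered_morphism_continuous.
- exact: filtered_morphism_continuous.
split=> // [u|u]; first exact: graph_expK.
by case/(graph_logP char0).
Qed.
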